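(* Let $\Bbbk$ be a commutative ring, $z,t\in\Bbbk^\times$, and let $f(w)=f_0w^l+f_1w^{l-1}+\cdots+f_l\in\Bbbk[w]$ be a polynomial of degree $l\ge0$ with $f_0=1$ and $f_l=t^2$. There is a unique strict $\Bbbk$-linear monoidal functor $$\Psi_f:\mathcal{H}eis_{-l}(z,t)\to\mathcal{E}nd_\Bbbk\Big(\bigoplus_{n\ge0}H_n^f\text{-mod}\Big)$$ sending the generating object $\uparrow$ (resp. $\downarrow$) to the additive endofunctor that takes an $H_n^f$-module $M$ to $\operatorname{ind}_n^{n+1}M$ (resp. $\operatorname{res}^n_{n-1}M$), and the generating morphisms $x,\tau,c,d$ to the natural transformations defined on an $H_n^f$-module $M$ as follows: (a) $\Psi_f(x)_M:H_{n+1}^f\otimes_{H_n^f}M\to H_{n+1}^f\otimes_{H_n^f}M$, $u\otimes v\mapsto ux_{n+1}\otimes v$; (b) $\Psi_f(\tau)_M:H_{n+2}^f\otimes_{H_n^f}M\to H_{n+2}^f\otimes_{H_n^f}M$, $u\otimes v\mapsto u\tau_{n+1}\otimes v$ (identifying $\operatorname{ind}_{n+1}^{n+2}\circ\operatorname{ind}_n^{n+1}$ with $\operatorname{ind}_n^{n+2}$ in the obvious way); (c) $\Psi_f(c)_M:M\to\operatorname{res}^{n+1}_n(H_{n+1}^f\otimes_{H_n^f}M)$, $v\mapsto1\otimes v$, i.e. the unit of the canonical adjunction making $(\operatorname{ind}_n^{n+1},\operatorname{res}_n^{n+1})$ an adjoint pair; (d) $\Psi_f(d)_M:H_n^f\otimes_{H_{n-1}^f}(\operatorname{res}^n_{n-1}M)\to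 M$, $u\otimes v\mapsto uv$, i.e. the counit of the canonical adjunction making $(\operatorname{ind}_{n-1}^n,\operatorname{res}_{n-1}^n)$ an adjoint pair.
   Context: $\mathcal{E}nd_\Bbbk(\mathcal C)$ is the strict monoidal category of $\Bbbk$-linear endofunctors of $\mathcal C$ and natural transformations, with tensor product given by composition of functors. In a strict monoidal category, $f\circ g$ means $f$ after $g$; $\mathbf 1$ is the unit object. **Cyclotomic Hecke algebras.** The affine Hecke algebra $AH_n$ is the $\Bbbk$-algebra with generators $x_1^{\pm1},\dots,x_n^{\pm1},\tau_1,\dots,\tau_{n-1}$ and relations: the $x_i$ commute; $\tau_jx_j\tau_j=x_{j+1}$; $\tau_jx_i=x_i\tau_j$ for $i\ne j,j+1$; $\tau_j^2=z\tau_j+1$; $\tau_i\tau_j=\tau_j\tau_i$ for $|i-j|>1$; $\tau_i\tau_{i+1}\tau_i=\tau_{i+1}\tau_i\tau_{i+1}$. $H_n^f$ is the quotient of $AH_n$ by the two-sided ideal generated by $f(x_1)$, with $H_0^f=\Bbbk$. The homomorphism $H_n^f\to H_{n+1}^f$ sending generators to generators of the same name is injective and is used to view $H_n^f\subseteq H_{n+1}^f$. $H_n^f\text{-mod}$ is the category of left modules, $\operatorname{ind}_n^{n+1}=H_{n+1}^f\otimes_{H_n^f}-$ and $\operatorname{res}_n^{n+1}$ is restriction (restriction of $H_0^f$-modules is zero). **Quantum Heisenberg category.** For $k\in\mathbb Z$, $\mathcal{H}eis_k(z,t)$ is the strict $\Bbbk$-linear monoidal category with generating objects $\uparrow,\downarrow$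 and the following generating morphisms and relations (here it is used with $k=-l\le0$). (i) $x:\uparrow\to\uparrow$, invertible, and $\tau:\uparrow\otimes\uparrow\to\uparrow\otimes\uparrow$, with $\tau\circ(1_\uparrow\otimes x)\circ\tau=x\otimes 1_\uparrow$, $\tau\circ\tau=z\tau+1_{\uparrow\otimes\uparrow}$, $(\tau\otimes1_\uparrow)\circ(1_\uparrow\otimes\tau)\circ(\tau\otimes1_\uparrow)=(1_\uparrow\otimes\tau)\circ(\tau\otimes1_\uparrow)\circ(1_\uparrow\otimes\tau)$. (ii) $c:\mathbf 1\to\downarrow\otimes\uparrow$ and $d:\uparrow\otimes\downarrow\to\mathbf 1$ with $(d\otimes1_\uparrow)\circ(1_\uparrow\otimes c)=1_\uparrow$ and $(1_\downarrow\otimes d)\circ(c\otimes1_\downarrow)=1_\downarrow$. (iii) Let $\sigma_+:=(1_\downarrow\otimes1_\uparrow\otimes d)\circ(1_\downarrow\otimes\tau\otimes1_\downarrow)\circ(c\otimes1_\uparrow\otimes1_\downarrow):\uparrow\otimes\downarrow\to\downarrow\otimes\uparrow$. Let $M_k$ be, if $k\ge0$, the column matrix with entries $\sigma_+,\ d\circ(x^{a}\otimes1_\downarrow)\ (a=0,\dots,k-1)$, a morphism $\uparrow\otimes\downarrow\to(\downarrow\otimes\uparrow)\oplus\mathbf 1^{\oplus k}$ in the additive envelope; if $k<0$, the row matrix with entries $\sigma_+,\ (1_\downarrow\otimes x^{a})\circ c\ (a=0,\dots,-k-1)$, a morphism $(\uparrow\otimes\downarrow)\oplus\mathbf 1^{\oplus(-k)}\to\downarrow\otimes\uparrow$.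 Adjoin as generators the entries of a two-sided inverse of $M_k$: this inverse is the row $[L,\eta_0,\dots,\eta_{k-1}]$ if $k\ge0$, and the column with entries $L,\varepsilon_0,\dots,\varepsilon_{-k-1}$ if $k<0$, where $L:\downarrow\otimes\uparrow\to\uparrow\otimes\downarrow$, $\eta_a:\mathbf 1\to\uparrow\otimes\downarrow$, $\varepsilon_a:\downarrow\otimes\uparrow\to\mathbf 1$. (iv) Define $c':\mathbf 1\to\uparrow\otimes\downarrow$ by $c':=-t^{-1}z^{-1}(x^{-1}\otimes1_\downarrow)\circ\eta_{k-1}$ if $k>0$, $c':=t\,L\circ c$ if $k=0$, $c':=t^{-1}L\circ(1_\downarrow\otimes x^{-k})\circ c$ if $k<0$; and $d':\downarrow\otimes\uparrow\to\mathbf 1$ by $d':=t\,d\circ(x^k\otimes1_\downarrow)\circ L$ if $k\ge0$, $d':=-t^{-1}z^{-1}\varepsilon_0$ if $k<0$. Impose: $d\circ c'=tz^{-1}1_{\mathbf 1}$ if $k>0$; $d\circ c'=(tz^{-1}-t^{-1}z^{-1})1_{\mathbf 1}$ if $k=0$; $d'\circ(1_\downarrow\otimes x^{-k})\circ c=tz^{-1}1_{\mathbf 1}$ if $k<0$. *)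

(* Defs.v *)
From HB Require Import structures.
From mathcomp Require Import all_boot all_order all_algebra generic_quotient.
From mathcomp Require Import boolp.
From Stdlib Require Import RelationClasses.

Set Implicit Arguments.
Unset Strict Implicit.
Unset Printing Implicit Defensive.

Import GRing.Theory.
Local Open Scope ring_scope.
Local Open Scope quotient_scope.

Section Quot.
Variables (T : Type) (E : T -> T -> Prop) (eqvE : Equivalence E).

Definition quot_rel (x y : {classic T}) : bool := `[< E x y >].

Lemma quot_rel_refl : reflexive quot_rel.
Proof. by move=> x; apply/asboolP; reflexivity. Qed.

Lemma quot_rel_sym : symmetric quot_rel.
Proof. by move=> x y; apply/asbool_equiv_eq; split=> h; symmetry. Qed.

Lemma quot_rel_trans : transitive quot_rel.
Proof.
by move=> y x w /asboolP xy /asboolP yw; apply/asboolP; transitivity y.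
Qed.

Canonical quot_equiv :=
  EquivRel quot_rel quot_rel_refl quot_rel_sym quot_rel_trans.

Definition quot := {eq_quot quot_equiv}.
HB.instance Definition _ := Choice.on quot.

Definition cls (x : T) : quot := \pi_({eq_quot quot_equiv}) (x : {classic T}).
Definition rep (q : quot) : T := repr (q : {eq_quot quot_equiv}).

Lemma rep_clsK q : cls (rep q) = q.
Proof. exact: reprK. Qed.

Lemma cls_eqP x y : cls x = cls y <-> E x y.
Proof.
split=> [/eqquotP /asboolP //|exy]; apply/eqquotP; exact/asboolP.
Qed.

Lemma rep_cls x : E (rep (cls x)) x.
Proof. by apply/cls_eqP; rewrite rep_clsK. Qed.

Lemma quot_ind (P : quot -> Prop) : (forall x, P (cls x)) -> forall q, P q.
Proof. by move=> h q; rewrite -(rep_clsK q). Qed.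

End Quot.

(** MathComp's [algType] requires 1 != 0, but a cyclotomic Hecke algebra may be
   the zero ring (for instance when l = 0 and n > 0). *)

Record pzalg (k : comPzRingType) := PzAlg {
  alg_ring :> pzRingType;
  scal : {rmorphism k -> alg_ring};
  scal_central : forall a (x : alg_ring), scal a * x = x * scal a }.
Arguments scal {k} A : rename.

Section FreeAlgebra.
Variables (k : comPzRingType) (X : Type).

Inductive fterm : Type :=
| FVar of X
| FConst of k
| FAdd of fterm & fterm
| FOpp of fterm
| FMul of fterm & fterm.

Inductive feq : fterm -> fterm -> Prop :=
| feq_refl u : feq u u
| feq_sym u v : feq u v -> feq v u
| feq_trans u v w : feq u v -> feq v w -> feq u w
| feq_add u u' v v' : feq u u' -> feq v v' -> feq (FAdd u v) (FAdd u' v')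
| feq_opp u u' : feq u u' -> feq (FOpp u) (FOpp u')
| feq_mul u u' v v' : feq u u' -> feq v v' -> feq (FMul u v) (FMul u' v')
| feq_addA u v w : feq (FAdd u (FAdd v w)) (FAdd (FAdd u v) w)
| feq_addC u v : feq (FAdd u v) (FAdd v u)
| feq_add0 u : feq (FAdd (FConst 0) u) u
| feq_addN u : feq (FAdd (FOpp u) u) (FConst 0)
| feq_mulA u v w : feq (FMul u (FMul v w)) (FMul (FMul u v) w)
| feq_1mul u : feq (FMul (FConst 1) u) u
| feq_mul1 u : feq (FMul u (FConst 1)) u
| feq_mulDl u v w : feq (FMul (FAdd u v) w) (FAdd (FMul u w) (FMul v w))
| feq_mulDr u v w : feq (FMul u (FAdd v w)) (FAdd (FMul u v) (FMul u w))
| feq_constD a b : feq (FConst (a + b)) (FAdd (FConst a) (FConst b))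
| feq_constM a b : feq (FConst (a * b)) (FMul (FConst a) (FConst b))
| feq_constC a u : feq (FMul (FConst a) u) (FMul u (FConst a)).

Lemma feq_equiv : Equivalence feq.
Proof.
split; [exact: feq_refl | exact: feq_sym | exact: feq_trans].
Qed.

Definition free_carrier := quot feq_equiv.
HB.instance Definition _ := Choice.on free_carrier.

Local Notation fcls := (cls feq_equiv).
Local Notation frep := (@rep _ _ feq_equiv).

Definition free_add (u v : free_carrier) : free_carrier :=
  fcls (FAdd (frep u) (frep v)).
Definition free_opp (u : free_carrier) : free_carrier := fcls (FOpp (frep u)).
Definition free_mul (u v : free_carrier) : free_carrier :=
  fcls (FMul (frep u) (frep v)).
Definition free_const (a : k) : free_carrier := fcls (FConst a).

Lemma free_addE u v : free_add (fcls u) (fcls v) = fcls (FAdd u v).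
Proof. by apply/cls_eqP/feq_add; apply: rep_cls. Qed.
Lemma free_oppE u : free_opp (fcls u) = fcls (FOpp u).
Proof. by apply/cls_eqP/feq_opp; apply: rep_cls. Qed.
Lemma free_mulE u v : free_mul (fcls u) (fcls v) = fcls (FMul u v).
Proof. by apply/cls_eqP/feq_mul; apply: rep_cls. Qed.
Let freeE := (free_addE, free_oppE, free_mulE).

Lemma free_addA : associative free_add.
Proof.
elim/quot_ind=> u; elim/quot_ind=> v; elim/quot_ind=> w.
by rewrite !freeE; apply/cls_eqP/feq_addA.
Qed.
Lemma free_addC : commutative free_add.
Proof.
elim/quot_ind=> u; elim/quot_ind=> v.
by rewrite !freeE; apply/cls_eqP/feq_addC.
Qed.
Lemma free_add0 : left_id (free_const 0) free_add.
Proof. by elim/quot_ind=> u; rewrite !freeE; apply/cls_eqP/feq_add0. Qed.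
Lemma free_addN : left_inverse (free_const 0) free_opp free_add.
Proof. by elim/quot_ind=> u; rewrite !freeE; apply/cls_eqP/feq_addN. Qed.
Lemma free_mulA : associative free_mul.
Proof.
elim/quot_ind=> u; elim/quot_ind=> v; elim/quot_ind=> w.
by rewrite !freeE; apply/cls_eqP/feq_mulA.
Qed.
Lemma free_1mul : left_id (free_const 1) free_mul.
Proof. by elim/quot_ind=> u; rewrite !freeE; apply/cls_eqP/feq_1mul. Qed.
Lemma free_mul1 : right_id (free_const 1) free_mul.
Proof. by elim/quot_ind=> u; rewrite !freeE; apply/cls_eqP/feq_mul1. Qed.
Lemma free_mulDl : left_distributive free_mul free_add.
Proof.
elim/quot_ind=> u; elim/quot_ind=> v; elim/quot_ind=> w.
by rewrite !freeE; apply/cls_eqP/feq_mulDl.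
Qed.
Lemma free_mulDr : right_distributive free_mul free_add.
Proof.
elim/quot_ind=> u; elim/quot_ind=> v; elim/quot_ind=> w.
by rewrite !freeE; apply/cls_eqP/feq_mulDr.
Qed.

HB.instance Definition _ := GRing.isPzRing.Build free_carrier
  free_addA free_addC free_add0 free_addN
  free_mulA free_1mul free_mul1 free_mulDl free_mulDr.

Lemma free_constD : {morph free_const : a b / a + b}.
Proof.
by move=> a b; rewrite [RHS]free_addE; apply/cls_eqP/feq_constD.
Qed.
Lemma free_constM : {morph free_const : a b / a * b}.
Proof.
by move=> a b; rewrite [RHS]free_mulE; apply/cls_eqP/feq_constM.
Qed.
Lemma free_const_nmod : nmod_morphism free_const.
Proof. by split=> //; apply: free_constD. Qed.
Lemma free_const_monoid : monoid_morphism free_const.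
Proof. by split=> //; apply: free_constM. Qed.
HB.instance Definition _ :=
  GRing.isNmodMorphism.Build k free_carrier free_const free_const_nmod.
HB.instance Definition _ :=
  GRing.isMonoidMorphism.Build k free_carrier free_const free_const_monoid.

Lemma free_central a (u : free_carrier) : free_const a * u = u * free_const a.
Proof.
elim/quot_ind: u => u.
by rewrite [LHS]free_mulE [RHS]free_mulE; apply/cls_eqP/feq_constC.
Qed.

Definition free_alg : pzalg k :=
  @PzAlg k free_carrier free_const free_central.

Definition free_var (x : X) : free_alg := fcls (FVar x).

Section Lift.
Variables (B : pzalg k) (v : X -> B).

Fixpoint feval (u : fterm) : B :=
  match u with
  | FVar x => v x
  | FConst a => scal B a
  | FAdd u1 u2 => feval u1 + feval u2
  | FOpp u1 => - feval u1
  | FMul u1 u2 => feval u1 * feval u2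
  end.

Lemma feval_eq u w : feq u w -> feval u = feval w.
Proof.
elim=> /=; intros; rewrite ?(rmorph0, rmorph1, rmorphD, rmorphM);
  first [ reflexivity | congruence | exact: addrA | exact: addrC | exact: add0r
        | exact: addNr | exact: mulrA | exact: mul1r | exact: mulr1
        | exact: mulrDl | exact: mulrDr | exact: scal_central ].
Qed.

Definition free_lift (q : free_alg) : B := feval (frep q).

Lemma free_liftE u : free_lift (fcls u) = feval u.
Proof. by apply: feval_eq; apply: rep_cls. Qed.

Lemma free_lift_var x : free_lift (free_var x) = v x.
Proof. exact: free_liftE. Qed.

Lemma free_lift_scal a : free_lift (scal free_alg a) = scal B a.
Proof. exact: free_liftE. Qed.

Lemma free_lift_nmod : nmod_morphism free_lift.
Proof.
split=> [|p q]; first by rewrite [LHS]free_liftE /= rmorph0.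
by elim/quot_ind: p => p; elim/quot_ind: q => q; rewrite [_ + _]free_addE !free_liftE.
Qed.

Lemma free_lift_monoid : monoid_morphism free_lift.
Proof.
split=> [|p q]; first by rewrite [LHS]free_liftE /= rmorph1.
by elim/quot_ind: p => p; elim/quot_ind: q => q; rewrite [_ * _ in LHS]free_mulE !free_liftE.
Qed.

HB.instance Definition _ :=
  GRing.isNmodMorphism.Build free_alg B free_lift free_lift_nmod.
HB.instance Definition _ :=
  GRing.isMonoidMorphism.Build free_alg B free_lift free_lift_monoid.

End Lift.
End FreeAlgebra.

(** The quotient of an algebra by the two-sided ideal generated by the
   differences [a - b] with [R a b]. *)
Section QuotientAlgebra.
Variables (k : comPzRingType) (A : pzalg k) (R : A -> A -> Prop).

Inductive gen_ideal : A -> Prop :=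
| gen_ideal_in a b : R a b -> gen_ideal (a - b)
| gen_ideal0 : gen_ideal 0
| gen_idealD a b : gen_ideal a -> gen_ideal b -> gen_ideal (a + b)
| gen_idealMl c a : gen_ideal a -> gen_ideal (c * a)
| gen_idealMr c a : gen_ideal a -> gen_ideal (a * c).

Definition ideal_eq (a b : A) : Prop := gen_ideal (a - b).

Lemma ideal_eq_equiv : Equivalence ideal_eq.
Proof.
rewrite /ideal_eq; split=> [a|a b h|a b c h1 h2].
- by rewrite subrr; apply: gen_ideal0.
- by rewrite -opprB -[X in gen_ideal X]mulN1r; apply: gen_idealMl.
- have -> : a - c = (a - b) + (b - c) by rewrite addrA subrK.
  exact: gen_idealD.
Qed.

Definition aquot_carrier := quot ideal_eq_equiv.
HB.instance Definition _ := Choice.on aquot_carrier.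

Local Notation acls := (cls ideal_eq_equiv).
Local Notation arep := (@rep _ _ ideal_eq_equiv).

Lemma arep_cls a : gen_ideal (arep (acls a) - a).
Proof. exact: (rep_cls ideal_eq_equiv a). Qed.

Definition aquot_add (u v : aquot_carrier) : aquot_carrier :=
  acls (arep u + arep v).
Definition aquot_opp (u : aquot_carrier) : aquot_carrier := acls (- arep u).
Definition aquot_mul (u v : aquot_carrier) : aquot_carrier :=
  acls (arep u * arep v).

Lemma aquot_addE u v : aquot_add (acls u) (acls v) = acls (u + v).
Proof.
apply/cls_eqP; rewrite /ideal_eq opprD addrACA.
by apply: gen_idealD; apply: arep_cls.
Qed.
Lemma aquot_oppE u : aquot_opp (acls u) = acls (- u).
Proof.
apply/cls_eqP; rewrite /ideal_eq -opprD -[X in gen_ideal X]mulN1r.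
by apply: gen_idealMl; apply: arep_cls.
Qed.
Lemma aquot_mulE u v : aquot_mul (acls u) (acls v) = acls (u * v).
Proof.
apply/cls_eqP; rewrite /ideal_eq; set u' := rep _; set v' := rep _.
have -> : u' * v' - u * v = (u' - u) * v' + u * (v' - v).
  by rewrite mulrBl mulrBr addrA subrK.
by apply: gen_idealD; [apply: gen_idealMr|apply: gen_idealMl]; apply: arep_cls.
Qed.
Let aquotE := (aquot_addE, aquot_oppE, aquot_mulE).

Lemma aquot_addA : associative aquot_add.
Proof.
elim/quot_ind=> u; elim/quot_ind=> v; elim/quot_ind=> w.
by rewrite !aquotE addrA.
Qed.
Lemma aquot_addC : commutative aquot_add.
Proof. by elim/quot_ind=> u; elim/quot_ind=> v; rewrite !aquotE addrC. Qed.
Lemma aquot_add0 : left_id (acls 0) aquot_add.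
Proof. by elim/quot_ind=> u; rewrite !aquotE add0r. Qed.
Lemma aquot_addN : left_inverse (acls 0) aquot_opp aquot_add.
Proof. by elim/quot_ind=> u; rewrite !aquotE addNr. Qed.
Lemma aquot_mulA : associative aquot_mul.
Proof.
elim/quot_ind=> u; elim/quot_ind=> v; elim/quot_ind=> w.
by rewrite !aquotE mulrA.
Qed.
Lemma aquot_1mul : left_id (acls 1) aquot_mul.
Proof. by elim/quot_ind=> u; rewrite !aquotE mul1r. Qed.
Lemma aquot_mul1 : right_id (acls 1) aquot_mul.
Proof. by elim/quot_ind=> u; rewrite !aquotE mulr1. Qed.
Lemma aquot_mulDl : left_distributive aquot_mul aquot_add.
Proof.
elim/quot_ind=> u; elim/quot_ind=> v; elim/quot_ind=> w.
by rewrite !aquotE mulrDl.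
Qed.
Lemma aquot_mulDr : right_distributive aquot_mul aquot_add.
Proof.
elim/quot_ind=> u; elim/quot_ind=> v; elim/quot_ind=> w.
by rewrite !aquotE mulrDr.
Qed.

HB.instance Definition _ := GRing.isPzRing.Build aquot_carrier
  aquot_addA aquot_addC aquot_add0 aquot_addN
  aquot_mulA aquot_1mul aquot_mul1 aquot_mulDl aquot_mulDr.

Definition aquot_pi (a : A) : aquot_carrier := acls a.

Lemma aquot_pi_nmod : nmod_morphism aquot_pi.
Proof. by split=> // a b; rewrite [RHS]aquot_addE. Qed.
Lemma aquot_pi_monoid : monoid_morphism aquot_pi.
Proof. by split=> // a b; rewrite [RHS]aquot_mulE. Qed.
HB.instance Definition _ :=
  GRing.isNmodMorphism.Build A aquot_carrier aquot_pi aquot_pi_nmod.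
HB.instance Definition _ :=
  GRing.isMonoidMorphism.Build A aquot_carrier aquot_pi aquot_pi_monoid.

Lemma aquot_central c (u : aquot_carrier) :
  (aquot_pi \o scal A) c * u = u * (aquot_pi \o scal A) c.
Proof.
by elim/quot_ind: u => u; rewrite [LHS]aquot_mulE scal_central [RHS]aquot_mulE.
Qed.

Definition quot_alg : pzalg k :=
  @PzAlg k aquot_carrier (aquot_pi \o scal A) aquot_central.

Definition quot_pi : {rmorphism A -> quot_alg} := aquot_pi.

Lemma quot_pi_rel a b : R a b -> quot_pi a = quot_pi b.
Proof. by move=> ab; apply/cls_eqP; apply: gen_ideal_in. Qed.

Section Lift.
Variables (B : pzalg k) (g : {rmorphism A -> B}).
Hypothesis gR : forall a b, R a b -> g a = g b.

Lemma gen_ideal_lift a : gen_ideal a -> g a = 0.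
Proof.
elim=> {a} [a b /gR ab||a b _ ga _ gb|c a _ ga|c a _ ga].
- by rewrite rmorphB ab subrr.
- exact: rmorph0.
- by rewrite rmorphD ga gb addr0.
- by rewrite rmorphM ga mulr0.
- by rewrite rmorphM ga mul0r.
Qed.

Definition quot_lift_fun of (forall a b, R a b -> g a = g b) :=
  fun q : quot_alg => g (arep q).
Local Notation lift := (quot_lift_fun gR).

Lemma quot_liftE a : lift (quot_pi a) = g a.
Proof.
by apply/eqP; rewrite -subr_eq0 -rmorphB; apply/eqP/gen_ideal_lift/arep_cls.
Qed.

Lemma quot_lift_nmod : nmod_morphism lift.
Proof.
split=> [|p q]; first by rewrite -(rmorph0 quot_pi) quot_liftE rmorph0.
elim/quot_ind: p => p; elim/quot_ind: q => q.
by rewrite -(rmorphD quot_pi) !quot_liftE rmorphD.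
Qed.
Lemma quot_lift_monoid : monoid_morphism lift.
Proof.
split=> [|p q]; first by rewrite -(rmorph1 quot_pi) quot_liftE rmorph1.
elim/quot_ind: p => p; elim/quot_ind: q => q.
by rewrite -(rmorphM quot_pi) !quot_liftE rmorphM.
Qed.
HB.instance Definition _ :=
  GRing.isNmodMorphism.Build quot_alg B lift quot_lift_nmod.
HB.instance Definition _ :=
  GRing.isMonoidMorphism.Build quot_alg B lift quot_lift_monoid.

Definition quot_lift : {rmorphism quot_alg -> B} := lift.

Lemma quot_lift_pi a : quot_lift (quot_pi a) = g a.
Proof. exact: quot_liftE. Qed.

End Lift.
End QuotientAlgebra.

Record ring_unit (k : comPzRingType) := RingUnit {
  uval :> k;
  uinv : k;
  uvalK : uval * uinv = 1 }.

(** Indices are shifted by one: [HX i] stands for x_{i+1} and [HTau j] for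
   tau_{j+1}. *)
Inductive hecke_gen (n : nat) : Type :=
| HX of 'I_n
| HXinv of 'I_n
| HTau of 'I_n.-1.

Section AffineHecke.
Variables (k : comPzRingType) (z : k) (n : nat).

Local Notation F := (free_alg k (hecke_gen n)).
Local Notation X i := (free_var k (HX i) : F).
Local Notation Xinv i := (free_var k (HXinv i) : F).
Local Notation T j := (free_var k (@HTau n j) : F).

Inductive AH_rel : F -> F -> Prop :=
| AH_xxinv i : AH_rel (X i * Xinv i) 1
| AH_xinvx i : AH_rel (Xinv i * X i) 1
| AH_xx i i' : AH_rel (X i * X i') (X i' * X i)
| AH_txt (j : 'I_n.-1) (i i' : 'I_n) : i = j :> nat -> i' = j.+1 :> nat ->
    AH_rel (T j * X i * T j) (X i')
| AH_tx (j : 'I_n.-1) (i : 'I_n) : i <> j :> nat -> i <> j.+1 :> nat ->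
    AH_rel (T j * X i) (X i * T j)
| AH_tt j : AH_rel (T j ^+ 2) (scal F z * T j + 1)
| AH_ttC (j j' : 'I_n.-1) : (j.+1 < j')%N \/ (j'.+1 < j)%N ->
    AH_rel (T j * T j') (T j' * T j)
| AH_braid (j j' : 'I_n.-1) : j' = j.+1 :> nat ->
    AH_rel (T j * T j' * T j) (T j' * T j * T j').

Definition aff_hecke : pzalg k := quot_alg AH_rel.

Definition AH_of (g : hecke_gen n) : aff_hecke := quot_pi AH_rel (free_var k g).

End AffineHecke.

(** The value at [x] of f(w) = f_0 w^l + f_1 w^(l-1) + ... + f_l.  MathComp's
   [{poly k}] is not used because it excludes the zero ring. *)
Definition poly_eval (k : comPzRingType) (l : nat) (f : 'I_l.+1 -> k)
    (A : pzalg k) (x : A) : A :=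
  \sum_(i < l.+1) scal A (f i) * x ^+ (l - i).

Section CyclotomicHecke.
Variables (k : comPzRingType) (z : k) (l : nat) (f : 'I_l.+1 -> k).

(** The ideal is generated by f(x_1) if n > 0; if n = 0 there is no x_1, no
   relation is imposed, and [aff_hecke z 0], which has no generators, is a copy of k. *)
Inductive cyc_rel (n : nat) : aff_hecke z n -> aff_hecke z n -> Prop :=
| Cyc_f (i : 'I_n) : i = 0%N :> nat ->
    cyc_rel (poly_eval f (AH_of z (HX i))) 0.

Definition cyc_hecke (n : nat) : pzalg k := quot_alg (@cyc_rel n).

Definition H_of (n : nat) (g : hecke_gen n) : cyc_hecke n :=
  quot_pi (@cyc_rel n) (AH_of z g).

(** x_{n+1} in H_{n+1} and tau_{n+1} in H_{n+2}. *)
Definition x_last (n : nat) : cyc_hecke n.+1 := H_of (HX ord_max).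
Definition tau_last (n : nat) : cyc_hecke n.+2 := H_of (@HTau n.+2 ord_max).

(** The homomorphism H_n -> H_{n+1} sending generators to generators of the same
   name, obtained from the universal properties. *)
Section Inclusion.
Variable n : nat.

Definition gen_incl (g : hecke_gen n) : hecke_gen n.+1 :=
  match g with
  | HX i => HX (widen_ord (leqnSn n) i)
  | HXinv i => HXinv (widen_ord (leqnSn n) i)
  | HTau j => @HTau n.+1 (widen_ord (leq_pred n) j)
  end.

Definition free_incl : {rmorphism free_alg k (hecke_gen n) -> cyc_hecke n.+1} :=
  free_lift (B := cyc_hecke n.+1) (fun g => H_of (gen_incl g)).

Lemma free_inclP a b : AH_rel z a b -> free_incl a = free_incl b.
Proof.
pose p : {rmorphism free_alg k (hecke_gen n.+1) -> cyc_hecke n.+1} :=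
  quot_pi (@cyc_rel n.+1) \o quot_pi (@AH_rel k z n.+1).
have pE c d : AH_rel z c d -> p c = p d by move=> /quot_pi_rel /= ->.
have E g : free_incl (free_var k g) = p (free_var k (gen_incl g)).
  exact: free_lift_var.
have Es c : free_incl (scal (free_alg k _) c) = p (scal (free_alg k _) c).
  exact: free_lift_scal.
case=> {a b} *; rewrite ?(rmorphM free_incl, rmorphD free_incl,
  rmorphXn free_incl, rmorph1 free_incl) ?E ?Es
  -?(rmorphM p, rmorphD p, rmorphXn p, rmorph1 p); apply: pE.
- exact: AH_xxinv.
- exact: AH_xinvx.
- exact: AH_xx.
- exact: AH_txt.
- exact: AH_tx.
- exact: AH_tt.
- exact: AH_ttC.
- exact: AH_braid.
Qed.

Definition AH_incl : {rmorphism aff_hecke z n -> cyc_hecke n.+1} := quot_lift free_inclP.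

Lemma AH_inclE g : AH_incl (AH_of z g) = H_of (gen_incl g).
Proof. by rewrite /AH_incl quot_lift_pi; apply: free_lift_var. Qed.

Lemma AH_incl_scal a : AH_incl (scal (aff_hecke z n) a) = scal (cyc_hecke n.+1) a.
Proof. by rewrite /AH_incl quot_lift_pi; apply: free_lift_scal. Qed.

Lemma AH_inclP a b : cyc_rel a b -> AH_incl a = AH_incl b.
Proof.
case=> i i0; rewrite rmorph0 /poly_eval rmorph_sum.
transitivity (poly_eval f (H_of (HX (widen_ord (leqnSn n) i)))).
  by apply: eq_bigr => j _; rewrite (rmorphM AH_incl) (rmorphXn AH_incl) AH_inclE AH_incl_scal.
have := quot_pi_rel (@Cyc_f n.+1 (widen_ord (leqnSn n) i) i0).
rewrite rmorph0 => <-; rewrite /poly_eval rmorph_sum.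
by apply: eq_bigr => j _; rewrite rmorphM rmorphXn.
Qed.

Definition H_incl : {rmorphism cyc_hecke n -> cyc_hecke n.+1} := quot_lift AH_inclP.

Lemma H_inclE g : H_incl (H_of g) = H_of (gen_incl g).
Proof. by rewrite /H_incl quot_lift_pi AH_inclE. Qed.

Lemma H_incl_scal a : H_incl (scal (cyc_hecke n) a) = scal (cyc_hecke n.+1) a.
Proof. by rewrite /H_incl quot_lift_pi AH_incl_scal. Qed.

End Inclusion.
End CyclotomicHecke.

Section Restriction.
Variables (R S : pzRingType) (phi : {rmorphism R -> S}).

Definition res_carrier of {rmorphism R -> S} := fun M : lmodType S => M : Type.
Local Notation res M := (res_carrier phi M).

Section Module.
Variable M : lmodType S.
HB.instance Definition _ := GRing.Zmodule.on (res M).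

Definition res_scale (r : R) (v : res M) : res M := phi r *: (v : M).

Lemma res_scaleA a b v : res_scale a (res_scale b v) = res_scale (a * b) v.
Proof. by rewrite /res_scale scalerA rmorphM. Qed.
Lemma res_scale1 : left_id 1 res_scale.
Proof. by move=> v; rewrite /res_scale rmorph1 scale1r. Qed.
Lemma res_scaleDr : right_distributive res_scale +%R.
Proof. by move=> a v w; rewrite /res_scale scalerDr. Qed.
Lemma res_scaleDl v : {morph res_scale^~ v : a b / a + b}.
Proof. by move=> a b; rewrite /res_scale rmorphD scalerDl. Qed.
HB.instance Definition _ := GRing.Zmodule_isLmodule.Build R (res M)
  res_scaleA res_scale1 res_scaleDr res_scaleDl.
End Module.

Definition res_mod (M : lmodType S) : lmodType R := res M.

Section Morphism.
Variables (M N : lmodType S) (g : {linear M -> N}).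
Definition res_map_fun : res_mod M -> res_mod N := g.
Lemma res_map_linear : linear res_map_fun.
Proof. by move=> a u v; apply: (linearP g). Qed.
HB.instance Definition _ :=
  GRing.isLinear.Build R (res_mod M) (res_mod N) *:%R res_map_fun res_map_linear.
Definition res_map : {linear res_mod M -> res_mod N} := res_map_fun.
End Morphism.
End Restriction.

(** The left S-module S (x)_R M, where S is a right R-module via phi: the abelian
   group generated by the symbols s (x) m subject to biadditivity and to
   (s phi(r)) (x) m = s (x) (r m). *)
Section Tensor.
Variables (R S : pzRingType) (phi : {rmorphism R -> S}) (M : lmodType R).

Inductive tterm : Type :=
| TPure of S & M
| TZero
| TAdd of tterm & tterm
| TOpp of tterm.

Inductive teq : tterm -> tterm -> Prop :=
| teq_refl u : teq u u
| teq_sym u v : teq u v -> teq v u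
| teq_trans u v w : teq u v -> teq v w -> teq u w
| teq_add u u' v v' : teq u u' -> teq v v' -> teq (TAdd u v) (TAdd u' v')
| teq_opp u u' : teq u u' -> teq (TOpp u) (TOpp u')
| teq_addA u v w : teq (TAdd u (TAdd v w)) (TAdd (TAdd u v) w)
| teq_addC u v : teq (TAdd u v) (TAdd v u)
| teq_add0 u : teq (TAdd TZero u) u
| teq_addN u : teq (TAdd (TOpp u) u) TZero
| teq_pureDl s s' m : teq (TPure (s + s') m) (TAdd (TPure s m) (TPure s' m))
| teq_pureDr s m m' : teq (TPure s (m + m')) (TAdd (TPure s m) (TPure s m'))
| teq_bal s r m : teq (TPure (s * phi r) m) (TPure s (r *: m)).

Lemma teq_equiv : Equivalence teq.
Proof.
split; [exact: teq_refl | exact: teq_sym | exact: teq_trans].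
Qed.

Fixpoint tscale (s : S) (u : tterm) : tterm :=
  match u with
  | TPure s' m => TPure (s * s') m
  | TZero => TZero
  | TAdd u1 u2 => TAdd (tscale s u1) (tscale s u2)
  | TOpp u1 => TOpp (tscale s u1)
  end.

Lemma teq_scale s u v : teq u v -> teq (tscale s u) (tscale s v).
Proof.
elim=> {u v} /=.
- by move=> u; apply: teq_refl.
- by move=> u v _; apply: teq_sym.
- by move=> u v w _ h _; apply: teq_trans h.
- by move=> u u' v v' _ h _; apply: teq_add h.
- by move=> u u' _; apply: teq_opp.
- by move=> u v w; apply: teq_addA.
- by move=> u v; apply: teq_addC.
- by move=> u; apply: teq_add0.
- by move=> u; apply: teq_addN.
- by move=> s1 s2 m; rewrite mulrDr; apply: teq_pureDl.
- by move=> s1 m m'; apply: teq_pureDr.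
- by move=> s1 r m; rewrite mulrA; apply: teq_bal.
Qed.

Definition tensor := quot teq_equiv.
HB.instance Definition _ := Choice.on tensor.

Local Notation tcls := (cls teq_equiv).
Local Notation trep := (@rep _ _ teq_equiv).

Definition tensor_zero : tensor := tcls TZero.
Definition tensor_add (u v : tensor) : tensor := tcls (TAdd (trep u) (trep v)).
Definition tensor_opp (u : tensor) : tensor := tcls (TOpp (trep u)).
Definition tensor_scale (s : S) (u : tensor) : tensor := tcls (tscale s (trep u)).

Lemma tensor_addE u v : tensor_add (tcls u) (tcls v) = tcls (TAdd u v).
Proof. by apply/cls_eqP/teq_add; apply: rep_cls. Qed.
Lemma tensor_oppE u : tensor_opp (tcls u) = tcls (TOpp u).
Proof. by apply/cls_eqP/teq_opp; apply: rep_cls. Qed.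
Lemma tensor_scaleE s u : tensor_scale s (tcls u) = tcls (tscale s u).
Proof. by apply/cls_eqP/teq_scale; apply: rep_cls. Qed.
Let tensorE := (tensor_addE, tensor_oppE, tensor_scaleE).

Lemma tensor_addA : associative tensor_add.
Proof.
elim/quot_ind=> u; elim/quot_ind=> v; elim/quot_ind=> w.
by rewrite !tensorE; apply/cls_eqP/teq_addA.
Qed.
Lemma tensor_addC : commutative tensor_add.
Proof.
elim/quot_ind=> u; elim/quot_ind=> v.
by rewrite !tensorE; apply/cls_eqP/teq_addC.
Qed.
Lemma tensor_add0 : left_id tensor_zero tensor_add.
Proof. by elim/quot_ind=> u; rewrite !tensorE; apply/cls_eqP/teq_add0. Qed.
Lemma tensor_addN : left_inverse tensor_zero tensor_opp tensor_add.
Proof. by elim/quot_ind=> u; rewrite !tensorE; apply/cls_eqP/teq_addN. Qed.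

HB.instance Definition _ := GRing.isZmodule.Build tensor
  tensor_addA tensor_addC tensor_add0 tensor_addN.

Lemma tensor_scaleDr : right_distributive tensor_scale +%R.
Proof.
move=> s; elim/quot_ind=> u; elim/quot_ind=> v.
by rewrite [_ + _ in LHS]tensor_addE !tensor_scaleE [RHS]tensor_addE.
Qed.

Lemma tensor_scaleN s u : tensor_scale s (- u) = - tensor_scale s u.
Proof.
elim/quot_ind: u => u.
by rewrite [- _ in LHS]tensor_oppE !tensor_scaleE [RHS]tensor_oppE.
Qed.

Lemma tensor_scale0 s : tensor_scale s 0 = 0.
Proof. exact: tensor_scaleE. Qed.

Definition tpure (s : S) (m : M) : tensor := tcls (TPure s m).

Lemma tensor_ind (P : tensor -> Prop) :
  (forall s m, P (tpure s m)) -> P 0 -> (forall u v, P u -> P v -> P (u + v)) ->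
  (forall u, P u -> P (- u)) -> forall u, P u.
Proof.
move=> Pp P0 PD PN; elim/quot_ind; elim=> //= [u Pu v Pv|u Pu].
- by have := PD _ _ Pu Pv; rewrite [_ + _]tensor_addE.
- by have := PN _ Pu; rewrite [- _]tensor_oppE.
Qed.

Lemma tpureDl s s' m : tpure (s + s') m = tpure s m + tpure s' m.
Proof. by rewrite [RHS]tensor_addE; apply/cls_eqP/teq_pureDl. Qed.
Lemma tpureDr s m m' : tpure s (m + m') = tpure s m + tpure s m'.
Proof. by rewrite [RHS]tensor_addE; apply/cls_eqP/teq_pureDr. Qed.
Lemma tpure_bal s r m : tpure (s * phi r) m = tpure s (r *: m).
Proof. by apply/cls_eqP/teq_bal. Qed.
Lemma tensor_scale_pure s s' m : tensor_scale s (tpure s' m) = tpure (s * s') m.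
Proof. exact: tensor_scaleE. Qed.

Lemma tensor_scaleA a b u :
  tensor_scale a (tensor_scale b u) = tensor_scale (a * b) u.
Proof.
elim/tensor_ind: u => [s m||u v hu hv|u hu].
- by rewrite !tensor_scale_pure mulrA.
- by rewrite !tensor_scale0.
- by rewrite !tensor_scaleDr hu hv.
- by rewrite !tensor_scaleN hu.
Qed.
Lemma tensor_scale1 : left_id 1 tensor_scale.
Proof.
elim/tensor_ind=> [s m||u v hu hv|u hu].
- by rewrite tensor_scale_pure mul1r.
- by rewrite tensor_scale0.
- by rewrite tensor_scaleDr hu hv.
- by rewrite tensor_scaleN hu.
Qed.
Lemma tensor_scaleDl u : {morph tensor_scale^~ u : a b / a + b}.
Proof.
move=> a b /=; elim/tensor_ind: u => [s m||u v hu hv|u hu].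
- by rewrite !tensor_scale_pure mulrDl tpureDl.
- by rewrite !tensor_scale0 addr0.
- by rewrite !tensor_scaleDr hu hv addrACA.
- by rewrite !tensor_scaleN hu opprD.
Qed.

HB.instance Definition _ := GRing.Zmodule_isLmodule.Build S tensor
  tensor_scaleA tensor_scale1 tensor_scaleDr tensor_scaleDl.

Definition ind_mod : lmodType S := tensor.

Lemma tpureZ s s' m : s *: (tpure s' m : ind_mod) = tpure (s * s') m.
Proof. exact: tensor_scale_pure. Qed.

Section Lift.
Variables (V : lmodType S) (h : {linear M -> res_mod phi V}).

Fixpoint teval (u : tterm) : V :=
  match u with
  | TPure s m => s *: (h m : V)
  | TZero => 0
  | TAdd u1 u2 => teval u1 + teval u2
  | TOpp u1 => - teval u1
  end.

Lemma teval_eq u v : teq u v -> teval u = teval v.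
Proof.
elim=> {u v} /=; try congruence.
- by move=> *; rewrite addrA.
- by move=> *; rewrite addrC.
- by move=> *; rewrite add0r.
- by move=> *; rewrite addNr.
- by move=> *; rewrite scalerDl.
- by move=> s m m'; rewrite linearD scalerDr.
- by move=> s r m; rewrite linearZ -scalerA.
Qed.

Definition ind_lift_fun (u : ind_mod) : V := teval (trep u).

Lemma ind_lift_cls u : ind_lift_fun (tcls u) = teval u.
Proof. by apply: teval_eq; apply: rep_cls. Qed.

Lemma ind_lift_linear : linear ind_lift_fun.
Proof.
have D u v : ind_lift_fun (u + v) = ind_lift_fun u + ind_lift_fun v.
  elim/quot_ind: u => u; elim/quot_ind: v => v.
  by rewrite [u in ind_lift_fun u]tensor_addE !ind_lift_cls.
have N u : ind_lift_fun (- u) = - ind_lift_fun u.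
  by elim/quot_ind: u => u; rewrite [u in ind_lift_fun u]tensor_oppE !ind_lift_cls.
have O : ind_lift_fun 0 = 0 by apply: ind_lift_cls.
move=> a u v; rewrite D; congr (_ + _).
elim/tensor_ind: u => [s m||u1 u2 h1 h2|u1 h1].
- by rewrite tpureZ [LHS]ind_lift_cls [ind_lift_fun _]ind_lift_cls /= scalerA.
- by rewrite scaler0 O scaler0.
- by rewrite scalerDr !D scalerDr h1 h2.
- by rewrite scalerN !N scalerN h1.
Qed.
HB.instance Definition _ :=
  GRing.isLinear.Build S ind_mod V *:%R ind_lift_fun ind_lift_linear.
Definition ind_lift : {linear ind_mod -> V} := ind_lift_fun.

Lemma ind_lift_pure s m : ind_lift (tpure s m) = s *: (h m : V).
Proof. exact: ind_lift_cls. Qed.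
End Lift.

Definition ind_unit_fun (m : M) : res_mod phi ind_mod := tpure 1 m.
Lemma ind_unit_linear : linear ind_unit_fun.
Proof.
move=> a u v; rewrite [LHS]tpureDr -tpure_bal mul1r; congr (_ + _).
by rewrite [RHS]tpureZ mulr1.
Qed.
HB.instance Definition _ :=
  GRing.isLinear.Build R M (res_mod phi ind_mod) *:%R ind_unit_fun ind_unit_linear.
Definition ind_unit : {linear M -> res_mod phi ind_mod} := ind_unit_fun.

End Tensor.

Definition ind_map (R S : pzRingType) (phi : {rmorphism R -> S})
    (M N : lmodType R) (g : {linear M -> N}) :
    {linear ind_mod phi M -> ind_mod phi N} :=
  ind_lift (ind_unit phi N \o g).

Lemma ind_map_pure (R S : pzRingType) (phi : {rmorphism R -> S})
    (M N : lmodType R) (g : {linear M -> N}) s m :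
  ind_map phi g (tpure phi s m) = tpure phi s (g m).
Proof. by rewrite [LHS]ind_lift_pure /= [LHS]tpureZ mulr1. Qed.

Lemma linear_ext (R : pzRingType) (M N : lmodType R) (g h : {linear M -> N}) :
  (forall v, g v = h v) -> g = h.
Proof.
case: g h => [g [[gm] [ga]]] [h [[hm] [ha]]] /= /funext gh.
by subst h; congr GRing.Linear.Pack; congr GRing.Linear.Class;
  congr (_ _); apply: Prop_irrelevance.
Qed.

Lemma ind_map_ext (R S : pzRingType) (phi : {rmorphism R -> S})
    (M : lmodType R) (N : lmodType S) (g h : {linear ind_mod phi M -> N}) :
  (forall s m, g (tpure phi s m) = h (tpure phi s m)) -> g = h.
Proof.
move=> gh; apply: linear_ext; elim/tensor_ind=> //.
- by rewrite !linear0.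
- by move=> u v gu gv; rewrite !linearD gu gv.
- by move=> u gu; rewrite !linearN gu.
Qed.

(** Hom-modules carry their k-module structure explicitly: [lmodType] lives in a
   fixed universe, which is too small for the natural transformations between
   endofunctors of a category of modules. *)

Record is_kmodule (k : comPzRingType) (V : Type) (zero : V) (add : V -> V -> V)
    (opp : V -> V) (scale : k -> V -> V) : Prop := IsKModule {
  kmod_addA : associative add;
  kmod_addC : commutative add;
  kmod_add0 : left_id zero add;
  kmod_addN : left_inverse zero opp add;
  kmod_scaleA a b v : scale a (scale b v) = scale (a * b) v;
  kmod_scale1 : left_id 1 scale;
  kmod_scaleDr : right_distributive scale add;
  kmod_scaleDl v a b : scale (a + b) v = add (scale a v) (scale b v) }.

Record lincat (k : comPzRingType) := LinCat {
  obj : Type;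
  hom : obj -> obj -> Type;
  idm : forall a, hom a a;
  hcomp : forall a b c, hom b c -> hom a b -> hom a c;
  hzero : forall a b, hom a b;
  hadd : forall a b, hom a b -> hom a b -> hom a b;
  hopp : forall a b, hom a b -> hom a b;
  hscale : forall a b, k -> hom a b -> hom a b;
  hom_kmodule : forall a b, is_kmodule (@hzero a b) (@hadd a b) (@hopp a b) (@hscale a b);
  compA : forall a b c d (f : hom c d) (g : hom b c) (h : hom a b),
    hcomp f (hcomp g h) = hcomp (hcomp f g) h;
  compIm : forall a b (f : hom a b), hcomp (idm b) f = f;
  compmI : forall a b (f : hom a b), hcomp f (idm a) = f;
  compDl : forall a b c (f f' : hom b c) (g : hom a b),
    hcomp (hadd f f') g = hadd (hcomp f g) (hcomp f' g);
  compDr : forall a b c (f : hom b c) (g g' : hom a b),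
    hcomp f (hadd g g') = hadd (hcomp f g) (hcomp f g');
  compZl : forall a b c x (f : hom b c) (g : hom a b),
    hcomp (hscale x f) g = hscale x (hcomp f g);
  compZr : forall a b c x (f : hom b c) (g : hom a b),
    hcomp f (hscale x g) = hscale x (hcomp f g) }.
Arguments hom {k} C : rename.
Arguments idm {k} C a : rename.
Arguments hcomp {k} C {a b c} : rename.
Arguments hzero {k} C a b : rename.
Arguments hadd {k} C {a b} : rename.
Arguments hopp {k} C {a b} : rename.
Arguments hscale {k} C {a b} : rename.
Arguments hom_kmodule {k} C a b : rename.

(** The arrows f and g are equal; in particular a = c and b = d, although these
   objects need not be convertible. *)
Definition arr_eq (k : comPzRingType) (C : lincat k) (a b c d : obj C)
    (f : hom C a b) (g : hom C c d) : Prop :=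
  existT (fun p : obj C * obj C => hom C p.1 p.2) (a, b) f
  = existT (fun p : obj C * obj C => hom C p.1 p.2) (c, d) g.

Section Functors.
Variables (k : comPzRingType) (C D : lincat k).

Record is_linfunctor (F0 : obj C -> obj D)
    (F1 : forall a b, hom C a b -> hom D (F0 a) (F0 b)) : Prop := IsLinFunctor {
  fun_id : forall a, F1 _ _ (idm C a) = idm D (F0 a);
  fun_comp : forall a b c (f : hom C b c) (g : hom C a b),
    F1 _ _ (hcomp C f g) = hcomp D (F1 _ _ f) (F1 _ _ g);
  fun_add : forall a b (f g : hom C a b), F1 _ _ (hadd C f g) = hadd D (F1 _ _ f) (F1 _ _ g);
  fun_scale : forall a b x (f : hom C a b), F1 _ _ (hscale C x f) = hscale D x (F1 _ _ f) }.

Record linfunctor := LinFunctor {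
  fobj :> obj C -> obj D;
  fhom : forall a b, hom C a b -> hom D (fobj a) (fobj b);
  linfunctorP : is_linfunctor fhom }.

Definition is_natural (F G : linfunctor) (n : forall a, hom D (F a) (G a)) : Prop :=
  forall a b (f : hom C a b), hcomp D (n b) (fhom F f) = hcomp D (fhom G f) (n a).

Record nattrans (F G : linfunctor) := NatTrans {
  napp :> forall a, hom D (F a) (G a);
  nattransP : is_natural napp }.

Lemma nattrans_ext (F G : linfunctor) (n m : nattrans F G) :
  (forall a, n a = m a) -> n = m.
Proof.
case: n m => [n Pn] [m Pm] /= nm.
have E : n = m by apply: functional_extensionality_dep.
by subst m; congr NatTrans; apply: Prop_irrelevance.
Qed.

Section Operations.
Variables F G K : linfunctor.

Lemma nat_id_subproof : is_natural (fun a => idm D (F a)).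
Proof. by move=> a b f; rewrite compIm compmI. Qed.
Definition nat_id := NatTrans nat_id_subproof.

Lemma nat_comp_subproof (n : nattrans G K) (m : nattrans F G) :
  is_natural (fun a => hcomp D (n a) (m a)).
Proof.
by move=> a b f; rewrite -compA (nattransP m) compA (nattransP n) compA.
Qed.
Definition nat_comp n m := NatTrans (nat_comp_subproof n m).

Lemma hcomp0r a b c (f : hom D b c) : hcomp D f (hzero D a b) = hzero D a c.
Proof.
have K1 := hom_kmodule D a b; have K2 := hom_kmodule D a c.
have E := compDr f (hzero D a b) (hzero D a b).
rewrite (kmod_add0 K1) in E.
rewrite -[RHS](kmod_addN K2 (hcomp D f (hzero D a b))) {3}E.
by rewrite (kmod_addA K2) (kmod_addN K2) (kmod_add0 K2).
Qed.
Lemma hcomp0l a b c (g : hom D a b) : hcomp D (hzero D b c) g = hzero D a c.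
Proof.
have K1 := hom_kmodule D b c; have K2 := hom_kmodule D a c.
have E := compDl (hzero D b c) (hzero D b c) g.
rewrite (kmod_add0 K1) in E.
rewrite -[RHS](kmod_addN K2 (hcomp D (hzero D b c) g)) {3}E.
by rewrite (kmod_addA K2) (kmod_addN K2) (kmod_add0 K2).
Qed.

Lemma hopp_unique a b (f g : hom D a b) : hadd D f g = hzero D a b -> f = hopp D g.
Proof.
have K2 := hom_kmodule D a b => E.
rewrite -[LHS](kmod_add0 K2) (kmod_addC K2) -(kmod_addN K2 g).
by rewrite [hadd D (hopp D g) g](kmod_addC K2) (kmod_addA K2) E (kmod_add0 K2).
Qed.

Lemma hcompNr a b c (f : hom D b c) (g : hom D a b) :
  hcomp D f (hopp D g) = hopp D (hcomp D f g).
Proof.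
by apply: hopp_unique; rewrite -compDr (kmod_addN (hom_kmodule _ _ _)) hcomp0r.
Qed.
Lemma hcompNl a b c (f : hom D b c) (g : hom D a b) :
  hcomp D (hopp D f) g = hopp D (hcomp D f g).
Proof.
by apply: hopp_unique; rewrite -compDl (kmod_addN (hom_kmodule _ _ _)) hcomp0l.
Qed.

Lemma nat_zero_subproof : is_natural (fun a => hzero D (F a) (G a)).
Proof. by move=> a b f; rewrite hcomp0l hcomp0r. Qed.
Definition nat_zero := NatTrans nat_zero_subproof.

Lemma nat_add_subproof (n m : nattrans F G) :
  is_natural (fun a => hadd D (n a) (m a)).
Proof. by move=> a b f; rewrite compDl compDr !nattransP. Qed.
Definition nat_add n m := NatTrans (nat_add_subproof n m).

Lemma nat_opp_subproof (n : nattrans F G) : is_natural (fun a => hopp D (n a)).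
Proof. by move=> a b f; rewrite hcompNl hcompNr !nattransP. Qed.
Definition nat_opp n := NatTrans (nat_opp_subproof n).

Lemma nat_scale_subproof (x : k) (n : nattrans F G) :
  is_natural (fun a => hscale D x (n a)).
Proof. by move=> a b f; rewrite compZl compZr !nattransP. Qed.
Definition nat_scale x n := NatTrans (nat_scale_subproof x n).

Lemma nat_kmodule : is_kmodule nat_zero nat_add nat_opp nat_scale.
Proof.
split.
- by move=> u v w; apply: nattrans_ext => a; apply: (kmod_addA (hom_kmodule _ _ _)).
- by move=> u v; apply: nattrans_ext => a; apply: (kmod_addC (hom_kmodule _ _ _)).
- by move=> u; apply: nattrans_ext => a; apply: (kmod_add0 (hom_kmodule _ _ _)).
- by move=> u; apply: nattrans_ext => a; apply: (kmod_addN (hom_kmodule _ _ _)).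
- by move=> x y u; apply: nattrans_ext => a; apply: (kmod_scaleA (hom_kmodule _ _ _)).
- by move=> u; apply: nattrans_ext => a; apply: (kmod_scale1 (hom_kmodule _ _ _)).
- by move=> x u v; apply: nattrans_ext => a; apply: (kmod_scaleDr (hom_kmodule _ _ _)).
- by move=> u x y; apply: nattrans_ext => a; apply: (kmod_scaleDl (hom_kmodule _ _ _)).
Qed.

End Operations.
End Functors.

Record strict_moncat (k : comPzRingType) := StrictMonCat {
  moncat :> lincat k;
  munit : obj moncat;
  mten : obj moncat -> obj moncat -> obj moncat;
  hten : forall a b c d, hom moncat a b -> hom moncat c d ->
    hom moncat (mten a c) (mten b d);
  mtenA : forall a b c, mten a (mten b c) = mten (mten a b) c;
  mten1x : forall a, mten munit a = a;
  mtenx1 : forall a, mten a munit = a;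
  hten_id : forall a b, hten (idm moncat a) (idm moncat b) = idm moncat (mten a b);
  hten_comp : forall a b c a' b' c' (f : hom moncat b c) (g : hom moncat a b)
      (f' : hom moncat b' c') (g' : hom moncat a' b'),
    hten (hcomp moncat f g) (hcomp moncat f' g') = hcomp moncat (hten f f') (hten g g');
  htenDl : forall a b c d (f f' : hom moncat a b) (g : hom moncat c d),
    hten (hadd moncat f f') g = hadd moncat (hten f g) (hten f' g);
  htenDr : forall a b c d (f : hom moncat a b) (g g' : hom moncat c d),
    hten f (hadd moncat g g') = hadd moncat (hten f g) (hten f g');
  htenZl : forall a b c d x (f : hom moncat a b) (g : hom moncat c d),
    hten (hscale moncat x f) g = hscale moncat x (hten f g);
  htenZr : forall a b c d x (f : hom moncat a b) (g : hom moncat c d),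
    hten f (hscale moncat x g) = hscale moncat x (hten f g);
  htenA : forall a b c a' b' c' (f : hom moncat a a') (g : hom moncat b b')
      (h : hom moncat c c'),
    arr_eq (hten f (hten g h)) (hten (hten f g) h);
  hten1x : forall a b (f : hom moncat a b), arr_eq (hten (idm moncat munit) f) f;
  htenx1 : forall a b (f : hom moncat a b), arr_eq (hten f (idm moncat munit)) f }.
Arguments munit {k} C : rename.
Arguments mten {k} C : rename.
Arguments hten {k} C {a b c d} : rename.

Record strict_monfunctor (k : comPzRingType) (C D : strict_moncat k) :=
  StrictMonFunctor {
  monfun :> linfunctor C D;
  monfun_unit : monfun (munit C) = munit D;
  monfun_ten : forall a b, monfun (mten C a b) = mten D (monfun a) (monfun b);
  monfun_hten : forall a b c d (f : hom C a b) (g : hom C c d),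
    arr_eq (fhom monfun (hten C f g)) (hten D (fhom monfun f) (fhom monfun g)) }.

Section Endofunctors.
Variables (k : comPzRingType) (C : lincat k).

Local Notation nt F G := (@nattrans k C C F G).

Lemma nat_compA F G K L (f : nt K L) (g : nt G K) (h : nt F G) :
  nat_comp f (nat_comp g h) = nat_comp (nat_comp f g) h.
Proof. by apply: nattrans_ext => a; apply: compA. Qed.
Lemma nat_compIm F G (f : nt F G) : nat_comp (nat_id G) f = f.
Proof. by apply: nattrans_ext => a; apply: compIm. Qed.
Lemma nat_compmI F G (f : nt F G) : nat_comp f (nat_id F) = f.
Proof. by apply: nattrans_ext => a; apply: compmI. Qed.
Lemma nat_compDl F G K (f f' : nt G K) (g : nt F G) :
  nat_comp (nat_add f f') g = nat_add (nat_comp f g) (nat_comp f' g).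
Proof. by apply: nattrans_ext => a; apply: compDl. Qed.
Lemma nat_compDr F G K (f : nt G K) (g g' : nt F G) :
  nat_comp f (nat_add g g') = nat_add (nat_comp f g) (nat_comp f g').
Proof. by apply: nattrans_ext => a; apply: compDr. Qed.
Lemma nat_compZl F G K x (f : nt G K) (g : nt F G) :
  nat_comp (nat_scale x f) g = nat_scale x (nat_comp f g).
Proof. by apply: nattrans_ext => a; apply: compZl. Qed.
Lemma nat_compZr F G K x (f : nt G K) (g : nt F G) :
  nat_comp f (nat_scale x g) = nat_scale x (nat_comp f g).
Proof. by apply: nattrans_ext => a; apply: compZr. Qed.

Definition endcat : lincat k := @LinCat k (linfunctor C C) (@nattrans k C C)
  (@nat_id _ _ _) (@nat_comp _ _ _) (@nat_zero _ _ _) (@nat_add _ _ _)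
  (@nat_opp _ _ _) (@nat_scale _ _ _) (@nat_kmodule _ _ _)
  nat_compA nat_compIm nat_compmI nat_compDl nat_compDr nat_compZl nat_compZr.

Lemma id_functor_subproof : is_linfunctor (fun a b (f : hom C a b) => f).
Proof. by split. Qed.
Definition id_functor := LinFunctor id_functor_subproof.

Lemma comp_functor_subproof (F G : linfunctor C C) :
  is_linfunctor (fun a b (f : hom C a b) => fhom F (fhom G f)).
Proof.
have [F1 F2 F3 F4] := linfunctorP F; have [G1 G2 G3 G4] := linfunctorP G.
by split=> *; rewrite ?(G1, G2, G3, G4) ?(F1, F2, F3, F4).
Qed.

(** The tensor product of F and G is F o G (first G, then F). *)
Definition comp_functor (F G : linfunctor C C) := LinFunctor (comp_functor_subproof F G).

Lemma nat_hcomp_subproof (F F' G G' : linfunctor C C)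
    (n : nattrans F F') (m : nattrans G G') :
  @is_natural k C C (comp_functor F G) (comp_functor F' G')
    (fun a => hcomp C (n (G' a)) (fhom F (m a))).
Proof.
move=> a b f /=; rewrite -compA -(fun_comp (linfunctorP F)) (nattransP m).
by rewrite (fun_comp (linfunctorP F)) !compA (nattransP n).
Qed.
Definition nat_hcomp (F F' G G' : linfunctor C C)
    (n : nattrans F F') (m : nattrans G G') :
  nattrans (comp_functor F G) (comp_functor F' G') :=
  NatTrans (nat_hcomp_subproof n m).

Lemma linfunctor_irr F0 F1 (P Q : is_linfunctor F1) :
  @LinFunctor k C C F0 F1 P = @LinFunctor k C C F0 F1 Q.
Proof. by rewrite (Prop_irrelevance P Q). Qed.

Lemma nattrans_arr_eq F0 F1 (P P' : is_linfunctor F1) G0 G1 (Q Q' : is_linfunctor G1)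
    (n : nattrans (@LinFunctor k C C F0 F1 P) (@LinFunctor k C C G0 G1 Q))
    (m : nattrans (@LinFunctor k C C F0 F1 P') (@LinFunctor k C C G0 G1 Q')) :
  (forall a, n a = m a) ->
  arr_eq (n : hom endcat _ _) (m : hom endcat _ _).
Proof.
rewrite (Prop_irrelevance P' P) in m *; rewrite (Prop_irrelevance Q' Q) in m *.
by move=> /nattrans_ext ->.
Qed.

Lemma comp_functorA (F G K : linfunctor C C) :
  comp_functor F (comp_functor G K) = comp_functor (comp_functor F G) K.
Proof. exact: linfunctor_irr. Qed.
Lemma comp_functor1x F : comp_functor id_functor F = F.
Proof. by case: F => F0 F1 P; apply: linfunctor_irr. Qed.
Lemma comp_functorx1 F : comp_functor F id_functor = F.
Proof. by case: F => F0 F1 P; apply: linfunctor_irr. Qed.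

Lemma nat_hcomp_id F G : nat_hcomp (nat_id F) (nat_id G) = nat_id (comp_functor F G).
Proof.
by apply: nattrans_ext => a /=; rewrite (fun_id (linfunctorP F)) compIm.
Qed.

Lemma nat_hcomp_comp (F G K F' G' K' : linfunctor C C)
    (f : nattrans G K) (g : nattrans F G) (f' : nattrans G' K') (g' : nattrans F' G') :
  nat_hcomp (nat_comp f g) (nat_comp f' g')
  = nat_comp (nat_hcomp f f') (nat_hcomp g g').
Proof.
apply: nattrans_ext => a /=.
rewrite (fun_comp (linfunctorP F)) -!compA; congr (hcomp C _ _).
by rewrite !compA (nattransP g).
Qed.

Lemma nat_hcompDl (F G F' G' : linfunctor C C) (f f' : nattrans F G)
    (g : nattrans F' G') :
  nat_hcomp (nat_add f f') g = nat_add (nat_hcomp f g) (nat_hcomp f' g).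
Proof. by apply: nattrans_ext => a /=; rewrite compDl. Qed.
Lemma nat_hcompDr (F G F' G' : linfunctor C C) (f : nattrans F G)
    (g g' : nattrans F' G') :
  nat_hcomp f (nat_add g g') = nat_add (nat_hcomp f g) (nat_hcomp f g').
Proof.
by apply: nattrans_ext => a /=; rewrite (fun_add (linfunctorP F)) compDr.
Qed.
Lemma nat_hcompZl (F G F' G' : linfunctor C C) x (f : nattrans F G)
    (g : nattrans F' G') :
  nat_hcomp (nat_scale x f) g = nat_scale x (nat_hcomp f g).
Proof. by apply: nattrans_ext => a /=; rewrite compZl. Qed.
Lemma nat_hcompZr (F G F' G' : linfunctor C C) x (f : nattrans F G)
    (g : nattrans F' G') :
  nat_hcomp f (nat_scale x g) = nat_scale x (nat_hcomp f g).
Proof.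
by apply: nattrans_ext => a /=; rewrite (fun_scale (linfunctorP F)) compZr.
Qed.

Lemma nat_hcompA (F G K F' G' K' : linfunctor C C)
    (f : nattrans F F') (g : nattrans G G') (h : nattrans K K') :
  arr_eq (nat_hcomp f (nat_hcomp g h) : hom endcat _ _)
         (nat_hcomp (nat_hcomp f g) h : hom endcat _ _).
Proof.
apply: nattrans_arr_eq => a /=.
by rewrite (fun_comp (linfunctorP F)) compA.
Qed.
Lemma nat_hcomp1x (F G : linfunctor C C) (f : nattrans F G) :
  arr_eq (nat_hcomp (nat_id id_functor) f : hom endcat _ _) (f : hom endcat _ _).
Proof.
case: F G f => F0 F1 P [G0 G1 Q] f; apply: nattrans_arr_eq => a /=.
exact: compIm.
Qed.
Lemma nat_hcompx1 (F G : linfunctor C C) (f : nattrans F G) :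
  arr_eq (nat_hcomp f (nat_id id_functor) : hom endcat _ _) (f : hom endcat _ _).
Proof.
case: F G f => F0 F1 P [G0 G1 Q] f; apply: nattrans_arr_eq => a /=.
by rewrite (fun_id P) compmI.
Qed.

Definition End_cat : strict_moncat k := @StrictMonCat k endcat
  id_functor comp_functor nat_hcomp
  comp_functorA comp_functor1x comp_functorx1 nat_hcomp_id nat_hcomp_comp
  nat_hcompDl nat_hcompDr nat_hcompZl nat_hcompZr nat_hcompA nat_hcomp1x nat_hcompx1.

End Endofunctors.

(** Objects are words in the generating objects; morphisms are formal expressions
   modulo the smallest congruence containing the axioms of strict k-linear
   monoidal categories and the defining relations.  The congruence relates
   expressions whose end points need not be syntactically the same; related
   expressions always have equal end points ([tm_eq_dom], [tm_eq_cod]). *)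

Section Presentation.
Variables (k : comPzRingType) (O : Type) (Gen : seq O -> seq O -> Type).

Inductive tm : seq O -> seq O -> Type :=
| TmGen a b of Gen a b : tm a b
| TmId a : tm a a
| TmComp a b c of tm b c & tm a b : tm a c
| TmTen a b c d of tm a b & tm c d : tm (a ++ c) (b ++ d)
| TmZero a b : tm a b
| TmAdd a b of tm a b & tm a b : tm a b
| TmOpp a b of tm a b : tm a b
| TmScale a b of k & tm a b : tm a b.

Variable Rel : forall a b, tm a b -> tm a b -> Prop.

Inductive tm_eq : forall a b c d, tm a b -> tm c d -> Prop :=
| tm_eq_rel a b (f g : tm a b) : Rel f g -> tm_eq f g
| tm_eq_refl a b (f : tm a b) : tm_eq f f
| tm_eq_sym a b c d (f : tm a b) (g : tm c d) : tm_eq f g -> tm_eq g f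
| tm_eq_trans a b c d a' b' (f : tm a b) (g : tm c d) (h : tm a' b') :
    tm_eq f g -> tm_eq g h -> tm_eq f h
| tm_eq_comp a b c a' b' c' (f : tm b c) (g : tm a b) (f' : tm b' c') (g' : tm a' b') :
    tm_eq f f' -> tm_eq g g' -> tm_eq (TmComp f g) (TmComp f' g')
| tm_eq_ten a b c d a' b' c' d' (f : tm a b) (g : tm c d) (f' : tm a' b') (g' : tm c' d') :
    tm_eq f f' -> tm_eq g g' -> tm_eq (TmTen f g) (TmTen f' g')
| tm_eq_add a b a' b' (f g : tm a b) (f' g' : tm a' b') :
    tm_eq f f' -> tm_eq g g' -> tm_eq (TmAdd f g) (TmAdd f' g')
| tm_eq_opp a b a' b' (f : tm a b) (f' : tm a' b') :
    tm_eq f f' -> tm_eq (TmOpp f) (TmOpp f')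
| tm_eq_scale a b a' b' x (f : tm a b) (f' : tm a' b') :
    tm_eq f f' -> tm_eq (TmScale x f) (TmScale x f')
| tm_eq_addA a b (f g h : tm a b) :
    tm_eq (TmAdd f (TmAdd g h)) (TmAdd (TmAdd f g) h)
| tm_eq_addC a b (f g : tm a b) : tm_eq (TmAdd f g) (TmAdd g f)
| tm_eq_add0 a b (f : tm a b) : tm_eq (TmAdd (TmZero a b) f) f
| tm_eq_addN a b (f : tm a b) : tm_eq (TmAdd (TmOpp f) f) (TmZero a b)
| tm_eq_scaleA a b x y (f : tm a b) :
    tm_eq (TmScale x (TmScale y f)) (TmScale (x * y) f)
| tm_eq_scale1 a b (f : tm a b) : tm_eq (TmScale 1 f) f
| tm_eq_scaleDr a b x (f g : tm a b) :
    tm_eq (TmScale x (TmAdd f g)) (TmAdd (TmScale x f) (TmScale x g))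
| tm_eq_scaleDl a b x y (f : tm a b) :
    tm_eq (TmScale (x + y) f) (TmAdd (TmScale x f) (TmScale y f))
| tm_eq_compA a b c d (f : tm c d) (g : tm b c) (h : tm a b) :
    tm_eq (TmComp f (TmComp g h)) (TmComp (TmComp f g) h)
| tm_eq_compIm a b (f : tm a b) : tm_eq (TmComp (TmId b) f) f
| tm_eq_compmI a b (f : tm a b) : tm_eq (TmComp f (TmId a)) f
| tm_eq_compDl a b c (f f' : tm b c) (g : tm a b) :
    tm_eq (TmComp (TmAdd f f') g) (TmAdd (TmComp f g) (TmComp f' g))
| tm_eq_compDr a b c (f : tm b c) (g g' : tm a b) :
    tm_eq (TmComp f (TmAdd g g')) (TmAdd (TmComp f g) (TmComp f g'))
| tm_eq_compZl a b c x (f : tm b c) (g : tm a b) :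
    tm_eq (TmComp (TmScale x f) g) (TmScale x (TmComp f g))
| tm_eq_compZr a b c x (f : tm b c) (g : tm a b) :
    tm_eq (TmComp f (TmScale x g)) (TmScale x (TmComp f g))
| tm_eq_ten_id a b : tm_eq (TmTen (TmId a) (TmId b)) (TmId (a ++ b))
| tm_eq_ten_comp a b c a' b' c' (f : tm b c) (g : tm a b) (f' : tm b' c') (g' : tm a' b') :
    tm_eq (TmTen (TmComp f g) (TmComp f' g')) (TmComp (TmTen f f') (TmTen g g'))
| tm_eq_tenDl a b c d (f f' : tm a b) (g : tm c d) :
    tm_eq (TmTen (TmAdd f f') g) (TmAdd (TmTen f g) (TmTen f' g))
| tm_eq_tenDr a b c d (f : tm a b) (g g' : tm c d) :
    tm_eq (TmTen f (TmAdd g g')) (TmAdd (TmTen f g) (TmTen f g'))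
| tm_eq_tenZl a b c d x (f : tm a b) (g : tm c d) :
    tm_eq (TmTen (TmScale x f) g) (TmScale x (TmTen f g))
| tm_eq_tenZr a b c d x (f : tm a b) (g : tm c d) :
    tm_eq (TmTen f (TmScale x g)) (TmScale x (TmTen f g))
| tm_eq_tenA a b c a' b' c' (f : tm a a') (g : tm b b') (h : tm c c') :
    tm_eq (TmTen f (TmTen g h)) (TmTen (TmTen f g) h)
| tm_eq_ten1x a b (f : tm a b) : tm_eq (TmTen (TmId [::]) f) f
| tm_eq_tenx1 a b (f : tm a b) : tm_eq (TmTen f (TmId [::])) f.

Lemma tm_eq_dom a b c d (f : tm a b) (g : tm c d) : tm_eq f g -> a = c.
Proof. by elim=> {a b c d f g}; intros; rewrite ?cats0 ?catA /=; congruence. Qed.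
Lemma tm_eq_cod a b c d (f : tm a b) (g : tm c d) : tm_eq f g -> b = d.
Proof. by elim=> {a b c d f g}; intros; rewrite ?cats0 ?catA /=; congruence. Qed.

Lemma tm_equiv a b : Equivalence (fun f g : tm a b => tm_eq f g).
Proof.
split=> [f|f g|f g h]; [exact: tm_eq_refl|exact: tm_eq_sym|exact: tm_eq_trans].
Qed.

Definition phom a b := quot (tm_equiv a b).
Definition tm_cls a b (f : tm a b) : phom a b := cls (tm_equiv a b) f.
Definition tm_rep a b (f : phom a b) : tm a b := rep f.

Lemma tm_rep_eq a b (f : tm a b) : tm_eq (tm_rep (tm_cls f)) f.
Proof. exact: rep_cls. Qed.
Lemma tm_clsP a b (f g : tm a b) : tm_eq f g -> tm_cls f = tm_cls g.
Proof. by move=> ?; apply/cls_eqP. Qed.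
Lemma phom_ind a b (P : phom a b -> Prop) : (forall f, P (tm_cls f)) -> forall f, P f.
Proof. exact: quot_ind. Qed.

Definition pid a : phom a a := tm_cls (TmId a).
Definition pcomp a b c (f : phom b c) (g : phom a b) : phom a c :=
  tm_cls (TmComp (tm_rep f) (tm_rep g)).
Definition pzero a b : phom a b := tm_cls (TmZero a b).
Definition padd a b (f g : phom a b) : phom a b :=
  tm_cls (TmAdd (tm_rep f) (tm_rep g)).
Definition popp a b (f : phom a b) : phom a b := tm_cls (TmOpp (tm_rep f)).
Definition pscale a b x (f : phom a b) : phom a b := tm_cls (TmScale x (tm_rep f)).
Definition pten a b c d (f : phom a b) (g : phom c d) : phom (a ++ c) (b ++ d) :=
  tm_cls (TmTen (tm_rep f) (tm_rep g)).

Lemma pcompE a b c (f : tm b c) (g : tm a b) :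
  pcomp (tm_cls f) (tm_cls g) = tm_cls (TmComp f g).
Proof. by apply: tm_clsP; apply: tm_eq_comp; apply: tm_rep_eq. Qed.
Lemma paddE a b (f g : tm a b) : padd (tm_cls f) (tm_cls g) = tm_cls (TmAdd f g).
Proof. by apply: tm_clsP; apply: tm_eq_add; apply: tm_rep_eq. Qed.
Lemma poppE a b (f : tm a b) : popp (tm_cls f) = tm_cls (TmOpp f).
Proof. by apply: tm_clsP; apply: tm_eq_opp; apply: tm_rep_eq. Qed.
Lemma pscaleE a b x (f : tm a b) : pscale x (tm_cls f) = tm_cls (TmScale x f).
Proof. by apply: tm_clsP; apply: tm_eq_scale; apply: tm_rep_eq. Qed.
Lemma ptenE a b c d (f : tm a b) (g : tm c d) :
  pten (tm_cls f) (tm_cls g) = tm_cls (TmTen f g).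
Proof. by apply: tm_clsP; apply: tm_eq_ten; apply: tm_rep_eq. Qed.
Let pE := (pcompE, paddE, poppE, pscaleE, ptenE).

Lemma p_kmodule a b : is_kmodule (@pzero a b) (@padd a b) (@popp a b) (@pscale a b).
Proof.
split.
- elim/phom_ind=> f; elim/phom_ind=> g; elim/phom_ind=> h; rewrite !pE.
  exact/tm_clsP/tm_eq_addA.
- by elim/phom_ind=> f; elim/phom_ind=> g; rewrite !pE; apply/tm_clsP/tm_eq_addC.
- by elim/phom_ind=> f; rewrite !pE; apply/tm_clsP/tm_eq_add0.
- by elim/phom_ind=> f; rewrite !pE; apply/tm_clsP/tm_eq_addN.
- by move=> x y; elim/phom_ind=> f; rewrite !pE; apply/tm_clsP/tm_eq_scaleA.
- by elim/phom_ind=> f; rewrite !pE; apply/tm_clsP/tm_eq_scale1.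
- move=> x; elim/phom_ind=> f; elim/phom_ind=> g; rewrite !pE.
  exact/tm_clsP/tm_eq_scaleDr.
- by elim/phom_ind=> f x y; rewrite !pE; apply/tm_clsP/tm_eq_scaleDl.
Qed.

Lemma pcompA a b c d (f : phom c d) (g : phom b c) (h : phom a b) :
  pcomp f (pcomp g h) = pcomp (pcomp f g) h.
Proof.
elim/phom_ind: f => f; elim/phom_ind: g => g; elim/phom_ind: h => h; rewrite !pE.
exact/tm_clsP/tm_eq_compA.
Qed.
Lemma pcompIm a b (f : phom a b) : pcomp (pid b) f = f.
Proof. by elim/phom_ind: f => f; rewrite !pE; apply/tm_clsP/tm_eq_compIm. Qed.
Lemma pcompmI a b (f : phom a b) : pcomp f (pid a) = f.
Proof. by elim/phom_ind: f => f; rewrite !pE; apply/tm_clsP/tm_eq_compmI. Qed.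
Lemma pcompDl a b c (f f' : phom b c) (g : phom a b) :
  pcomp (padd f f') g = padd (pcomp f g) (pcomp f' g).
Proof.
elim/phom_ind: f => f; elim/phom_ind: f' => f'; elim/phom_ind: g => g; rewrite !pE.
exact/tm_clsP/tm_eq_compDl.
Qed.
Lemma pcompDr a b c (f : phom b c) (g g' : phom a b) :
  pcomp f (padd g g') = padd (pcomp f g) (pcomp f g').
Proof.
elim/phom_ind: f => f; elim/phom_ind: g => g; elim/phom_ind: g' => g'; rewrite !pE.
exact/tm_clsP/tm_eq_compDr.
Qed.
Lemma pcompZl a b c x (f : phom b c) (g : phom a b) :
  pcomp (pscale x f) g = pscale x (pcomp f g).
Proof.
elim/phom_ind: f => f; elim/phom_ind: g => g; rewrite !pE.
exact/tm_clsP/tm_eq_compZl.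
Qed.
Lemma pcompZr a b c x (f : phom b c) (g : phom a b) :
  pcomp f (pscale x g) = pscale x (pcomp f g).
Proof.
elim/phom_ind: f => f; elim/phom_ind: g => g; rewrite !pE.
exact/tm_clsP/tm_eq_compZr.
Qed.

Definition pres_lincat : lincat k := @LinCat k (seq O) phom pid pcomp pzero padd
  popp pscale p_kmodule pcompA pcompIm pcompmI pcompDl pcompDr pcompZl pcompZr.

Lemma tm_eq_arr a b c d (f : tm a b) (g : tm c d) : tm_eq f g ->
  arr_eq (tm_cls f : hom pres_lincat a b) (tm_cls g : hom pres_lincat c d).
Proof.
move=> fg; have ac := tm_eq_dom fg; have bd := tm_eq_cod fg.
by subst c d; rewrite (tm_clsP fg).
Qed.

Lemma pten_id a b : pten (pid a) (pid b) = pid (a ++ b).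
Proof. by rewrite !pE; apply/tm_clsP/tm_eq_ten_id. Qed.
Lemma pten_comp a b c a' b' c' (f : phom b c) (g : phom a b) (f' : phom b' c')
    (g' : phom a' b') :
  pten (pcomp f g) (pcomp f' g') = pcomp (pten f f') (pten g g').
Proof.
elim/phom_ind: f => f; elim/phom_ind: g => g; elim/phom_ind: f' => f'.
by elim/phom_ind: g' => g'; rewrite !pE; apply/tm_clsP/tm_eq_ten_comp.
Qed.
Lemma ptenDl a b c d (f f' : phom a b) (g : phom c d) :
  pten (padd f f') g = padd (pten f g) (pten f' g).
Proof.
elim/phom_ind: f => f; elim/phom_ind: f' => f'; elim/phom_ind: g => g; rewrite !pE.
exact/tm_clsP/tm_eq_tenDl.
Qed.
Lemma ptenDr a b c d (f : phom a b) (g g' : phom c d) :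
  pten f (padd g g') = padd (pten f g) (pten f g').
Proof.
elim/phom_ind: f => f; elim/phom_ind: g => g; elim/phom_ind: g' => g'; rewrite !pE.
exact/tm_clsP/tm_eq_tenDr.
Qed.
Lemma ptenZl a b c d x (f : phom a b) (g : phom c d) :
  pten (pscale x f) g = pscale x (pten f g).
Proof.
elim/phom_ind: f => f; elim/phom_ind: g => g; rewrite !pE.
exact/tm_clsP/tm_eq_tenZl.
Qed.
Lemma ptenZr a b c d x (f : phom a b) (g : phom c d) :
  pten f (pscale x g) = pscale x (pten f g).
Proof.
elim/phom_ind: f => f; elim/phom_ind: g => g; rewrite !pE.
exact/tm_clsP/tm_eq_tenZr.
Qed.
Lemma ptenA a b c a' b' c' (f : phom a a') (g : phom b b') (h : phom c c') :
  arr_eq (pten f (pten g h) : hom pres_lincat _ _)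
         (pten (pten f g) h : hom pres_lincat _ _).
Proof.
elim/phom_ind: f => f; elim/phom_ind: g => g; elim/phom_ind: h => h; rewrite !pE.
exact/tm_eq_arr/tm_eq_tenA.
Qed.
Lemma pten1x a b (f : phom a b) :
  arr_eq (pten (pid [::]) f : hom pres_lincat _ _) (f : hom pres_lincat _ _).
Proof.
by elim/phom_ind: f => f; rewrite !pE; apply/tm_eq_arr/tm_eq_ten1x.
Qed.
Lemma ptenx1 a b (f : phom a b) :
  arr_eq (pten f (pid [::]) : hom pres_lincat _ _) (f : hom pres_lincat _ _).
Proof.
by elim/phom_ind: f => f; rewrite !pE; apply/tm_eq_arr/tm_eq_tenx1.
Qed.

Definition pres_cat : strict_moncat k := @StrictMonCat k pres_lincat
  [::] (@cat O) pten (@catA O) (@cat0s O) (@cats0 O) pten_id pten_comp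
  ptenDl ptenDr ptenZl ptenZr ptenA pten1x ptenx1.

End Presentation.

Inductive dir : Type := Up | Down.

Definition pos_part (c : int) : nat := if c is Posz p then p else 0.
Definition neg_part (c : int) : nat := if c is Negz q then q.+1 else 0.

Inductive heis_gen (c : int) : seq dir -> seq dir -> Type :=
| Gx : heis_gen c [:: Up] [:: Up]
| Gxinv : heis_gen c [:: Up] [:: Up]
| Gtau : heis_gen c [:: Up; Up] [:: Up; Up]
| Gc : heis_gen c [::] [:: Down; Up]
| Gd : heis_gen c [:: Up; Down] [::]
| GL : heis_gen c [:: Down; Up] [:: Up; Down]
| Geta of 'I_(pos_part c) : heis_gen c [::] [:: Up; Down]
| Geps of 'I_(neg_part c) : heis_gen c [:: Down; Up] [::].

Declare Scope heis_scope.
Delimit Scope heis_scope with heis.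
Notation "f \o g" := (TmComp f g) : heis_scope.
Notation "f \ox g" := (TmTen f g) (at level 40, left associativity) : heis_scope.
Notation "f + g" := (TmAdd f g) : heis_scope.
Notation "x *: f" := (TmScale x f) : heis_scope.

Section Heisenberg.
Variables (k : comPzRingType) (z t : ring_unit k).

Local Notation term c := (tm k (heis_gen c)).
Local Notation hx := (TmGen k (Gx _)).
Local Notation hxinv := (TmGen k (Gxinv _)).
Local Notation htau := (TmGen k (Gtau _)).
Local Notation hc := (TmGen k (Gc _)).
Local Notation hd := (TmGen k (Gd _)).
Local Notation hL := (TmGen k (GL _)).
Local Notation heta a := (TmGen k (Geta a)).
Local Notation heps a := (TmGen k (Geps a)).
Local Notation id1 a := (TmId k (heis_gen _) a).
Local Notation up := (id1 [:: Up]).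
Local Notation down := (id1 [:: Down]).
Local Notation unit1 := (id1 [::]).
Local Notation zero := (TmZero k (heis_gen _) _ _).
Local Open Scope heis_scope.

Section Diagrams.
Variable c : int.

Fixpoint xpow (n : nat) : term c [:: Up] [:: Up] :=
  if n is m.+1 then hx \o xpow m else up.

Definition sigma_plus : term c [:: Up; Down] [:: Down; Up] :=
  (down \ox up \ox hd) \o ((down \ox htau \ox down) \o (hc \ox up \ox down)).

(** d o (x^n (x) 1) and (1 (x) x^n) o c, the other entries of the matrix M_k. *)
Definition dot_cap (n : nat) : term c [:: Up; Down] [::] := hd \o (xpow n \ox down).
Definition dot_cup (n : nat) : term c [::] [:: Down; Up] := (down \ox xpow n) \o hc.

End Diagrams.

Definition cprime (c : int) : term c [::] [:: Up; Down] :=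
  match c with
  | Posz 0 => uval t *: (hL \o hc)
  | Posz p.+1 =>
      (- (uinv t * uinv z)) *: ((hxinv \ox down) \o TmGen k (@Geta (Posz p.+1) ord_max))
  | Negz q => uinv t *: (hL \o dot_cup (Negz q) q.+1)
  end.

Definition dprime (c : int) : term c [:: Down; Up] [::] :=
  match c with
  | Posz p => uval t *: (dot_cap (Posz p) p \o hL)
  | Negz q => (- (uinv t * uinv z)) *: TmGen k (@Geps (Negz q) ord0)
  end.

(** Since [pos_part c] = 0 or [neg_part c] = 0, the relations from
   [Heis_L_sigma] to [Heis_eps_cup] say that (L, eta_a) is a two-sided inverse of
   the column (sigma_+, dot_cap a) if c >= 0 and that (L, eps_a) is a two-sided
   inverse of the row (sigma_+, dot_cup a) if c < 0. *)
Inductive heis_rel (c : int) : forall a b, term c a b -> term c a b -> Prop :=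
| Heis_xxinv : heis_rel (hx \o hxinv) up
| Heis_xinvx : heis_rel (hxinv \o hx) up
| Heis_slide : heis_rel (htau \o ((up \ox hx) \o htau)) (hx \ox up)
| Heis_quad : heis_rel (htau \o htau) (uval z *: htau + id1 [:: Up; Up])
| Heis_braid :
    heis_rel ((htau \ox up) \o ((up \ox htau) \o (htau \ox up)))
             ((up \ox htau) \o ((htau \ox up) \o (up \ox htau)))
| Heis_zigzag_up : heis_rel ((hd \ox up) \o (up \ox hc)) up
| Heis_zigzag_down : heis_rel ((down \ox hd) \o (hc \ox down)) down
| Heis_L_sigma :
    heis_rel (hL \o sigma_plus c
              + \big[@TmAdd _ _ _ _ _/zero]_(a < pos_part c) (heta a \o dot_cap c a))
             (id1 [:: Up; Down])
| Heis_sigma_L :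
    heis_rel (sigma_plus c \o hL
              + \big[@TmAdd _ _ _ _ _/zero]_(a < neg_part c) (dot_cup c a \o heps a))
             (id1 [:: Down; Up])
| Heis_sigma_eta (a : 'I_(pos_part c)) : heis_rel (sigma_plus c \o heta a) zero
| Heis_cap_L (a : 'I_(pos_part c)) : heis_rel (dot_cap c a \o hL) zero
| Heis_cap_eta (a b : 'I_(pos_part c)) :
    heis_rel (dot_cap c a \o heta b) (if a == b then unit1 else zero)
| Heis_L_cup (a : 'I_(neg_part c)) : heis_rel (hL \o dot_cup c a) zero
| Heis_eps_sigma (a : 'I_(neg_part c)) : heis_rel (heps a \o sigma_plus c) zero
| Heis_eps_cup (a b : 'I_(neg_part c)) :
    heis_rel (heps a \o dot_cup c b) (if a == b then unit1 else zero)
| Heis_bubble_pos : (0 < c)%R ->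
    heis_rel (hd \o cprime c) ((uval t * uinv z) *: unit1)
| Heis_bubble0 : c = 0%R ->
    heis_rel (hd \o cprime c) ((uval t * uinv z - uinv t * uinv z)%R *: unit1)
| Heis_bubble_neg : (c < 0)%R ->
    heis_rel (dprime c \o dot_cup c (neg_part c)) ((uval t * uinv z) *: unit1).

Definition Heis (c : int) : strict_moncat k := pres_cat (@heis_rel c).

Definition Heis_of (c : int) a b (g : heis_gen c a b) : hom (Heis c) a b :=
  tm_cls (@heis_rel c) (TmGen k g).

End Heisenberg.

(** In the direct sum over n of the categories of A_n-modules, an object is a
   family of modules, all but finitely many of them zero; a morphism is a family
   of linear maps. *)

Section DirectSum.
Variables (k : comPzRingType) (A : nat -> pzalg k).

Record graded_mod := GradedMod {
  gmod :> forall n, lmodType (A n);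
  gmod_fin : exists N, forall n, (N <= n)%N -> forall v : gmod n, v = 0 }.

Definition graded_hom (M N : graded_mod) := forall n, {linear M n -> N n}.

Definition alg_scale n (V : lmodType (A n)) (x : k) (v : V) : V :=
  scal (A n) x *: v.
Lemma alg_scale_linear n (V : lmodType (A n)) (x : k) : linear (@alg_scale n V x).
Proof.
by move=> a u v; rewrite /alg_scale scalerDr !scalerA scal_central.
Qed.
HB.instance Definition _ n (V : lmodType (A n)) (x : k) :=
  GRing.isLinear.Build (A n) V V *:%R (@alg_scale n V x) (@alg_scale_linear n V x).

Definition gr_id M : graded_hom M M := fun n => idfun.
Definition gr_comp M N P (g : graded_hom N P) (h : graded_hom M N) : graded_hom M P :=
  fun n => g n \o h n.
Definition gr_zero M N : graded_hom M N := fun n => \0.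
Definition gr_add M N (g h : graded_hom M N) : graded_hom M N :=
  fun n => g n \+ h n.
Definition gr_scale M N (x : k) (g : graded_hom M N) : graded_hom M N :=
  fun n => @alg_scale n (N n) x \o g n.
Definition gr_opp M N (g : graded_hom M N) : graded_hom M N :=
  fun n => \- g n.

Lemma gr_ext M N (g h : graded_hom M N) : (forall n v, g n v = h n v) -> g = h.
Proof.
by move=> gh; apply: functional_extensionality_dep => n; apply: linear_ext.
Qed.

Lemma gr_kmodule M N :
  is_kmodule (@gr_zero M N) (@gr_add M N) (@gr_opp M N) (@gr_scale M N).
Proof.
split.
- by move=> f g h; apply: gr_ext => n v; apply: addrA.
- by move=> f g; apply: gr_ext => n v; apply: addrC.
- by move=> f; apply: gr_ext => n v; apply: add0r.
- by move=> f; apply: gr_ext => n v; apply: addNr.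
- by move=> x y f; apply: gr_ext => n v; rewrite /= /alg_scale scalerA rmorphM.
- by move=> f; apply: gr_ext => n v; rewrite /= /alg_scale rmorph1 scale1r.
- by move=> x f g; apply: gr_ext => n v; rewrite /= /alg_scale scalerDr.
- by move=> f x y; apply: gr_ext => n v; rewrite /= /alg_scale rmorphD scalerDl.
Qed.

Lemma gr_compA M N P Q (f : graded_hom P Q) (g : graded_hom N P) (h : graded_hom M N) :
  gr_comp f (gr_comp g h) = gr_comp (gr_comp f g) h.
Proof. exact: gr_ext. Qed.
Lemma gr_compIm M N (f : graded_hom M N) : gr_comp (gr_id N) f = f.
Proof. exact: gr_ext. Qed.
Lemma gr_compmI M N (f : graded_hom M N) : gr_comp f (gr_id M) = f.
Proof. exact: gr_ext. Qed.
Lemma gr_compDl M N P (f f' : graded_hom N P) (g : graded_hom M N) :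
  gr_comp (gr_add f f') g = gr_add (gr_comp f g) (gr_comp f' g).
Proof. exact: gr_ext. Qed.
Lemma gr_compDr M N P (f : graded_hom N P) (g g' : graded_hom M N) :
  gr_comp f (gr_add g g') = gr_add (gr_comp f g) (gr_comp f g').
Proof. by apply: gr_ext => n v; apply: linearD. Qed.
Lemma gr_compZl M N P x (f : graded_hom N P) (g : graded_hom M N) :
  gr_comp (gr_scale x f) g = gr_scale x (gr_comp f g).
Proof. exact: gr_ext. Qed.
Lemma gr_compZr M N P x (f : graded_hom N P) (g : graded_hom M N) :
  gr_comp f (gr_scale x g) = gr_scale x (gr_comp f g).
Proof. by apply: gr_ext => n v; apply: linearZ. Qed.

Definition mod_sum : lincat k := @LinCat k graded_mod graded_hom gr_id gr_comp
  gr_zero gr_add gr_opp gr_scale gr_kmodule gr_compA gr_compIm gr_compmI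
  gr_compDl gr_compDr gr_compZl gr_compZr.

(** Induction and restriction along a sequence of k-algebra homomorphisms
   A_n -> A_{n+1}: (ind M)_{n+1} = A_{n+1} (x)_{A_n} M_n and (ind M)_0 = 0,
   while (res M)_n = res M_{n+1}. *)
Variable iota : forall n, {rmorphism A n -> A n.+1}.
Hypothesis iota_scal : forall n a, iota n (scal (A n) a) = scal (A n.+1) a.

Definition ind_obj (M : forall n, lmodType (A n)) (n : nat) : lmodType (A n) :=
  match n with
  | 0 => 'rV[A 0]_0
  | m.+1 => ind_mod (iota m) (M m)
  end.

Lemma ind_obj_fin (M : graded_mod) :
  exists N, forall n, (N <= n)%N -> forall v : ind_obj M n, v = 0.
Proof.
have [N N0] := gmod_fin M; exists N.+1 => -[//|n] Nn /=.
elim/tensor_ind => [s m||u v -> ->|u ->]; rewrite ?addr0 ?oppr0 //.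
rewrite [m]N0 // -[0 in LHS](scale0r (0 : M n)) -tpure_bal rmorph0 mulr0.
by rewrite -(mul0r (1 : A n.+1)) -tpureZ scale0r.
Qed.

Definition ind_gmod (M : graded_mod) : graded_mod := GradedMod (ind_obj_fin M).

Definition ind_hom (M N : graded_mod) (g : graded_hom M N) :
    graded_hom (ind_gmod M) (ind_gmod N) :=
  fun n => match n return {linear ind_obj M n -> ind_obj N n} with
  | 0 => idfun
  | m.+1 => ind_map (iota m) (g m)
  end.

Lemma ind_homP : @is_linfunctor k mod_sum mod_sum ind_gmod ind_hom.
Proof.
have E M N (g h : graded_hom (ind_gmod M) N) :
    (forall n s (m : M n), g n.+1 (tpure (iota n) s m) = h n.+1 (tpure (iota n) s m)) ->
    g = h.
  move=> gh; apply: functional_extensionality_dep => -[|n].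
    by apply: linear_ext => v; rewrite [v]thinmx0 !linear0.
  exact: ind_map_ext.
split=> *; apply: E => n s m /=; rewrite !ind_map_pure //=.
  by rewrite tpureDr.
rewrite /alg_scale -[X in tpure _ _ X]/(scal (A n) _ *: _) -tpure_bal iota_scal.
by rewrite [RHS]tpureZ scal_central.
Qed.

Definition Ind : linfunctor mod_sum mod_sum := LinFunctor ind_homP.

Lemma res_obj_fin (M : graded_mod) :
  exists N, forall n, (N <= n)%N -> forall v : res_mod (iota n) (M n.+1), v = 0.
Proof. by have [N N0] := gmod_fin M; exists N => n Nn v; apply: (N0 n.+1); apply: leqW. Qed.

Definition res_gmod (M : graded_mod) : graded_mod := GradedMod (res_obj_fin M).

Definition res_hom (M N : graded_mod) (g : graded_hom M N) :
    graded_hom (res_gmod M) (res_gmod N) :=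
  fun n => res_map (iota n) (g n.+1).

Lemma res_homP : @is_linfunctor k mod_sum mod_sum res_gmod res_hom.
Proof.
split=> *; apply: gr_ext => n v //.
by rewrite /= /res_map_fun /= /alg_scale [RHS]/(_ *: _) /= /res_scale iota_scal.
Qed.

Definition Res : linfunctor mod_sum mod_sum := LinFunctor res_homP.

End DirectSum.

Section HeckeModules.
Variables (k : comPzRingType) (z : k) (l : nat) (f : 'I_l.+1 -> k).

Definition Hmod : lincat k := mod_sum (cyc_hecke z f).
Definition HInd : linfunctor Hmod Hmod := Ind (@H_incl_scal k z l f).
Definition HRes : linfunctor Hmod Hmod := Res (@H_incl_scal k z l f).

End HeckeModules.

Notation "u \ot v" := (tpure (H_incl _ _ _) u v) (at level 40, left associativity).

(* Main.v *)
From HB Require Import structures.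
Require Import Defs.
From mathcomp Require Import all_boot all_order all_algebra.
From mathcomp Require Import boolp zify.

Set Implicit Arguments.
Unset Strict Implicit.
Unset Printing Implicit Defensive.

Import GRing.Theory.
Local Open Scope ring_scope.
Local Notation hom := Defs.hom.

(** Write A_n for H_n^f, and X = x_{n+1}, tau = tau_n for the last generators of
   A_{n+1}.  A strict monoidal functor out of a category given by generators and
   relations is the same thing as a choice of values for the generators that
   satisfies the relations ([pres_functor]).  Once the values of x, tau, c and d are
   prescribed, the relations on x and tau are identities between the last generators
   of A_{n+1}, A_{n+2} and A_{n+3}, and the zigzag relations are the triangle
   identities of the adjunction.  The content of the theorem lies in the remaining
   generators L and eps_a, which must form a two-sided inverse of the row
   (sigma_+, (1 (x) x^a) c).  On a module M over A_n, that row is the map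

       ind res M (+) M^l -> res ind M,    (w, m) |-> sigma w + sum_a X^a (x) m_a,

   with sigma (u (x) m) = u tau (x) m, and its bijectivity is the Mackey decomposition
   A_{n+1} = A_n tau A_n (+) (+)_{a < l} A_n X^a  ([mackey_surj], [mackey_inj]).

   Surjectivity only needs the relations: the span on the right is stable under left
   multiplication by the generators, because X^a - tau x_n^a tau is a combination of
   lower terms ([mspan_TxT], [mspan_full]).  Injectivity usually rests on the basis
   theorem for A_n.  It is obtained here from a construction: if A_n acts on a
   k-module N, then A_{n+1} acts by explicit formulas on the sum of n + 1 blocks
   N[w]/f(w) ([tower_datum]), which has the size that the induced module ought to
   have.  An A_n-equivariant injection M -> N therefore extends to an A_{n+1}-linear
   map [coord] on ind M, whose behaviour on the row is triangular: X^a (x) m has last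
   block m w^a up to lower powers of w ([rho_X_top]), while sigma w lies in the first
   n blocks, where it is the image of w under [coord] one level below
   ([coord_sigma]).  Induction on n gives the injectivity of the row.

   The last relation evaluates a bubble.  Its value is read off from the component of
   X^l (x) m in the copy of M with index 0, which is - f_l m = - t^2 m
   ([mackey_top]).  When l = 0 it compares two scalars and holds since t^2 = 1.

   For uniqueness, a strict monoidal functor is determined by its values on the
   generators ([monfunctor_eq]); the values of x^-1, L and eps_a follow from those of
   x, tau, c and d, as entries of inverse matrices ([heis_functor_eq]). *)

(** * Homomorphisms out of cyclotomic Hecke algebras *)

Section HeckeDatum.
Variables (k : comPzRingType) (z : k) (l : nat) (f : 'I_l.+1 -> k).
Variable f_inv : k.
Hypothesis f_invK : f ord_max * f_inv = 1.

(** A presentation of H_n^f by x_0 and the tau_j alone (indices start at 0): the other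
   x_i are obtained from x_0 by conjugation ([jucys]), and x_0 is invertible since
   f(x_0) = 0 and the constant term of f is a unit. *)
Record hecke_datum (n : nat) (B : pzalg k) (x : B) (T : nat -> B) : Prop :=
  HeckeDatum {
  hd_quad i : (i.+1 < n)%N -> T i * T i = scal B z * T i + 1;
  hd_comm i j : (i.+1 < j)%N -> (j.+1 < n)%N -> T i * T j = T j * T i;
  hd_braid i : (i.+2 < n)%N -> T i * T i.+1 * T i = T i.+1 * T i * T i.+1;
  hd_xT i : (0 < i)%N -> (i.+1 < n)%N -> x * T i = T i * x;
  hd_xTxT : (1 < n)%N -> x * T 0 * x * T 0 = T 0 * x * T 0 * x;
  hd_f : (0 < n)%N -> poly_eval f x = 0 }.

Fixpoint jucys (B : pzalg k) (x : B) (T : nat -> B) (i : nat) : B :=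
  if i is j.+1 then T j * jucys x T j * T j else x.

Section Consequences.
Variables (n : nat) (B : pzalg k) (x : B) (T : nat -> B).
Hypothesis D : hecke_datum n x T.

Lemma jucys_comm_above i j : (i < j)%N -> (j.+1 < n)%N ->
  GRing.comm (T j) (jucys x T i).
Proof.
move=> + jn; elim: i => [j0|i IH ij] /=; first by rewrite /GRing.comm (hd_xT D).
have Tc : GRing.comm (T j) (T i) by rewrite /GRing.comm [RHS](hd_comm D).
by apply: commrM => //; apply: commrM => //; apply: IH; apply: ltnW.
Qed.

(** In the critical case i = j + 2 this is the braid relation applied twice. *)
Lemma jucys_comm_below i j : (j.+1 < i)%N -> (i < n)%N ->
  GRing.comm (T j) (jucys x T i).
Proof.
elim: i => // i IH; rewrite ltnS leq_eqVlt => /orP[/eqP <-|ji] iN /=; last first.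
  have Tc : GRing.comm (T j) (T i) by rewrite /GRing.comm (hd_comm D).
  by apply: commrM => //; apply: commrM => //; apply: IH => //; apply: ltnW.
have cm : T j.+1 * jucys x T j = jucys x T j * T j.+1.
  exact: (jucys_comm_above (ltnSn j) iN).
have br := hd_braid D iN; rewrite /GRing.comm.
transitivity (T j * T j.+1 * T j * jucys x T j * T j * T j.+1); first by rewrite !mulrA.
rewrite br -!mulrA [_ * (_ * (T j * T j.+1))]mulrA cm -!mulrA.
by congr (_ * (_ * (_ * _))); rewrite !mulrA br.
Qed.

Lemma jucys_comm i j : (i < j)%N -> (j < n)%N ->
  GRing.comm (jucys x T i) (jucys x T j).
Proof.
elim: i => [|i IH] ij jn /=; last first.
  have Tc : GRing.comm (T i) (jucys x T j) by apply: jucys_comm_below.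
  apply: commr_sym; apply: commrM; last exact: commr_sym.
  by apply: commrM; apply: commr_sym => //; apply: IH => //; apply: ltnW.
elim: j ij jn => //= -[|j] IH _ jn.
  by rewrite /GRing.comm /= !mulrA (hd_xTxT D).
have Tc : GRing.comm x (T j.+1) by rewrite /GRing.comm (hd_xT D).
by apply: commrM => //; apply: commrM => //; apply: IH => //; apply: ltnW.
Qed.

(** The quadratic relation says that tau - z is inverse to tau. *)
Lemma hd_TV i : (i.+1 < n)%N -> (T i - scal B z) * T i = 1.
Proof. by move=> iN; rewrite mulrBl (hd_quad D) // addrC addKr. Qed.

Lemma hd_VT i : (i.+1 < n)%N -> T i * (T i - scal B z) = 1.
Proof.
by move=> iN; rewrite mulrBr (hd_quad D) // -scal_central addrC addKr.
Qed.

(** The constant term of f is a unit, so f(x) = 0 exhibits the inverse of x as a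
   polynomial in x. *)
Definition poly_inv (C : pzalg k) (y : C) : C :=
  - (scal C f_inv * \sum_(i < l) scal C (f (widen_ord (leqnSn l) i)) * y ^+ (l - i).-1).

Lemma poly_invK (C : pzalg k) (y : C) : poly_eval f y = 0 -> y * poly_inv y = 1.
Proof.
rewrite /poly_eval big_ord_recr /= subnn expr0 mulr1 => /eqP.
rewrite addr_eq0 => /eqP E; rewrite /poly_inv mulrN mulrA -scal_central -mulrA.
rewrite mulr_sumr (eq_bigr (fun i : 'I_l =>
    scal C (f (widen_ord (leqnSn l) i)) * y ^+ (l - i))) => [|i _].
  by rewrite E mulrN opprK -rmorphM [f_inv * _]mulrC f_invK rmorph1.
by rewrite mulrA -scal_central -mulrA -exprS prednK // subn_gt0.
Qed.

Lemma poly_inv_comm (C : pzalg k) (y : C) : y * poly_inv y = poly_inv y * y.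
Proof.
rewrite /poly_inv mulrN mulNr; congr (- _); rewrite mulrA -scal_central -!mulrA.
congr (_ * _); rewrite mulr_sumr mulr_suml; apply: eq_bigr => i _.
by rewrite mulrA -scal_central -!mulrA -exprS exprSr.
Qed.

Fixpoint jucys_inv (i : nat) : B :=
  if i is j.+1 then (T j - scal B z) * jucys_inv j * (T j - scal B z) else poly_inv x.

Lemma jucysV i : (i < n)%N ->
  jucys x T i * jucys_inv i = 1 /\ jucys_inv i * jucys x T i = 1.
Proof.
elim: i => [|i IH] iN /=.
  have h : x * poly_inv x = 1 by apply: poly_invK; apply: hd_f D _.
  by rewrite -poly_inv_comm h.
have [h1 h2] := IH (ltnW iN); split.
  rewrite !mulrA -(mulrA _ (T i) (_ - _)) hd_VT // mulr1 -(mulrA (T i)) h1 mulr1.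
  by rewrite hd_VT.
rewrite !mulrA -(mulrA _ (_ - _) (T i)) hd_TV // mulr1 -(mulrA (_ - _)) h2 mulr1.
by rewrite hd_TV.
Qed.

Definition datum_gen (g : hecke_gen n) : B :=
  match g with
  | HX i => jucys x T i
  | HXinv i => jucys_inv i
  | HTau j => T j
  end.

Lemma ltn_pred_S (j : 'I_n.-1) : (j.+1 < n)%N.
Proof. by case: n j => [|m] // [j jm] /=; [case: j jm|rewrite ltnS]. Qed.

Let F : {rmorphism free_alg k (hecke_gen n) -> B} := free_lift (B := B) datum_gen.

Lemma datum_AH_rel a b : AH_rel z a b -> F a = F b.
Proof.
have E g : F (free_var k g) = datum_gen g by apply: free_lift_var.
have Es c : F (scal (free_alg k _) c) = scal B c by apply: free_lift_scal.
case=> {a b} [i|i|i i'|j i i' ij ij'|j i ij ij'|j|j j' jj|j j' jj];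
  rewrite ?(rmorphM F, rmorphD F, rmorphXn F, rmorph1 F) ?E ?Es /=.
- exact: (jucysV (ltn_ord _)).1.
- exact: (jucysV (ltn_ord _)).2.
- move: (ltn_ord i) (ltn_ord i'); case: (ltngtP i i') => [ii' _ in'|ii' iN _|->//].
    exact: jucys_comm.
  by apply: esym; apply: jucys_comm.
- by rewrite ij ij'.
- move: (ltn_pred_S j) (ltn_ord i) ij ij'; case: (ltngtP i j) => // ij jn iN _ ij'.
    exact: jucys_comm_above.
  apply: jucys_comm_below => //; rewrite ltn_neqAle ij andbT eq_sym; exact/eqP.
- by rewrite expr2 (hd_quad D) ?ltn_pred_S.
- by case: jj => jj; [|apply: esym]; rewrite (hd_comm D) ?ltn_pred_S.
- by move: (ltn_pred_S j'); rewrite jj => jn; rewrite (hd_braid D).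
Qed.

Definition datum_AH : {rmorphism aff_hecke z n -> B} := quot_lift datum_AH_rel.

Lemma datum_AHE g : datum_AH (AH_of z g) = datum_gen g.
Proof. by rewrite /datum_AH quot_lift_pi; apply: free_lift_var. Qed.

Lemma datum_AH_scal a : datum_AH (scal (aff_hecke z n) a) = scal B a.
Proof. by rewrite /datum_AH quot_lift_pi; apply: free_lift_scal. Qed.

Lemma datum_cyc_rel a b : cyc_rel f a b -> datum_AH a = datum_AH b.
Proof.
case=> i i0; rewrite rmorph0 /poly_eval rmorph_sum -[RHS](hd_f D) /poly_eval.
  apply: eq_bigr => j _.
  by rewrite (rmorphM datum_AH) (rmorphXn datum_AH) datum_AHE datum_AH_scal /= i0.
exact: leq_ltn_trans (ltn_ord i).
Qed.

Definition datum_hom : {rmorphism cyc_hecke z f n -> B} := quot_lift datum_cyc_rel.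

Lemma datum_homE g : datum_hom (H_of z f g) = datum_gen g.
Proof. by rewrite /datum_hom quot_lift_pi datum_AHE. Qed.

Lemma datum_hom_scal a : datum_hom (scal (cyc_hecke z f n) a) = scal B a.
Proof. by rewrite /datum_hom quot_lift_pi datum_AH_scal. Qed.

End Consequences.

Local Notation A := (cyc_hecke z f).

(** Indexing by natural numbers, with the value 0 out of range, spares all casts
   between the ordinals of different levels; most commutation relations hold
   without any bound on the index. *)
Definition gx n (i : nat) : A n :=
  if insub i is Some i' then H_of z f (HX (i' : 'I_n)) else 0.
Definition gxV n (i : nat) : A n :=
  if insub i is Some i' then H_of z f (HXinv (i' : 'I_n)) else 0.
Definition gtau n (j : nat) : A n :=
  if insub j is Some j' then H_of z f (@HTau n (j' : 'I_n.-1)) else 0.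

Lemma gxE n (i : 'I_n) : gx n i = H_of z f (HX i).
Proof. by rewrite /gx valK. Qed.
Lemma gxVE n (i : 'I_n) : gxV n i = H_of z f (HXinv i).
Proof. by rewrite /gxV valK. Qed.
Lemma gtauE n (j : 'I_n.-1) : gtau n j = H_of z f (HTau j).
Proof. by rewrite /gtau valK. Qed.

Lemma gx_ord n i (iN : (i < n)%N) : gx n i = H_of z f (HX (Ordinal iN)).
Proof. exact: gxE (Ordinal iN). Qed.
Lemma gxV_ord n i (iN : (i < n)%N) : gxV n i = H_of z f (HXinv (Ordinal iN)).
Proof. exact: gxVE (Ordinal iN). Qed.
Lemma gtau_ord n j (jn : (j < n.-1)%N) : gtau n j = H_of z f (HTau (Ordinal jn)).
Proof. exact: gtauE (Ordinal jn). Qed.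

Lemma gx_last n : x_last z f n = gx n.+1 n.
Proof. by rewrite /x_last -gxE. Qed.
Lemma gtau_last n : tau_last z f n = gtau n.+2 n.
Proof. by rewrite /tau_last -gtauE. Qed.

Lemma gtau_default n j : (n <= j.+1)%N -> gtau n j = 0.
Proof. by move=> nj; rewrite /gtau insubN // -leqNgt; case: n nj. Qed.

Lemma ltn_pred n j : (j.+1 < n)%N -> (j < n.-1)%N.
Proof. by case: n. Qed.

Lemma H_rel n a b : AH_rel z a b ->
  quot_pi (@cyc_rel k z l f n) (quot_pi (@AH_rel k z n) a)
  = quot_pi (@cyc_rel k z l f n) (quot_pi (@AH_rel k z n) b).
Proof. by move=> /quot_pi_rel ->. Qed.

Lemma gtau_quad n j : (j.+1 < n)%N ->
  gtau n j * gtau n j = scal (A n) z * gtau n j + 1.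
Proof.
move=> /ltn_pred jn; rewrite gtau_ord.
by have := H_rel (AH_tt z (Ordinal jn)); rewrite expr2 !(rmorphM, rmorphD, rmorph1).
Qed.

Lemma gtau_comm n i j : (i.+1 < j)%N -> gtau n i * gtau n j = gtau n j * gtau n i.
Proof.
move=> ij; case: (ltnP j n.-1) => jn; last first.
  by rewrite [gtau n j]gtau_default ?mulr0 ?mul0r // -ltnS; case: n jn.
have iN : (i < n.-1)%N by apply: ltn_trans jn; apply: ltnW.
rewrite (gtau_ord jn) (gtau_ord iN).
by have := H_rel (@AH_ttC _ z n (Ordinal iN) (Ordinal jn) (or_introl ij));
  rewrite !rmorphM.
Qed.

Lemma gtau_braid n i : (i.+2 < n)%N ->
  gtau n i * gtau n i.+1 * gtau n i = gtau n i.+1 * gtau n i * gtau n i.+1.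
Proof.
move=> /ltn_pred jn; have iN := ltnW jn.
rewrite (gtau_ord jn) (gtau_ord iN).
by have := H_rel (@AH_braid _ z n (Ordinal iN) (Ordinal jn) erefl); rewrite !rmorphM.
Qed.

Lemma gxS n i : (i.+1 < n)%N -> gx n i.+1 = gtau n i * gx n i * gtau n i.
Proof.
move=> iN; have i1 := ltn_pred iN; have i2 := ltnW iN.
rewrite (gx_ord iN) (gx_ord i2) (gtau_ord i1).
have := H_rel (@AH_txt _ z n (Ordinal i1) (Ordinal i2) (Ordinal iN) erefl erefl).
by rewrite !rmorphM.
Qed.

Lemma gtau_gx n i j : i != j -> i != j.+1 -> gtau n j * gx n i = gx n i * gtau n j.
Proof.
rewrite /gtau /gx; case: insubP => [j' _ <-|_]; last by rewrite mul0r mulr0.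
case: insubP => [i' _ <-|_] /eqP h1 /eqP h2; last by rewrite mul0r mulr0.
by have := H_rel (AH_tx z h1 h2); rewrite !rmorphM.
Qed.

Lemma gx_comm n i j : gx n i * gx n j = gx n j * gx n i.
Proof.
rewrite /gx; case: insubP => [j' _ _|_]; last by rewrite mul0r mulr0.
case: insubP => [i' _ _|_]; last by rewrite mul0r mulr0.
by have := H_rel (AH_xx z j' i'); rewrite !rmorphM.
Qed.

Lemma gx_f n : (0 < n)%N -> poly_eval f (gx n 0) = 0.
Proof.
move=> n0; rewrite (gx_ord n0).
have := quot_pi_rel (@Cyc_f _ z _ f n (Ordinal n0) erefl).
rewrite rmorph0 /poly_eval rmorph_sum => h; rewrite -[RHS]h.
by apply: eq_bigr => j _; rewrite rmorphM rmorphXn.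
Qed.

Lemma gxVK n i : (i < n)%N -> gx n i * gxV n i = 1 /\ gxV n i * gx n i = 1.
Proof.
move=> iN; rewrite (gx_ord iN) (gxV_ord iN).
have := H_rel (AH_xxinv z (Ordinal iN)); have := H_rel (AH_xinvx z (Ordinal iN)).
by rewrite !(rmorphM, rmorph1).
Qed.

Lemma hecke_datum_self n : hecke_datum n (gx n 0) (gtau n).
Proof.
split.
- exact: gtau_quad.
- by move=> i j ij _; apply: gtau_comm.
- exact: gtau_braid.
- by case=> // i _ _; rewrite gtau_gx.
- by move=> n1; have := gx_comm n 0 1; rewrite gxS // !mulrA.
- exact: gx_f.
Qed.

(** In this induction principle x_1, ..., x_{n-1} and all inverses are absent, since they
   are polynomial expressions in the remaining generators. *)
Lemma hecke_ind n (P : A n -> Prop) :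
  (forall a, P (scal (A n) a)) ->
  (forall u v, P u -> P v -> P (u + v)) -> (forall u v, P u -> P v -> P (u * v)) ->
  ((0 < n)%N -> P (gx n 0)) -> (forall j, (j.+1 < n)%N -> P (gtau n j)) ->
  forall u, P u.
Proof.
move=> Ps PD PM Px PT.
have PN u : P u -> P (- u).
  by move=> Pu; rewrite -mulN1r -(rmorph1 (scal (A n))) -rmorphN; apply: PM.
have Psum (I : finType) (F : I -> A n) : (forall i, P (F i)) -> P (\sum_i F i).
  move=> PF; elim/big_ind: _ => //; first by rewrite -(rmorph0 (scal (A n))).
have PX u m : P u -> P (u ^+ m).
  move=> Pu; elim: m => [|m IH]; last by rewrite exprS; apply: PM.
  by rewrite expr0 -(rmorph1 (scal (A n))).
have Pxi i : (i < n)%N -> P (gx n i).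
  elim: i => [//|i IH] iN; rewrite gxS //.
  by apply: (PM); [apply: (PM); [exact: PT|apply/IH/ltnW]|exact: PT].
have D := hecke_datum_self n.
have PxV i : (i < n)%N -> P (gxV n i).
  elim: i => [|i IH] iN.
    have -> : gxV n 0 = poly_inv (gx n 0).
      rewrite -[LHS]mulr1 -(poly_invK (gx_f iN)) mulrA.
      by rewrite (gxVK iN).2 mul1r.
    by apply: PN; apply: (PM) => //; apply: Psum => j; apply: (PM) => //; apply/PX/Pxi.
  have -> : gxV n i.+1 = (gtau n i - scal _ z) * gxV n i * (gtau n i - scal _ z).
    rewrite -[LHS]mulr1; set r := RHS.
    have <- : gx n i.+1 * r = 1.
      rewrite gxS // /r !mulrA -(mulrA _ (gtau n i) (_ - _)) (hd_VT D) // mulr1.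
      by rewrite -(mulrA (gtau n i)) (gxVK (ltnW iN)).1 mulr1 (hd_VT D).
    by rewrite mulrA (gxVK iN).2 mul1r.
  have Ps' : P (gtau n i - scal _ z) by apply: PD; [exact: PT|exact/PN].
  by apply: (PM) => //; apply: (PM) => //; apply/IH/ltnW.
(* the elements are classes of formal expressions, through three quotients *)
elim/quot_ind=> a; elim/quot_ind: a => a; elim/quot_ind: a; elim=> [[i|i|j]|a|u Pu v Pv|u Pu|u Pu v Pv].
- by rewrite -[P _]/(P (H_of z f (HX i))) -gxE; apply: Pxi.
- by rewrite -[P _]/(P (H_of z f (HXinv i))) -gxVE; apply: PxV.
- by rewrite -[P _]/(P (H_of z f (HTau j))) -gtauE; apply: PT; apply: ltn_pred_S.
- exact: Ps a.
- have := PD _ _ Pu Pv; rewrite -[_ + _]/(aquot_add _ _) aquot_addE.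
  by rewrite -[_ + _]/(aquot_add _ _) aquot_addE -[_ + _]/(free_add _ _) free_addE.
- have := PN _ Pu; rewrite -[- _]/(aquot_opp _) aquot_oppE.
  by rewrite -[- _]/(aquot_opp _) aquot_oppE -[- _]/(free_opp _) free_oppE.
- have := PM _ _ Pu Pv; rewrite -[_ * _]/(aquot_mul _ _) aquot_mulE.
  by rewrite -[_ * _]/(aquot_mul _ _) aquot_mulE -[_ * _]/(free_mul _ _) free_mulE.
Qed.

Lemma H_incl_x n i : (i < n)%N -> H_incl z f n (gx n i) = gx n.+1 i.
Proof.
move=> iN; by rewrite (gx_ord iN) H_inclE /= -gxE.
Qed.

Lemma H_incl_tau n j : (j.+1 < n)%N -> H_incl z f n (gtau n j) = gtau n.+1 j.
Proof.
move=> /ltn_pred jn; by rewrite (gtau_ord jn) H_inclE /= -gtauE.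
Qed.
End HeckeDatum.

(** * Endomorphism algebras *)

Section EndAlg.
Variables (k : comPzRingType) (V : lmodType k).

Definition kend := {linear V -> V}.
HB.instance Definition _ := gen_eqMixin kend.
HB.instance Definition _ := gen_choiceMixin kend.

Definition kend_add (g h : kend) : kend := g \+ h.
Definition kend_opp (g : kend) : kend := \- g.
Definition kend_zero : kend := \0.
Definition kend_mul (g h : kend) : kend := g \o h.
Definition kend_one : kend := idfun.

Lemma kend_addA : associative kend_add.
Proof. by move=> g h i; apply: linear_ext => v; apply: addrA. Qed.
Lemma kend_addC : commutative kend_add.
Proof. by move=> g h; apply: linear_ext => v; apply: addrC. Qed.
Lemma kend_add0 : left_id kend_zero kend_add.
Proof. by move=> g; apply: linear_ext => v; apply: add0r. Qed.
Lemma kend_addN : left_inverse kend_zero kend_opp kend_add.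
Proof. by move=> g; apply: linear_ext => v; apply: addNr. Qed.
Lemma kend_mulA : associative kend_mul.
Proof. by move=> g h i; apply: linear_ext. Qed.
Lemma kend_1mul : left_id kend_one kend_mul.
Proof. by move=> g; apply: linear_ext. Qed.
Lemma kend_mul1 : right_id kend_one kend_mul.
Proof. by move=> g; apply: linear_ext. Qed.
Lemma kend_mulDl : left_distributive kend_mul kend_add.
Proof. by move=> g h i; apply: linear_ext. Qed.
Lemma kend_mulDr : right_distributive kend_mul kend_add.
Proof. by move=> g h i; apply: linear_ext => v; apply: linearD. Qed.

HB.instance Definition _ := GRing.isPzRing.Build kend
  kend_addA kend_addC kend_add0 kend_addN
  kend_mulA kend_1mul kend_mul1 kend_mulDl kend_mulDr.

Definition kend_scal (a : k) : kend := ( *:%R a : V -> V).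
Lemma kend_scal_nmod : nmod_morphism kend_scal.
Proof.
split=> [|a b]; apply: linear_ext => v; first exact: scale0r.
exact: scalerDl.
Qed.
Lemma kend_scal_monoid : monoid_morphism kend_scal.
Proof.
split=> [|a b]; apply: linear_ext => v; first exact: scale1r.
exact/esym/scalerA.
Qed.
HB.instance Definition _ :=
  GRing.isNmodMorphism.Build k kend kend_scal kend_scal_nmod.
HB.instance Definition _ :=
  GRing.isMonoidMorphism.Build k kend kend_scal kend_scal_monoid.

Lemma kend_scal_central a (g : kend) : kend_scal a * g = g * kend_scal a.
Proof. by apply: linear_ext => v; rewrite [RHS]linearZ. Qed.

Definition kend_alg : pzalg k := @PzAlg k kend kend_scal kend_scal_central.

Lemma kend_mulE (g h : kend_alg) v : (g * h : kend) v = (g : kend) ((h : kend) v).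
Proof. by []. Qed.
Lemma kend_addE (g h : kend_alg) v : (g + h : kend) v = (g : kend) v + (h : kend) v.
Proof. by []. Qed.
Lemma kend_expE (g : kend_alg) m v :
  (g ^+ m : kend) v = iter m (g : kend) v.
Proof.
elim: m => [|m IH]; first by rewrite expr0.
by rewrite exprS kend_mulE IH.
Qed.
Lemma kend_sumE (I : finType) (F : I -> kend_alg) v :
  (\sum_i F i : kend) v = \sum_i (F i : kend) v.
Proof. exact: (big_morph (fun g : kend => g v) (fun _ _ => erefl) erefl). Qed.

End EndAlg.

(** The alias keeps the R-module structure given by rho apart from the k-module
   structure of V. *)
Section Twist.
Variables (k : comPzRingType) (V : lmodType k) (R : pzRingType).
Variable rho : {rmorphism R -> kend_alg V}.

Definition twist_carrier of {rmorphism R -> kend_alg V} : Type := V.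
Local Notation W := (twist_carrier rho).
HB.instance Definition _ := GRing.Zmodule.on W.

Definition twist_scale (r : R) (v : W) : W := (rho r : kend V) v.
Lemma twist_scaleA a b v : twist_scale a (twist_scale b v) = twist_scale (a * b) v.
Proof. by rewrite /twist_scale rmorphM. Qed.
Lemma twist_scale1 : left_id 1 twist_scale.
Proof. by move=> v; rewrite /twist_scale rmorph1. Qed.
Lemma twist_scaleDr : right_distributive twist_scale +%R.
Proof. by move=> a v w; apply: linearD. Qed.
Lemma twist_scaleDl v : {morph twist_scale^~ v : a b / a + b}.
Proof. by move=> a b; rewrite /twist_scale rmorphD. Qed.
HB.instance Definition _ := GRing.Zmodule_isLmodule.Build R W
  twist_scaleA twist_scale1 twist_scaleDr twist_scaleDl.

Definition twist : lmodType R := W.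
End Twist.

(** * Identities with inverse braidings *)

Section DatumIdentities.
Variables (k : comPzRingType) (z : k) (l : nat) (f : 'I_l.+1 -> k).
Variables (n : nat) (B : pzalg k) (x : B) (T : nat -> B).
Hypothesis D : hecke_datum z f n x T.

Local Notation s i := (T i - scal B z).

Lemma hd_quadV i : (i.+1 < n)%N -> s i * s i = 1 - scal B z * s i.
Proof. by move=> iN; rewrite [LHS]mulrBl (hd_VT D) // -mulrBr. Qed.

(** s_{p-1} ... s_0, where s_i is the inverse of tau_i *)
Fixpoint descent (p : nat) : B := if p is q.+1 then s q * descent q else 1.

Lemma descent_comm_above p q : (p < q)%N -> (q.+1 < n)%N ->
  GRing.comm (T q) (descent p).
Proof.
move=> + qn; elim: p => [|p IH] pq /=; first exact: commr1.
apply: commrM; last by apply/IH/ltnW.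
apply: commrB; last exact/commr_sym/scal_central.
by rewrite /GRing.comm [RHS](hd_comm D).
Qed.

Lemma descentTl p : (p.+1 < n)%N -> T p * descent p.+1 = descent p.
Proof. by move=> pn; rewrite /= mulrA (hd_VT D) // mul1r. Qed.

Lemma hd_braid_inv i : (i.+2 < n)%N -> s i.+1 * s i * T i.+1 = T i * s i.+1 * s i.
Proof.
move=> iN; have i1 : (i.+1 < n)%N := ltnW iN.
have E : T i * T i.+1 * (s i.+1 * s i * T i.+1) = T i * T i.+1 * (T i * s i.+1 * s i).
  rewrite !mulrA -(mulrA (T i)) (hd_VT D) // mulr1 (hd_VT D) // mul1r.
  by rewrite (hd_braid D) // -(mulrA _ (T i.+1)) (hd_VT D) // mulr1 -mulrA (hd_VT D) // mulr1.
have := congr1 (fun u => s i.+1 * (s i * u)) E.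
rewrite -!(mulrA (T i) (T i.+1)) !(mulrA (s i) (T i)) !(hd_TV D) // !mul1r.
by rewrite !(mulrA (s i.+1) (T i.+1)) !(hd_TV D) // !mul1r.
Qed.

Lemma descent_shift p i : (i.+1 < p)%N -> (p < n)%N ->
  descent p * T i.+1 = T i * descent p.
Proof.
elim: p => // p IH; rewrite ltnS leq_eqVlt => /orP[/eqP <-|ip] pn /=.
  rewrite -!mulrA -(descent_comm_above (ltnSn i) pn).
  by rewrite !mulrA hd_braid_inv.
rewrite -mulrA (IH ip (ltnW pn)) !mulrA; congr (_ * _).
have : GRing.comm (T i) (s p); last by move=> ->.
apply: commrB; last exact/commr_sym/scal_central.
by rewrite /GRing.comm (hd_comm D).
Qed.

(** All factors of a descent but the last commute with x. *)
Lemma descent_split p : (p.+1 < n)%N ->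
  exists2 u, descent p.+1 = u * s 0 & GRing.comm x u.
Proof.
elim: p => [|p IH] pn; first by exists 1; [rewrite /= mulr1 mul1r|exact: commr1].
have [u Eu xu] := IH (ltnW pn); exists (s p.+1 * u).
  by rewrite -mulrA -Eu.
apply: commrM => //; apply: commrB; last exact/commr_sym/scal_central.
by rewrite /GRing.comm (hd_xT D).
Qed.

Lemma hd_x2_comm : (1 < n)%N -> GRing.comm (T 0 * x * T 0) x.
Proof. by move=> n1; rewrite /GRing.comm -(hd_xTxT D) // !mulrA. Qed.

(** This is how x_0 moves past s_0 x_0^a tau_0; it follows from x_0 = s_0 x_1 s_0 and
   from x_1 = tau_0 x_0 tau_0 commuting with x_0. *)
Lemma hd_key a : (1 < n)%N ->
  x * s 0 * x ^+ a * T 0 =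
  s 0 * x ^+ a * T 0 * x
  + scal B z * (x * s 0 * x ^+ a) - scal B z * (x ^+ a.+1 * s 0).
Proof.
move=> n1; set w := T 0 * x * T 0; set Z := scal B z.
have xE : x = s 0 * w * s 0.
  by rewrite /w !mulrA (hd_TV D) // mul1r -mulrA (hd_VT D) // mulr1.
have wx m : w * x ^+ m = x ^+ m * w by apply: commrX; apply: hd_x2_comm.
have sw : s 0 * w = x * T 0 by rewrite /w !mulrA (hd_TV D) // mul1r.
have TT := hd_quad D n1; have ss := hd_quadV n1.
have sE : T 0 = s 0 + Z by rewrite subrK.
move: ss xE sw sE; move: (T 0 - scal B z) => S ss xE sw sE.
have Zc u : Z * u = u * Z by apply: scal_central.
have -> : x * S * x ^+ a * T 0 = S * x ^+ a * w * T 0 - Z * (x ^+ a.+1 * T 0).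
  rewrite {1}xE -(mulrA _ S S) ss mulrBr mulr1 !mulrBl; congr (_ - _).
    by rewrite -(mulrA S w) wx !mulrA.
  by rewrite (mulrA _ Z S) -(Zc (S * w)) -(mulrA Z) -xE exprS !mulrA.
have -> : S * x ^+ a * w * T 0 = S * x ^+ a * T 0 * x + Z * (x * T 0 * x ^+ a).
  rewrite -sw -(mulrA S w) wx /w -!mulrA TT mulrDr mulr1.
  rewrite !mulrDr [RHS]addrC; congr (_ + _).
  by rewrite !mulrA -(Zc (S * x ^+ a * T 0 * x)) !mulrA.
rewrite -!addrA; congr (_ + _).
rewrite sE mulrDr mulrDl !mulrDr.
have -> : Z * (x * Z * x ^+ a) = Z * (x ^+ a.+1 * Z).
  by congr (_ * _); rewrite -(Zc x) -(mulrA Z) -exprS Zc.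
by rewrite [_ + Z * (_ * Z) in X in _ - X]addrC addrKA.
Qed.

End DatumIdentities.

(** * The module M[w]/f(w) *)

Section CompanionModule.
Variables (k : comPzRingType) (l : nat) (f : 'I_l.+1 -> k).
Hypothesis f0 : f ord0 = 1.

(** The coefficient of w^b in f. *)
Definition coef (b : nat) : k := f (inord (l - b)).

Lemma poly_eval_coef (B : pzalg k) (y : B) :
  poly_eval f y = y ^+ l + \sum_(b < l) scal B (coef b) * y ^+ b.
Proof.
rewrite /poly_eval (reindex_inj rev_ord_inj) big_ord_recr /= addrC; congr (_ + _).
  have -> : rev_ord (ord_max : 'I_l.+1) = ord0 by apply: val_inj; rewrite /= subSS subnn.
  by rewrite f0 rmorph1 mul1r subSS subnn subn0.
apply: eq_bigr => b _; rewrite subSS subKn 1?ltnW //; congr (scal B (f _) * _).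
by apply: val_inj; rewrite /= inordK ?subSS // ltnS leq_subr.
Qed.

Variable M : lmodType k.

(** M[w] / f(w), through the coefficients of w^0, ..., w^(l-1). *)
Definition polyM : lmodType k := {ffun 'I_l -> M}.

Definition mon_fun (a : nat) (m : M) : polyM := [ffun b : 'I_l => if b == a :> nat then m else 0].
Lemma mon_linear a : linear (mon_fun a).
Proof.
by move=> c u v; apply/ffunP => b; rewrite !ffunE; case: ifP => //; rewrite scaler0 addr0.
Qed.
HB.instance Definition _ a := GRing.isLinear.Build k M polyM *:%R (mon_fun a) (mon_linear a).
(** m w^a *)
Definition mon a : {linear M -> polyM} := mon_fun a.

Lemma polyM_decomp (y : polyM) : y = \sum_(a < l) mon a (y a).
Proof.
apply/ffunP => b; rewrite sum_ffunE (bigD1 b) //= ffunE eqxx big1 ?addr0 // => a ab.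
by rewrite ffunE ifF //; apply/negbTE; rewrite eq_sym.
Qed.

Lemma polyM_ext (N : lmodType k) (g h : {linear polyM -> N}) :
  (forall a m, (a < l)%N -> g (mon a m) = h (mon a m)) -> forall y, g y = h y.
Proof.
by move=> gh y; rewrite [y]polyM_decomp !linear_sum; apply: eq_bigr => a _; apply: gh.
Qed.

Definition coefwise_fun (g : {linear M -> M}) (y : polyM) : polyM :=
  [ffun a => g (y a)].
Lemma coefwise_linear (g : {linear M -> M}) : linear (coefwise_fun g).
Proof. by move=> c u v; apply/ffunP => b; rewrite !ffunE linearP. Qed.
HB.instance Definition _ g :=
  GRing.isLinear.Build k polyM polyM *:%R (coefwise_fun g) (coefwise_linear g).
Definition coefwise g : {linear polyM -> polyM} := coefwise_fun g.

Lemma coefwise_mon g a m : coefwise g (mon a m) = mon a (g m).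
Proof. by apply/ffunP => b; rewrite !ffunE; case: ifP => //; rewrite linear0. Qed.

Definition coord_at (a : nat) (y : polyM) : M := if insub a is Some b then y b else 0.
Lemma coord_at_linear a : linear (coord_at a).
Proof.
by move=> c u v; rewrite /coord_at; case: insub => [b|]; rewrite ?ffunE ?scaler0 ?addr0.
Qed.
HB.instance Definition _ a := GRing.isLinear.Build k polyM M *:%R (coord_at a) (coord_at_linear a).

Lemma coord_at_mon a b m : (b < l)%N -> coord_at b (mon a m) = if b == a then m else 0.
Proof. by move=> bl; rewrite /coord_at insubT ffunE. Qed.

(** Multiplication by w. *)
Definition wmul_fun (y : polyM) : polyM :=
  [ffun b : 'I_l => (if nat_of_ord b is c.+1 then coord_at c y else 0)
    - coef b *: coord_at l.-1 y].
Lemma wmul_linear : linear wmul_fun.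
Proof.
move=> c u v; apply/ffunP => b; rewrite !ffunE (linearP (coord_at l.-1)) scalerBr.
rewrite [coef b *: (_ + _)]scalerDr [- (_ + _)]opprD !scalerA [coef b * c]mulrC.
case: (nat_of_ord b) => [|d]; first by rewrite scaler0 !add0r.
by rewrite linearP addrACA.
Qed.
HB.instance Definition _ := GRing.isLinear.Build k polyM polyM *:%R wmul_fun wmul_linear.
Definition wmul : {linear polyM -> polyM} := wmul_fun.

Lemma wmul_coefwise g y : wmul (coefwise g y) = coefwise g (wmul y).
Proof.
apply/ffunP => b; rewrite !ffunE linearB [g (_ *: _)]linearZ.
have E a : coord_at a (coefwise g y) = g (coord_at a y).
  by rewrite /coord_at; case: insub => [c|]; rewrite ?ffunE ?linear0.
by rewrite E; case: (nat_of_ord b) => [|c]; rewrite ?linear0 ?E.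
Qed.

Lemma wmul_mon a m : (a.+1 < l)%N -> wmul (mon a m) = mon a.+1 m.
Proof.
move=> al; apply/ffunP => b; rewrite !ffunE coord_at_mon ?ltn_predL 1?(leq_trans _ al) //.
rewrite ifF; last by apply/negbTE; rewrite neq_ltn; case: l al => // ? /ltnSE -> ; rewrite orbT.
rewrite scaler0 subr0; case: b => -[|c] cl //=; rewrite coord_at_mon ?eqSS //.
exact: ltnW.
Qed.

Lemma iter_wmul a m : (a < l)%N -> iter a wmul (mon 0 m) = mon a m.
Proof. by elim: a => //= a IH al; rewrite IH 1?ltnW // wmul_mon. Qed.

(** This is the reduction of w^l modulo f, by means of f_0 = 1. *)
Lemma iter_wmul_top m :
  iter l wmul (mon 0 m) = - \sum_(b < l) coef b *: mon b m.
Proof.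
case E : l => [|l'] /=; first by apply/ffunP => b; have : (b < 0)%N by rewrite -E.
rewrite -E iter_wmul ?E //; apply/ffunP => b.
have E1 : l.-1 = l' by rewrite E.
rewrite ffunE E1 coord_at_mon; last by rewrite E.
rewrite eqxx ffunE sum_ffunE (bigD1 b) //= big1 => [|a ab].
  rewrite !ffunE eqxx addr0; case: b => -[|c] cl /=; first by rewrite sub0r.
  rewrite coord_at_mon ?(ltnW cl) // ifF ?sub0r //; apply/negbTE; rewrite neq_ltn.
  by rewrite -ltnS -E cl.
by rewrite !ffunE ifF ?scaler0 //; apply/negbTE; rewrite eq_sym.
Qed.

(** As f(w) commutes with multiplication by w, the constants are the only elements to
   be tested. *)
Lemma wmul_f : poly_eval f (wmul : kend_alg polyM) = 0.
Proof.
set p := poly_eval _ _; apply: linear_ext => y.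
have pC (u : polyM) : (p : kend _) (wmul u) = wmul ((p : kend _) u).
  suff h : p * (wmul : kend_alg polyM) = (wmul : kend_alg polyM) * p.
    exact: (congr1 (fun g : kend polyM => g u) h).
  rewrite /p /poly_eval mulr_suml mulr_sumr; apply: eq_bigr => i _.
  by rewrite mulrA -scal_central -!mulrA -exprS -exprSr.
have p0 m : (p : kend _) (mon 0 m) = 0.
  rewrite /p poly_eval_coef kend_addE kend_sumE kend_expE iter_wmul_top.
  rewrite addrC; apply/eqP; rewrite subr_eq0; apply/eqP; apply: eq_bigr => b _.
  by rewrite kend_mulE kend_expE iter_wmul.
rewrite [y]polyM_decomp linear_sum big1 // => a _; rewrite -iter_wmul //.
have pi c u : (p : kend _) (iter c wmul u) = iter c wmul ((p : kend _) u).
  by elim: c => //= c IH; rewrite pC IH.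
rewrite [LHS]pi p0; elim: (nat_of_ord a) => //= c ->; exact: linear0.
Qed.

(** Evaluation of w at an operator x. *)
Variable x : {linear M -> M}.
Definition evalM_fun (y : polyM) : M := \sum_(a < l) iter a x (y a).
Lemma iter_linear a : linear (iter a x).
Proof. by move=> c u v; elim: a => //= a ->; rewrite linearP. Qed.
Lemma evalM_linear : linear evalM_fun.
Proof.
move=> c u v; rewrite /evalM_fun scaler_sumr -big_split /=; apply: eq_bigr => a _.
by rewrite !ffunE iter_linear.
Qed.
HB.instance Definition _ := GRing.isLinear.Build k polyM M *:%R evalM_fun evalM_linear.
Definition evalM : {linear polyM -> M} := evalM_fun.

Lemma iter0 a : iter a x 0 = 0.
Proof. by elim: a => //= a ->; rewrite linear0. Qed.

Lemma evalM_mon a m : (a < l)%N -> evalM (mon a m) = iter a x m.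
Proof.
move=> al; rewrite /evalM /= /evalM_fun (bigD1 (Ordinal al)) //= ffunE eqxx big1 ?addr0 // => b ab.
by rewrite ffunE ifF ?iter0 //; apply/negbTE.
Qed.

Lemma evalM_coefwise (g : {linear M -> M}) y :
  (forall m, x (g m) = g (x m)) -> evalM (coefwise g y) = g (evalM y).
Proof.
move=> xg; rewrite /evalM /= /evalM_fun linear_sum; apply: eq_bigr => a _.
by rewrite ffunE; elim: (nat_of_ord a) => //= c ->.
Qed.

Hypothesis fx : poly_eval f (x : kend_alg M) = 0.

Lemma fx_iter m : iter l x m = - \sum_(b < l) coef b *: iter b x m.
Proof.
have := congr1 (fun g : kend M => g m) fx.
rewrite poly_eval_coef kend_addE kend_sumE kend_expE => /eqP.
rewrite addr_eq0 => /eqP ->; congr (- _); apply: eq_bigr => b _.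
by rewrite kend_mulE kend_expE.
Qed.

Lemma evalM_wmul y : evalM (wmul y) = x (evalM y).
Proof.
apply: (polyM_ext (g := evalM \o wmul) (h := x \o evalM)) => a m al /=.
rewrite evalM_mon //; case: (ltnP a.+1 l) => al'.
  by rewrite wmul_mon // evalM_mon.
have E : l = a.+1 by apply/eqP; rewrite eqn_leq al' al.
rewrite -iter_wmul // -/(iter a.+1 wmul _) -E iter_wmul_top linearN (linear_sum evalM).
rewrite -/(iter a.+1 x m) -E fx_iter; congr (- _); apply: eq_bigr => b _.
by rewrite linearZ evalM_mon.
Qed.

(** For l = 0 both sides vanish, because then f(x) = 0 says that M is zero. *)
Lemma evalM_mon0 m : evalM (mon 0 m) = m.
Proof.
case: (posnP l) => [l0|]; last by move=> h; rewrite evalM_mon.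
have M0 (u : M) : u = 0.
  have := fx_iter u; rewrite l0 /= => ->.
  by rewrite big_ord0 oppr0.
by rewrite [LHS]M0 [RHS]M0.
Qed.

Lemma evalM_iter_wmul a m : evalM (iter a wmul (mon 0 m)) = iter a x m.
Proof. by elim: a => [|a IH] /=; rewrite ?evalM_mon0 // evalM_wmul IH. Qed.

End CompanionModule.

(** * Adding a strand to a module *)

Section TowerModule.
Variables (k : comPzRingType) (z : k) (l : nat) (f : 'I_l.+1 -> k).
Hypothesis f0 : f ord0 = 1.
Variables (M : lmodType k) (n : nat) (x : kend_alg M) (t : nat -> kend_alg M).

Local Notation Y := (polyM l M).
Definition cw (g : kend_alg M) : {linear Y -> Y} := coefwise l (g : kend M).
Local Notation W := (wmul f M).
Local Notation c := (mon l M 0).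
Local Notation ev := (@evalM k l M (x : kend M)).

Lemma cwM g h y : cw (g * h) y = cw g (cw h y).
Proof. by apply/ffunP => a; rewrite !ffunE. Qed.
Lemma cwD g h y : cw (g + h) y = cw g y + cw h y.
Proof. by apply/ffunP => a; rewrite !ffunE. Qed.
Lemma cw1 y : cw 1 y = y.
Proof. by apply/ffunP => a; rewrite !ffunE. Qed.
Lemma cw_scal a y : cw (scal _ a) y = a *: y.
Proof. by apply/ffunP => b; rewrite !ffunE. Qed.
Lemma W_cw g y : W (cw g y) = cw g (W y).
Proof. exact: wmul_coefwise. Qed.
Lemma cw_c g m : cw g (c m) = c ((g : kend M) m).
Proof. exact: coefwise_mon. Qed.

(** This models the module induced from M: the element m w^a of block j stands for

       tau_{j-1}^-1 ... tau_0^-1 x_0^a tau_0 ... tau_{n-1} (x) m,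

   so that the constants of block n are the elements 1 (x) m.  The relations of the
   affine Hecke algebra force the formulas [Tblk] and [Xblk] below for the actions of
   tau_i and x_0. *)
Definition towerM : lmodType k := {ffun 'I_n.+1 -> Y}.
Local Notation V := towerM.

Definition blk_fun (j : nat) (y : Y) : V := [ffun i : 'I_n.+1 => if i == j :> nat then y else 0].
Lemma blk_linear j : linear (blk_fun j).
Proof.
by move=> a u v; apply/ffunP => i; rewrite !ffunE; case: ifP => //; rewrite scaler0 addr0.
Qed.
HB.instance Definition _ j := GRing.isLinear.Build k Y V *:%R (blk_fun j) (blk_linear j).
Definition blk j : {linear Y -> V} := blk_fun j.

Lemma towerM_decomp (v : V) : v = \sum_(j < n.+1) blk j (v j).
Proof.
apply/ffunP => b; rewrite sum_ffunE (bigD1 b) //= ffunE eqxx big1 ?addr0 // => a ab.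
by rewrite ffunE ifF //; apply/negbTE; rewrite eq_sym.
Qed.

Lemma towerM_ext (N : lmodType k) (g h : {linear V -> N}) :
  (forall j y, (j <= n)%N -> g (blk j y) = h (blk j y)) -> forall v, g v = h v.
Proof.
move=> gh v; rewrite [v]towerM_decomp !linear_sum; apply: eq_bigr => a _.
by apply: gh; rewrite -ltnS.
Qed.

Section Extend.
Variables (U : lmodType k) (F : nat -> {linear Y -> U}).
Definition extend_fun (v : V) : U := \sum_(j < n.+1) F j (v j).
Lemma extend_linear : linear extend_fun.
Proof.
move=> a u v; rewrite /extend_fun scaler_sumr -big_split /=; apply: eq_bigr => j _.
by rewrite !ffunE linearP.
Qed.
HB.instance Definition _ := GRing.isLinear.Build k V U *:%R extend_fun extend_linear.
Definition extend : {linear V -> U} := extend_fun.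
Lemma extend_blk j y : (j <= n)%N -> extend (blk j y) = F j y.
Proof.
rewrite -ltnS => jn; rewrite /extend /= /extend_fun (bigD1 (Ordinal jn)) //= ffunE eqxx.
by rewrite big1 ?addr0 // => b ab; rewrite ffunE ifF ?linear0 //; apply/negbTE.
Qed.
End Extend.

(** y(x) - y(w): the obstruction to replacing w by x in y, on which the correction
   terms in the action of [towerX] depend *)
Definition evdiff : {linear Y -> Y} := (c \o ev) \- idfun.
Lemma evdiffE y : evdiff y = c (ev y) - y.
Proof. by []. Qed.

Definition Tblk (i j : nat) : {linear Y -> V} :=
  if (j < i)%N then (blk j \o cw (t i.-1) : {linear Y -> V})
  else if j == i then (blk j.+1 \+ (z \*: blk j) : {linear Y -> V})
  else if j == i.+1 then blk i
  else (blk j \o cw (t i) : {linear Y -> V}).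
Definition Xblk (j : nat) : {linear Y -> V} :=
  if j is p.+1 then
    ((blk j \o cw x) \+ (z \*: (blk 0 \o (W \o (cw (descent z t p) \o evdiff))))
      : {linear Y -> V})
  else (blk 0 \o W : {linear Y -> V}).

Definition towerT (i : nat) : {linear V -> V} := extend (Tblk i).
Definition towerX : {linear V -> V} := extend Xblk.
Local Notation T := towerT.
Local Notation X := towerX.

Lemma T_lt i j y : (j <= i)%N -> (i < n)%N -> T i.+1 (blk j y) = blk j (cw (t i) y).
Proof. by move=> ji iN; rewrite [LHS]extend_blk ?(leq_trans ji (ltnW iN)) // /Tblk ltnS ji. Qed.
Lemma T_eq i y : (i < n)%N -> T i (blk i y) = blk i.+1 y + z *: blk i y.
Proof. by move=> iN; rewrite [LHS]extend_blk ?(ltnW iN) // /Tblk ltnn eqxx. Qed.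
Lemma T_S i y : (i < n)%N -> T i (blk i.+1 y) = blk i y.
Proof. by move=> iN; rewrite [LHS]extend_blk // /Tblk ltnNge leqnSn /= eqxx eqn_leq ltnn. Qed.
Lemma T_gt i j y : (i.+1 < j)%N -> (j <= n)%N -> T i (blk j y) = blk j (cw (t i) y).
Proof.
move=> ij jn; rewrite [LHS]extend_blk // /Tblk ltnNge (ltnW (ltnW ij)) /=.
by rewrite !gtn_eqF // ltnW.
Qed.
Lemma X_0 y : X (blk 0 y) = blk 0 (W y).
Proof. by rewrite [LHS]extend_blk. Qed.
Lemma X_S p y : (p < n)%N ->
  X (blk p.+1 y) = blk p.+1 (cw x y) + z *: blk 0 (W (cw (descent z t p) (evdiff y))).
Proof. by move=> pn; rewrite [LHS]extend_blk. Qed.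

#[local] Opaque blk cw towerT towerX evdiff mon wmul evalM.

Hypothesis D : hecke_datum z f n x t.

Lemma cw_quad i y : (i.+1 < n)%N -> cw (t i) (cw (t i) y) = z *: cw (t i) y + y.
Proof. by move=> iN; rewrite -cwM (hd_quad D) // cwD cwM cw1 cw_scal. Qed.

Lemma tower_quad i v : (i < n)%N -> T i (T i v) = z *: T i v + v.
Proof.
move=> iN; apply: (towerM_ext (g := T i \o T i) (h := (z \*: T i) \+ idfun)) => j y jn /=.
case: (ltngtP j i) => [ji|ij|->].
- case: i ji iN => // i ji iN; have i1 := ltnW iN.
  by rewrite !T_lt // cw_quad // linearD linearZ.
- move: ij; rewrite leq_eqVlt => /orP[/eqP <-|ij]; first by rewrite T_S // T_eq // addrC.
  by rewrite !T_gt // cw_quad ?(leq_trans ij) // linearD linearZ.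
- by rewrite T_eq // linearD linearZ /= T_S // T_eq // scalerDr addrC.
Qed.

Lemma tower_comm i i' v : (i.+1 < i')%N -> (i' < n)%N -> T i (T i' v) = T i' (T i v).
Proof.
move=> ii' i'n; apply: (towerM_ext (g := T i \o T i') (h := T i' \o T i)) => j y jn /=.
case: i' ii' i'n => // i'; rewrite ltnS => ii' i'n.
have iN : (i < n)%N by lia.
have i'n1 : (i' < n)%N by lia.
have tc a b : (a.+1 < b)%N -> (b.+1 < n)%N -> cw (t a) (cw (t b) y) = cw (t b) (cw (t a) y).
  by move=> ab bn; rewrite -!cwM (hd_comm D).
case: (ltngtP j i) => [ji|ij|->].
- case: i ii' iN ji => // i ii' iN ji.
  have h1 : (j <= i')%N by lia.
  have h2 : (i < n)%N by lia.
  by rewrite !T_lt // tc.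
- have ij1 : (i < n)%N by lia.
  move: ij; rewrite leq_eqVlt => /orP[/eqP <-|ij].
    have h1 : (i <= i')%N by lia.
    have h2 : (i < i')%N by lia.
    by rewrite T_S // !T_lt // T_S.
  rewrite (T_gt _ ij) //; case: (ltngtP j i'.+1) => [ji'|ij'|E].
  + by rewrite !T_lt // ?T_gt // tc //; lia.
  + move: ij'; rewrite leq_eqVlt => /orP[/eqP E|ij'].
      by rewrite -E !T_S // T_gt //; lia.
    by rewrite !(T_gt _ ij') // T_gt // tc //; lia.
  + have h1 : (i.+1 < i'.+1)%N by lia.
    have h2 : (i.+1 < i'.+2)%N by lia.
    by rewrite E !T_eq // linearD linearZ /= !T_gt // ltnW.
- have h1 : (i <= i')%N by lia.
  have h2 : (i < i')%N by lia.
  by rewrite !T_lt // !T_eq // linearD linearZ /= !T_lt.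
Qed.

Lemma tower_braid i v : (i.+1 < n)%N -> T i (T i.+1 (T i v)) = T i.+1 (T i (T i.+1 v)).
Proof.
move=> iN; have i1 := ltnW iN.
apply: (towerM_ext (g := T i \o (T i.+1 \o T i)) (h := T i.+1 \o (T i \o T i.+1))) => j y jn /=.
case: (ltngtP j i) => [ji|ij|->].
- case: i ji iN i1 => // i ji iN i1; have i2 := ltnW i1; have ji1 := leqW ji.
  by rewrite !T_lt // -!cwM (hd_braid D).
- move: ij; rewrite leq_eqVlt => /orP[/eqP <-|ij].
    rewrite T_S // T_lt // [in RHS]T_eq // !linearD !linearZ /= T_eq //.
    rewrite [T i (blk i.+2 y)]T_gt // T_S // T_S // T_lt // addrC; congr (_ + _).
  move: ij; rewrite leq_eqVlt => /orP[/eqP E|ij].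
    by rewrite -E in jn *; rewrite T_gt // !T_S // T_lt.
  have ij1 : (i.+1 < j)%N by apply: ltnW.
  have h : (i.+2 < n)%N by lia.
  do 3! rewrite ?(T_gt _ ij jn) ?(T_gt _ ij1 jn).
  by rewrite -!cwM (hd_braid D).
- have E1 u : T i (blk i u) = blk i.+1 u + z *: blk i u by apply: T_eq.
  have E2 u : T i.+1 (blk i.+1 u) = blk i.+2 u + z *: blk i.+1 u by apply: T_eq.
  have E3 u : T i.+1 (blk i u) = blk i (cw (t i) u) by apply: T_lt.
  have E4 u : T i (blk i.+1 u) = blk i u by apply: T_S.
  have E5 u : T i (blk i.+2 u) = blk i.+2 (cw (t i) u) by apply: T_gt.
  rewrite [T i.+1 (blk i y)]E3 !E1 !linearD !linearZZ !E2 !E3.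
  rewrite !linearD !linearZZ E1 E4 E5 cw_quad // !linearD !linearZZ.
  by rewrite -!addrA; congr (_ + _); rewrite addrC -addrA.
Qed.

Lemma evdiff_cw g y : x * g = g * x -> evdiff (cw g y) = cw g (evdiff y).
Proof.
move=> xg; rewrite !evdiffE linearB cw_c; congr (c _ - _).
by apply: evalM_coefwise => m; apply: (congr1 (fun h : kend M => h m) xg).
Qed.

Lemma tower_XT i v : (i.+1 < n)%N -> X (T i.+1 v) = T i.+1 (X v).
Proof.
move=> iN; have i1 := ltnW iN.
apply: (towerM_ext (g := X \o T i.+1) (h := T i.+1 \o X)) => -[|p] y jn /=.
  by rewrite T_lt // 1?ltnW // !X_0 T_lt // 1?ltnW // W_cw.
rewrite (X_S _ jn) linearD linearZZ [T i.+1 (blk 0 _)]T_lt // 1?ltnW //.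
have xt q : (0 < q)%N -> (q.+1 < n)%N -> x * t q = t q * x by apply: (hd_xT D).
case: (ltngtP p i) => [pi|ip|E].
- rewrite !T_lt // 1?ltnW // X_S // evdiff_cw; last by rewrite xt //; lia.
  rewrite -!cwM xt ?(leq_ltn_trans _ pi) // -(W_cw (t i) (cw _ _)) -!cwM.
  by rewrite (descent_comm_above D).
- move: ip; rewrite leq_eqVlt => /orP[/eqP E|ip].
    by rewrite -E in jn *; rewrite !T_S // X_S // -(W_cw (t i) (cw _ _)) -cwM (descentTl D).
  rewrite !T_gt // X_S // evdiff_cw; last by rewrite xt //; lia.
  rewrite -!cwM xt //; last by lia.
  by rewrite -(W_cw (t i) (cw _ _)) -!cwM (descent_shift D).
- rewrite -{}E in iN i1 *.
  rewrite !T_eq // linearD linearZZ !X_S // -(W_cw (t p) (cw _ _)) -cwM.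
  have -> : t p * descent z t p = descent z t p.+1 + scal _ z * descent z t p.
    by rewrite -mulrDl subrK.
  rewrite cwD cwM cw_scal (linearD W) (linearD (blk 0)) (linearZZ W) (linearZZ (blk 0)).
  rewrite scalerDr -!addrA; congr (_ + _).
  by rewrite [z *: (_ + _)]scalerDr addrCA.
Qed.

(** The identity [hd_key], applied to the monomials of y. *)
Lemma tower_key y : (1 < n)%N ->
  cw x (cw (t 0 - scal _ z) (evdiff (cw (t 0) y))) =
  cw (t 0 - scal _ z) (evdiff (cw (t 0) (cw x y)))
  + z *: c ((x : kend M) (ev (cw (t 0 - scal _ z) (evdiff y)))).
Proof.
move=> n1; set s := t 0 - scal _ z.
have key := hd_key D _ n1; rewrite -/s in key.
have sT : s * t 0 = 1 by apply: (hd_TV D).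
clearbody s.
have L u : cw s (evdiff (cw (t 0) u)) = c ((s : kend M) (ev (cw (t 0) u))) - u.
  by rewrite evdiffE (linearB (cw s)) cw_c -(cwM s) sT cw1.
rewrite !L linearB cw_c addrAC; congr (_ - _).
rewrite -linearZ -linearD /=; congr (c _).
apply: (polyM_ext
  (g := (x : kend M) \o ((s : kend M) \o (ev \o cw (t 0))))
  (h := ((s : kend M) \o (ev \o (cw (t 0) \o cw x)))
    \+ (z \*: ((x : kend M) \o (ev \o (cw s \o evdiff)))))) => a m al /=.
have l0 := leq_ltn_trans (leq0n a) al.
rewrite !linearB !cw_c !coefwise_mon !evalM_mon //.
have := congr1 (fun h : kend M => h m) (key a).
rewrite !(kend_mulE, kend_addE).
by move=> K; rewrite -!kend_expE K expr0 exprS -addrA.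
Qed.

(** All factors of the descent but the last commute with x, which reduces this to
   [tower_key]. *)
Lemma tower_key_descent p y : (p.+1 < n)%N ->
  cw x (cw (descent z t p.+1) (evdiff (cw (t 0) y))) =
  cw (descent z t p.+1) (evdiff (cw (t 0) (cw x y)))
  + z *: c ((x : kend M) (ev (cw (descent z t p.+1) (evdiff y)))).
Proof.
move=> pn; have n1 : (1 < n)%N by apply: leq_trans pn.
have [u -> xu] := descent_split D pn.
have ux m : (x : kend M) ((u : kend M) m) = (u : kend M) ((x : kend M) m).
  exact: (congr1 (fun h : kend M => h m) xu).
rewrite !cwM -[LHS]cwM xu cwM tower_key // linearD linearZZ cw_c.
by rewrite -ux -(evalM_coefwise _ ux).
Qed.

Lemma XT_0 u : (0 < n)%N ->
  X (T 0 (blk 0 u)) = blk 1 (cw x u) + z *: blk 0 (W (c (ev u))).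
Proof.
move=> n0; rewrite T_eq // (linearD X) (linearZZ X) X_0 X_S // cw1 -addrA.
rewrite -(scalerDr z) -(linearD (blk 0)) -(linearD W) evdiffE subrK.
by [].
Qed.

(** This relation is the source of the correction terms in [Xblk].  On block 0 it is a
   direct computation, on block 1 it uses that evaluating the constant y(x) gives y(x)
   back, and on the other blocks it reduces to [tower_key_descent]. *)
Lemma tower_XTXT v : (0 < n)%N -> X (T 0 (X (T 0 v))) = T 0 (X (T 0 (X v))).
Proof.
move=> n0; have fx := hd_f D n0.
have evW u : ev (W u) = (x : kend M) (ev u) by apply: evalM_wmul.
have evc m : ev (c m) = m by apply: (evalM_mon0 f0 fx).
have T0 u : T 0 (blk 0 u) = blk 1 u + z *: blk 0 u by apply: T_eq.
have T1 u : T 0 (blk 1 u) = blk 0 u by apply: T_S.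
have XT0 u := XT_0 u n0.
apply: (towerM_ext (g := X \o (T 0 \o (X \o T 0)))
  (h := T 0 \o (X \o (T 0 \o X)))) => -[|[|p]] y jn /=.
- rewrite [X (blk 0 y)]X_0.
  rewrite XT0 (linearD (T 0)) (linearD X) T1 X_0 (linearZZ (T 0)) (linearZZ X) XT0.
  rewrite [in RHS]XT0 (linearD (T 0)) T1 (linearZZ (T 0)) T0 !evW evc W_cw.
  by rewrite -(W_cw x (c _)) cw_c.
- rewrite T1 !X_0 XT0 evW X_S // (linearD (T 0)) (linearD X) (linearD (T 0)) cw1.
  rewrite T1 X_0 T0 (linearZZ (T 0)) (linearZZ X) (linearZZ (T 0)) XT0.
  rewrite (linearD (T 0)) T1 (linearZZ (T 0)) evW evdiffE (linearB ev) evc subrr.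
  rewrite (linear0 (x : kend M)) (linear0 c) (linear0 W) (linear0 (blk 0)) (linear0 (T 0)).
  rewrite scaler0 addr0 W_cw -addrA -(scalerDr z) -(linearD (blk 0)); congr (_ + _ *: _).
  by rewrite -(linearD (cw x)) -(linearD W) [y + _]addrC subrK -(W_cw x) cw_c.
- set d := descent z t p.+1; have d1 : (p.+1 < n)%N by [].
  have K u : cw x (cw d (evdiff (cw (t 0) u))) =
      cw d (evdiff (cw (t 0) (cw x u))) + z *: c ((x : kend M) (ev (cw d (evdiff u)))).
    exact: tower_key_descent.
  have Xp u : X (blk p.+2 u) = blk p.+2 (cw x u) + z *: blk 0 (W (cw d (evdiff u))).
    exact: X_S.
  have Tp u : T 0 (blk p.+2 u) = blk p.+2 (cw (t 0) u) by apply: T_gt.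
  have n1 : (1 < n)%N by apply: leq_trans d1.
  have br : cw (t 0) (cw x (cw (t 0) (cw x y))) = cw x (cw (t 0) (cw x (cw (t 0) y))).
    by rewrite -!cwM (hd_xTxT D).
  move: (cw d) K Xp => w K Xp.
  have -> : X (T 0 (X (T 0 (blk p.+2 y)))) =
      blk p.+2 (cw x (cw (t 0) (cw x (cw (t 0) y))))
      + z *: blk 0 (W (w (evdiff (cw (t 0) (cw x (cw (t 0) y))))))
      + z *: (blk 1 (W (cw x (w (evdiff (cw (t 0) y)))))
              + z *: blk 0 (W (c ((x : kend M) (ev (w (evdiff (cw (t 0) y)))))))).
    rewrite Tp Xp (linearD (T 0)) Tp (linearD X) Xp (linearZZ (T 0)) (linearZZ X) XT0.
    by rewrite evW W_cw.
  rewrite Xp (linearD (T 0)) Tp (linearD X) Xp (linearZZ (T 0)) (linearZZ X) XT0.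
  rewrite evW (linearD (T 0)) (linearZZ (T 0)) !(linearD (T 0)) Tp !(linearZZ (T 0)) T1 !T0 br.
  rewrite -!addrA; congr (_ + _); rewrite -(W_cw x) (K y).
  have -> : W (w (evdiff (cw (t 0) (cw x (cw (t 0) y))))) =
      z *: W (w (evdiff (cw (t 0) (cw x y)))) + z *: (z *: W (c ((x : kend M) (ev (w (evdiff y))))))
      + W (cw x (w (evdiff y))) - z *: W (c ((x : kend M) (ev (w (evdiff (cw (t 0) y)))))).
    rewrite -!(linearZZ W) -!(linearD W) -(linearB W); congr (W _).
    apply/eqP; rewrite eq_sym subr_eq -K eq_sym cw_quad // (linearD evdiff) (linearZZ evdiff).
    by rewrite (linearD w) (linearZZ w) (linearD (cw x)) (linearZZ (cw x)) K scalerDr.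
  rewrite (linearD W) (linearZZ W).
  move: (W (w _)) (W (c _)) (W (cw x _)) => a b e.
  move: (W (c _)) => b'.
  rewrite (linearB (blk 0)) !(linearD (blk 0)) (linearD (blk 1)) !(linearZZ (blk 0)).
  rewrite (linearZZ (blk 1)) -!(scalerDr z); congr (_ *: _).
  rewrite [blk 1 a + _ + _]addrC addrA subrK scalerDr -(addrA (z *: _)) addrACA.
  congr (_ + _); first exact: addrC.
  rewrite [z *: (_ + _)]scalerDr [z *: (z *: _) + _]addrC -addrA.
  by congr (_ + _); apply: addrC.
Qed.

Definition towerT_alg (i : nat) : kend_alg V := T i.
Definition towerX_alg : kend_alg V := X.

Lemma poly_eval_app (N : lmodType k) (g : {linear N -> N}) v :
  (poly_eval f (g : kend_alg N) : kend N) v = \sum_(i < l.+1) f i *: iter (l - i) g v.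
Proof.
by rewrite /poly_eval kend_sumE; apply: eq_bigr => i _; rewrite kend_mulE kend_expE.
Qed.

(** By the remainder theorem, x - w divides y(x) - y(w). *)
Lemma evdiff_factor y : (0 < n)%N -> exists G, evdiff y = cw x G - W G.
Proof.
move=> n0; have fx := hd_f D n0; rewrite [y]polyM_decomp linear_sum.
elim/big_ind: _ => [|_ _ [G1 ->] [G2 ->]|a _].
- by exists 0; rewrite (linear0 (cw x)) (linear0 W) subr0.
- by exists (G1 + G2); rewrite (linearD (cw x)) (linearD W) addrACA opprD.
rewrite -(iter_wmul f) //; elim: (nat_of_ord a) => [|b [G IH]] /=.
  by exists 0; rewrite evdiffE (evalM_mon0 f0 fx) subrr (linear0 (cw x)) (linear0 W) subr0.
exists (W G + c (iter b (x : kend M) (y a))).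
move: IH; rewrite !evdiffE (evalM_wmul f0 fx) (evalM_iter_wmul f0 fx).
move=> /eqP; rewrite subr_eq => /eqP E; rewrite (linearD (cw x)) (linearD W) cw_c E.
rewrite (linearD W) (linearB W) W_cw [RHS]addrC.
by rewrite [W (W G) + (_ + _)]addrA [W (W G) + _]addrC subrK opprD addrACA addNr add0r addrC.
Qed.

(** The correction terms telescope, by the factorization of y(x) - y(w). *)
Lemma tower_X_iter m y G : evdiff y = cw x G - W G -> (0 < n)%N ->
  iter m X (blk 1 y) = blk 1 (iter m (cw x) y)
    + z *: blk 0 (W (iter m (cw x) G - iter m W G)).
Proof.
move=> EG n0; elim: m => [|m IH] /=.
  by rewrite subrr (linear0 W) (linear0 (blk 0)) scaler0 addr0.
have xiter u : cw x (iter m (cw x) u) = iter m (cw x) (cw x u) by rewrite -iterSr.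
have Wx u : W (iter m (cw x) u) = iter m (cw x) (W u).
  by elim: m {IH xiter} => //= q IHq; rewrite W_cw IHq.
rewrite IH (linearD X) (linearZZ X) X_S // X_0 cw1 -addrA -(scalerDr z).
congr (_ + _ *: _); rewrite -(linearD (blk 0)) -(linearD W); congr (blk 0 (W _)).
have -> : evdiff (iter m (cw x) y) = iter m (cw x) (evdiff y).
  by elim: m {IH xiter Wx} => //= m <-; rewrite evdiff_cw.
have iB u v : iter m (cw x) (u - v) = iter m (cw x) u - iter m (cw x) v.
  by elim: m {IH xiter Wx} => //= q ->; rewrite linearB.
by rewrite EG (linearB W) iB Wx addrA subrK xiter.
Qed.

(** On block 0 the operator X is multiplication by w, which is killed by f.  On block 1
   the formula of [tower_X_iter] is linear in the powers of x and w, hence its values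
   for the monomials of f add up to 0.  The other blocks are reached from block 1 by
   tau_1, tau_2, ..., which commute with X. *)
Lemma tower_f : poly_eval f towerX_alg = 0.
Proof.
set p := poly_eval _ _; apply: linear_ext => v.
apply: (towerM_ext (g := (p : kend V)) (h := \0)) => j y jn /=.
case: j jn => [|j] jn.
  rewrite poly_eval_app.
  have E m : iter m X (blk 0 y) = blk 0 (iter m W y) by elim: m => //= m ->; rewrite X_0.
  rewrite (eq_bigr (fun i : 'I_l.+1 => blk 0 (f i *: iter (l - i) W y))) => [|i _].
    by rewrite -linear_sum -poly_eval_app wmul_f // (linear0 (blk 0)).
  by rewrite E (linearZZ (blk 0)).
have n0 : (0 < n)%N by apply: leq_trans jn.
elim: j jn y => [|j IH] jn y.
  have [G EG] := evdiff_factor y n0.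
  rewrite poly_eval_app.
  rewrite (eq_bigr (fun i : 'I_l.+1 => blk 1 (f i *: iter (l - i) (cw x) y)
      + z *: blk 0 (W (f i *: iter (l - i) (cw x) G - f i *: iter (l - i) W G)))) => [|i _].
    rewrite big_split /= -linear_sum -scaler_sumr -linear_sum -linear_sum.
    rewrite sumrB -!poly_eval_app wmul_f //.
    have cwp u : (poly_eval f (cw x : kend_alg Y) : kend Y) u = 0.
      rewrite poly_eval_app; apply/ffunP => a; rewrite sum_ffunE ffunE.
      rewrite -[RHS](congr1 (fun g : kend M => g (u a)) (hd_f D n0)) poly_eval_app.
      apply: eq_bigr => i _; rewrite ffunE; congr (_ *: _).
      by elim: (l - i)%N => //= q IH; rewrite ffunE IH.
    by rewrite !cwp subrr (linear0 W) !(linear0 (blk _)) scaler0 addr0.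
  rewrite (tower_X_iter _ EG) // scalerDr (linearZZ (blk 1)); congr (_ + _).
  by rewrite -!scalerBr (linearZZ W) (linearZZ (blk 0)) !scalerA mulrC.
have pT u : (p : kend V) (T j.+1 u) = T j.+1 ((p : kend V) u).
  rewrite !poly_eval_app linear_sum; apply: eq_bigr => i _; rewrite (linearZZ (T _)).
  by congr (_ *: _); elim: (l - i)%N => //= q ->; rewrite tower_XT.
have jn1 := ltnW jn.
have := pT (blk j.+1 y); rewrite T_eq // (linearD (p : kend V)) (linearZZ (p : kend V)).
by rewrite !IH // scaler0 addr0 (linear0 (T _)).
Qed.

Lemma tower_datum : hecke_datum z f n.+1 towerX_alg towerT_alg.
Proof.
split.
- by move=> i iN; apply: linear_ext => v; apply: tower_quad.
- by move=> i j ij jn; apply: linear_ext => v; apply: tower_comm.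
- by move=> i iN; apply: linear_ext => v; apply: tower_braid.
- by case=> // i _ iN; apply: linear_ext => v; apply: tower_XT.
- by move=> n0; apply: linear_ext => v; apply: tower_XTXT.
- by move=> _; apply: tower_f.
Qed.
End TowerModule.

(** * Spanning sets of A_{n+1} over A_n *)

(** The spanning half of the Mackey decomposition uses nothing of the cyclotomic
   Hecke algebras beyond the relations between consecutive levels.  Here X_ n and T_ n
   stand for x_{n+1} and tau_n in A_{n+1}, and T_ 0 = 0. *)
Section Tower.
Variables (k : comPzRingType) (z : k) (l : nat) (cf : nat -> k).
Variables (A : nat -> pzalg k) (iota : forall n, {rmorphism A n -> A n.+1}).
Variables (X_ T_ : forall n, A n.+1).

Record hecke_tower : Prop := HeckeTower {
  tw_scal n a : iota n (scal (A n) a) = scal (A n.+1) a;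
  tw_X n u : GRing.comm (X_ n) (iota n u);
  tw_T n u : GRing.comm (T_ n.+1) (iota n.+1 (iota n u));
  tw_XE n : X_ n.+1 = T_ n.+1 * iota n.+1 (X_ n) * T_ n.+1;
  tw_quad n : T_ n.+1 * T_ n.+1 = scal (A n.+2) z * T_ n.+1 + 1;
  tw_braid n : T_ n.+2 * iota n.+2 (T_ n.+1) * T_ n.+2
    = iota n.+2 (T_ n.+1) * T_ n.+2 * iota n.+2 (T_ n.+1);
  tw_T0 : T_ 0 = 0;
  tw_f : X_ 0 ^+ l = - \sum_(b < l) scal (A 1) (cf b) * X_ 0 ^+ b;
  tw_ind n (P : A n.+1 -> Prop) :
    (forall u v, P u -> P v -> P (u + v)) -> (forall u v, P u -> P v -> P (u * v)) ->
    (forall u, P (iota n u)) -> P (T_ n) -> (n = 0%N -> P (X_ n)) -> forall u, P u }.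

Hypothesis HT : hecke_tower.
Local Notation iota_scal := (tw_scal HT).
Local Notation X_comm := (tw_X HT).
Local Notation T_comm := (tw_T HT).
Local Notation XnE := (tw_XE HT).
Local Notation T_quad := (tw_quad HT).
Local Notation T_braid := (tw_braid HT).
Local Notation T_0 := (tw_T0 HT).

(** The sum of A_n tau A_n and of the A_n X^i for lo <= i < hi. *)
Inductive mspan n (lo hi : nat) : A n.+1 -> Prop :=
| mspan0 : mspan lo hi 0
| mspanD u v : mspan lo hi u -> mspan lo hi v -> mspan lo hi (u + v)
| mspan_T g h : mspan lo hi (iota n g * T_ n * iota n h)
| mspan_X h i : (lo <= i < hi)%N -> mspan lo hi (iota n h * X_ n ^+ i).

Section MspanTheory.
Variables (n : nat) (lo hi : nat).

Lemma mspanS lo' hi' (u : A n.+1) : mspan lo hi u -> (lo' <= lo)%N -> (hi <= hi')%N ->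
  mspan lo' hi' u.
Proof.
move=> hu l1 l2; elim: hu => [|v w _ hv _ hw|g h|h i /andP[h1 h2]].
- exact: mspan0.
- exact: mspanD.
- exact: mspan_T.
- by apply: mspan_X; rewrite (leq_trans l1 h1) (leq_trans h2 l2).
Qed.

Lemma mspanMl g (u : A n.+1) : mspan lo hi u -> mspan lo hi (iota n g * u).
Proof.
elim=> [|v w _ hv _ hw|g' h|h i hi'].
- by rewrite mulr0; apply: mspan0.
- by rewrite mulrDr; apply: mspanD.
- by rewrite !mulrA -rmorphM; apply: mspan_T.
- by rewrite mulrA -rmorphM; apply: mspan_X.
Qed.

Lemma Xn_comm i (u : A n) : X_ n ^+ i * iota n u = iota n u * X_ n ^+ i.
Proof. by apply/commr_sym/commrX/commr_sym/X_comm. Qed.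

Lemma mspanMr g (u : A n.+1) : mspan lo hi u -> mspan lo hi (u * iota n g).
Proof.
elim=> [|v w _ hv _ hw|g' h|h i hi'].
- by rewrite mul0r; apply: mspan0.
- by rewrite mulrDl; apply: mspanD.
- by rewrite -!mulrA -rmorphM mulrA; apply: mspan_T.
- by rewrite -mulrA Xn_comm mulrA -rmorphM; apply: mspan_X.
Qed.

Lemma mspanZ a (u : A n.+1) : mspan lo hi u -> mspan lo hi (scal (A n.+1) a * u).
Proof. by rewrite -iota_scal; apply: mspanMl. Qed.

Lemma mspanN (u : A n.+1) : mspan lo hi u -> mspan lo hi (- u).
Proof. by move=> h; rewrite -mulN1r -(rmorph1 (scal _)) -rmorphN; apply: mspanZ. Qed.

Lemma mspanB (u v : A n.+1) : mspan lo hi u -> mspan lo hi v -> mspan lo hi (u - v).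
Proof. by move=> hu hv; apply: mspanD => //; apply: mspanN. Qed.

Lemma mspan_Xi i : (lo <= i < hi)%N -> @mspan n lo hi (X_ n ^+ i).
Proof. by move=> h; have := @mspan_X n lo hi 1 i h; rewrite rmorph1 mul1r. Qed.

Lemma mspan_Tn : @mspan n lo hi (T_ n).
Proof. by have := @mspan_T n lo hi 1 1; rewrite rmorph1 mul1r mulr1. Qed.
End MspanTheory.

Section Step.
Variable n : nat.
Local Notation tau := (T_ n.+1).
Local Notation x := (iota n.+1 (X_ n)).
Local Notation X := (X_ n.+1).
Local Notation i2 u := (iota n.+1 (iota n u)).

Lemma TX : tau * X = x * tau + scal _ z * X.
Proof. by rewrite XnE !mulrA T_quad !mulrDl mul1r addrC. Qed.

Lemma mspan_TX i : mspan 1 i.+1 (tau * X ^+ i).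
Proof.
elim: i => [|i IH]; first by rewrite expr0 mulr1; apply: mspan_Tn.
rewrite exprS mulrA TX mulrDl -!mulrA -exprS; apply: mspanD.
  by apply: mspanMl; apply: mspanS IH _ _.
by apply: mspanZ; apply: mspan_Xi; rewrite /= ltnSn.
Qed.

(** In the induction on a, moving tau past X by [TX] only produces lower
   powers of X. *)
Lemma mspan_TxT a : mspan 1 a (X ^+ a - tau * x ^+ a * tau).
Proof.
case: a => [|a].
  rewrite !expr0 mulr1 T_quad opprD addrCA subrr addr0; apply: mspanN.
  by apply: mspanZ; apply: mspan_Tn.
elim: a => [|a IH]; first by rewrite !expr1 XnE subrr; apply: mspan0.
have -> : X ^+ a.+2 - tau * x ^+ a.+2 * tau =
    (X ^+ a.+1 - tau * x ^+ a.+1 * tau) * X + scal _ z * (tau * X * x ^+ a.+1).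
  rewrite mulrBl -exprSr -addrA; congr (_ + _).
  have -> : tau * x ^+ a.+1 * tau * X =
      tau * x ^+ a.+1 * (x * tau) + tau * x ^+ a.+1 * (scal _ z * X).
    by rewrite -(mulrA (tau * _) tau X) TX mulrDr.
  rewrite opprD -addrA.
  have -> : tau * x ^+ a.+1 * (scal (A n.+2) z * X) = scal (A n.+2) z * (tau * X * x ^+ a.+1).
    rewrite mulrA -scal_central -!mulrA; congr (_ * (_ * _)).
    by rewrite -rmorphXn X_comm.
  by rewrite addNr addr0 [x ^+ _.+2]exprSr !mulrA.
apply: mspanD; last first.
  apply: mspanZ; rewrite -rmorphXn; apply: mspanMr.
  by have := mspan_TX 1; rewrite expr1 => h; apply: mspanS h _ _.
elim: IH => [|v w _ hv _ hw|g h|h i /andP[i1 ia]].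
- by rewrite mul0r; apply: mspan0.
- by rewrite mulrDl; apply: mspanD.
- rewrite -mulrA -X_comm -mulrA [tau * _]mulrA; apply: mspanMl; apply: mspanMr.
  by have := mspan_TX 1; rewrite expr1 => H; apply: mspanS H _ _.
- by rewrite -mulrA -exprSr; apply: mspan_X; rewrite /= ltnS.
Qed.

(** On A_n tau A_n this is the braid relation, and on the powers of x it is
   [mspan_TxT]. *)
Lemma mspan_TuT lo hi (u : A n.+1) : (lo <= 1)%N -> mspan lo hi u ->
  mspan lo hi (tau * iota n.+1 u * tau).
Proof.
move=> lo1; elim=> [|v w _ hv _ hw|g h|h i hi'].
- by rewrite rmorph0 mulr0 mul0r; apply: mspan0.
- by rewrite rmorphD mulrDr mulrDl; apply: mspanD.
- rewrite !rmorphM; case: (n) g h => [|n'] g h.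
    by rewrite T_0 rmorph0 mulr0 mul0r mulr0 mul0r; apply: mspan0.
  have -> (t' : A n'.+3) :
      T_ n'.+2 * (iota n'.+2 (iota n'.+1 g) * t' * iota n'.+2 (iota n'.+1 h)) * T_ n'.+2
      = iota n'.+2 (iota n'.+1 g) * (T_ n'.+2 * t' * T_ n'.+2) * iota n'.+2 (iota n'.+1 h).
    by rewrite !mulrA (T_comm g) -(mulrA _ _ (T_ n'.+2)) -(T_comm h) !mulrA.
  apply/mspanMr/mspanMl; rewrite T_braid; exact: mspan_T.
- rewrite rmorphM mulrA T_comm -!mulrA; apply: mspanMl; rewrite mulrA.
  have /andP[i1 i2] := hi'; rewrite rmorphXn.
  rewrite -[tau * _ * _](subKr (X ^+ i)); apply: mspanB; first exact: mspan_Xi.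
  by apply: mspanS (mspan_TxT i) _ (ltnW i2).
Qed.

End Step.

Lemma mspan_pow0 i : (0 < l)%N -> @mspan 0 0 l (X_ 0 ^+ i).
Proof.
move=> l0; elim: i => [|i IH]; first by apply: mspan_Xi.
rewrite exprSr; elim: IH => [|v w _ hv _ hw|p h|h j /andP[_ jl]].
- by rewrite mul0r; apply: mspan0.
- by rewrite mulrDl; apply: mspanD.
- by rewrite T_0 mulr0 !mul0r; apply: mspan0.
rewrite -mulrA -exprSr; apply: mspanMl.
move: jl; rewrite leq_eqVlt => /orP[/eqP ->|jl]; last exact: mspan_Xi.
rewrite (tw_f HT); apply: mspanN.
elim/big_ind: _ => [|u v hu hv|b _]; [exact: mspan0|exact: mspanD|].
by apply: mspanZ; apply: mspan_Xi; rewrite ltn_ord.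
Qed.

(** By induction on n the span is a left ideal containing 1: it is stable under
   A_{n+1}, and under tau by [mspan_TuT] and [mspan_TX].  For l = 0 the relation
   f(x_1) = 0 reads 1 = 0. *)
Lemma mspan_full n (u : A n.+1) : mspan 0 l u.
Proof.
case: (posnP l) => [l0|l0].
  suff -> : u = 0 by apply: mspan0.
  have E : (1 : A 1) = 0.
    by have := tw_f HT; rewrite l0 expr0 big_ord0 oppr0.
  have {}E m : (1 : A m.+1) = 0.
    by elim: m => // m IH; rewrite -(rmorph1 (iota m.+1)) IH rmorph0.
  by rewrite -[u]mulr1 E mulr0.
elim: n u => [|n IH].
  apply: (tw_ind HT) => [u v hu hv|u v hu hv|u||_].
  - exact: mspanD.
  - elim: hu => [|v1 w _ h1 _ h2|p h|h j _].
    + by rewrite mul0r; apply: mspan0.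
    + by rewrite mulrDl; apply: mspanD.
    + by rewrite T_0 mulr0 !mul0r; apply: mspan0.
    rewrite -mulrA; apply: mspanMl; elim: hv => [|v1 w _ h1 _ h2|p h'|h' i _].
    + by rewrite mulr0; apply: mspan0.
    + by rewrite mulrDr; apply: mspanD.
    + by rewrite T_0 mulr0 mul0r mulr0; apply: mspan0.
    by rewrite mulrA Xn_comm -mulrA -exprD; apply: mspanMl; apply: mspan_pow0.
  - by rewrite -[iota 0 u]mulr1; apply: mspanMl; have := @mspan_pow0 0 l0; rewrite expr0.
  - by rewrite T_0; apply: mspan0.
  - by have := @mspan_pow0 1 l0; rewrite expr1.
have TuT u : mspan 0 l (T_ n.+1 * iota n.+1 u * T_ n.+1) by apply: mspan_TuT (IH u).
have one : mspan 0 l (1 : A n.+2) by rewrite -(expr0 (X_ n.+1)); apply: mspan_Xi.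
suff Q : forall u v : A n.+2, mspan 0 l v -> mspan 0 l (u * v) by move=> u; rewrite -[u]mulr1; apply: Q.
apply: (@tw_ind HT n.+1 (fun u => forall v, mspan 0 l v -> mspan 0 l (u * v)))
  => [a b ha hb v hv|a b ha hb v hv|a v|v hv|//].
- by rewrite mulrDl; apply: mspanD; [apply: ha|apply: hb].
- by rewrite -mulrA; apply: ha; apply: hb.
- exact: mspanMl.
elim: hv => [|v1 w _ h1 _ h2|p h|h i /andP[_ il]].
- by rewrite mulr0; apply: mspan0.
- by rewrite mulrDr; apply: mspanD.
- by rewrite !mulrA; apply: mspanMr.
- rewrite -Xn_comm mulrA; apply: mspanMr; apply: mspanS (mspan_TX n i) _ _ => //.
Qed.

(** For n = 0 this is f(x_1) = 0.  Conjugation of x^l + f_l by tau gives X^l up to lower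
   terms, plus f_l tau^2 = f_l + z f_l tau. *)
Lemma mspan_top n : (0 < l)%N -> mspan 1 l (X_ n ^+ l + scal (A n.+1) (cf 0)).
Proof.
move=> l0; elim: n => [|n IH].
  rewrite (tw_f HT); case: l l0 => // l' _.
  rewrite big_ord_recl /= expr0 mulr1 opprD addrAC addNr add0r; apply: mspanN.
  elim/big_ind: _ => [|u v hu hv|b _]; [exact: mspan0|exact: mspanD|].
  by apply: mspanZ; apply: mspan_Xi; rewrite /= ltnS ltn_ord.
have h1 := mspan_TxT n l.
have h2 := mspan_TuT (leqnn 1) IH.
have h3 : mspan 1 l (scal (A n.+2) (cf 0) * (scal (A n.+2) z * T_ n.+1)).
  by do 2! apply: mspanZ; apply: mspan_Tn.
have := mspanB (mspanD h1 h2) h3.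
rewrite rmorphD rmorphXn iota_scal mulrDr mulrDl addrA subrK.
rewrite -(scal_central _ (T_ n.+1)) -(mulrA (scal _ _)) T_quad mulrDr mulr1.
by rewrite -addrA addrAC subrr add0r.
Qed.

End Tower.

(** * The tower of cyclotomic Hecke algebras *)

Section CyclotomicTower.
Variables (k : comPzRingType) (z : k) (l : nat) (f : 'I_l.+1 -> k) (f_inv : k).
Hypotheses (f0 : f ord0 = 1) (f_invK : f ord_max * f_inv = 1).

Local Notation A := (cyc_hecke z f).
Local Notation iota n := (H_incl z f n).
Local Notation gx := (gx z f).
Local Notation gtau := (gtau z f).

Let iota_scal := @H_incl_scal k z l f.
Let iota_x := @H_incl_x k z l f.
Let iota_tau := @H_incl_tau k z l f.

Definition X_ (n : nat) : A n.+1 := gx n.+1 n.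
(** For n = 0 this is 0, in accordance with the vanishing of ind o res on modules
   over A_0. *)
Definition T_ (n : nat) : A n.+1 := gtau n.+1 n.-1.

Lemma hecke_comm n (B : pzRingType) (phi : {rmorphism A n -> B}) (y : B) :
  (forall a, GRing.comm y (phi (scal (A n) a))) ->
  ((0 < n)%N -> GRing.comm y (phi (gx n 0))) ->
  (forall j, (j.+1 < n)%N -> GRing.comm y (phi (gtau n j))) ->
  forall u, GRing.comm y (phi u).
Proof.
move=> hs hx ht; apply: (hecke_ind f_invK) => // u v hu hv.
  by rewrite rmorphD; apply: commrD.
by rewrite rmorphM; apply: commrM.
Qed.

Lemma X_comm n (u : A n) : GRing.comm (X_ n) (iota n u).
Proof.
move: u; apply: hecke_comm => [a|n0|j jn].
- by rewrite iota_scal; apply/esym/scal_central.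
- by rewrite iota_x //; apply: gx_comm.
- by rewrite iota_tau //; apply/esym/gtau_gx; lia.
Qed.

Lemma T_comm n (u : A n) : GRing.comm (T_ n.+1) (iota n.+1 (iota n u)).
Proof.
move: u; apply: (hecke_comm (phi := iota n.+1 \o iota n)) => [a|n0|j jn];
  rewrite -[X in GRing.comm _ X]/(iota n.+1 (iota n _)).
- by rewrite !iota_scal; apply/esym/scal_central.
- by rewrite iota_x // iota_x //; apply: gtau_gx; lia.
- by rewrite iota_tau // iota_tau; [apply/esym/gtau_comm|]; lia.
Qed.

Lemma XnE n : X_ n.+1 = T_ n.+1 * iota n.+1 (X_ n) * T_ n.+1.
Proof. by rewrite /X_ (iota_x (ltnSn n)) (@gxS k z l f n.+2 n (ltnSn _)). Qed.

Lemma T_quad n : T_ n.+1 * T_ n.+1 = scal (A n.+2) z * T_ n.+1 + 1.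
Proof. exact: (@gtau_quad k z l f n.+2 n (ltnSn _)). Qed.

Lemma T_braid n : T_ n.+2 * iota n.+2 (T_ n.+1) * T_ n.+2
  = iota n.+2 (T_ n.+1) * T_ n.+2 * iota n.+2 (T_ n.+1).
Proof.
rewrite (iota_tau (ltnSn n.+1)) -[T_ n.+2]/(gtau n.+3 n.+1).
by rewrite (@gtau_braid k z l f n.+3 n (ltnSn _)).
Qed.

Lemma T_0 : T_ 0 = 0.
Proof. exact: gtau_default. Qed.

Lemma hecke_ind_step n (P : A n.+1 -> Prop) :
  (forall u v, P u -> P v -> P (u + v)) -> (forall u v, P u -> P v -> P (u * v)) ->
  (forall u, P (iota n u)) -> P (T_ n) -> (n = 0%N -> P (X_ n)) -> forall u, P u.
Proof.
move=> PD PM Pi PT PX; apply: (hecke_ind f_invK) => //.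
- by move=> a; rewrite -iota_scal.
- case: n P PD PM Pi PT PX => [|n] P PD PM Pi PT PX _; first exact: PX.
  by rewrite -iota_x.
- move=> j; rewrite ltnS leq_eqVlt => /orP[/eqP jn|jn]; last by rewrite -iota_tau.
  by have -> : j = n.-1 by rewrite -jn.
Qed.

Lemma X_0_f : X_ 0 ^+ l = - \sum_(b < l) scal (A 1) (coef f b) * X_ 0 ^+ b.
Proof.
have := @gx_f k z l f 1 isT; rewrite poly_eval_coef // => /eqP.
by rewrite addr_eq0 => /eqP.
Qed.

Lemma cyc_tower : hecke_tower z l (coef f) (H_incl z f) X_ T_.
Proof.
split.
- exact: iota_scal.
- exact: X_comm.
- exact: T_comm.
- exact: XnE.
- exact: T_quad.
- exact: T_braid.
- exact: T_0.
- exact: X_0_f.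
- exact: hecke_ind_step.
Qed.

Lemma coef_const : coef f 0 = f ord_max.
Proof. by rewrite /coef subn0; congr (f _); apply: val_inj; rewrite /= inordK. Qed.

End CyclotomicTower.

(** * Comparison of consecutive levels *)

Section TowerInclusion.
Variables (k : comPzRingType) (z : k) (l : nat) (f : 'I_l.+1 -> k).
Variables (N : lmodType k) (n : nat) (x x' : kend_alg N) (t t' : nat -> kend_alg N).
Hypotheses (xx : (0 < n)%N -> x' = x) (tt : forall j, (j.+1 < n)%N -> t' j = t j).

Definition tower_incl : {linear towerM l N n -> towerM l N n.+1} :=
  extend n (blk l N n.+1).

Lemma tower_incl_blk j y : (j <= n)%N -> tower_incl (blk l N n j y) = blk l N n.+1 j y.
Proof. by move=> jn; rewrite [LHS](@extend_blk k l N n). Qed.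

Lemma tower_incl_inj v : tower_incl v = 0 -> v = 0.
Proof.
move=> v0; apply/ffunP => j; rewrite [RHS]ffunE.
have := congr1 (fun u : towerM l N n.+1 => u (widen_ord (leqnSn n.+1) j)) v0.
rewrite [RHS]ffunE => <-; rewrite /tower_incl /= /extend_fun sum_ffunE (bigD1 j) //=.
rewrite ffunE eqxx big1 ?addr0 // => i ij; rewrite ffunE ifF //.
by apply/negbTE; rewrite eq_sym.
Qed.

#[local] Opaque tower_incl blk towerX towerT cw evdiff wmul.

Lemma descent_ext p : (p < n)%N -> descent z t' p = descent z t p.
Proof. by elim: p => //= p IH pn; rewrite tt // IH // ltnW. Qed.

(** The formulas for the action on blocks 0, ..., n do not depend on n. *)
Lemma tower_incl_X v : tower_incl (towerX z f n x t v) = towerX z f n.+1 x' t' (tower_incl v).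
Proof.
apply: (towerM_ext (g := tower_incl \o towerX z f n x t)
  (h := towerX z f n.+1 x' t' \o tower_incl)) => j y jn /=.
rewrite tower_incl_blk //; case: j jn => [|p] jn; first by rewrite !X_0 tower_incl_blk.
have n0 : (0 < n)%N by apply: leq_trans jn.
have dE := descent_ext jn; have xE := xx n0.
rewrite (X_S _ _ _ _ _ jn) (X_S _ _ _ _ _ (leqW jn)) xE dE linearD linearZZ.
by rewrite (tower_incl_blk _ jn) (tower_incl_blk _ (leq0n n)).
Qed.

Lemma tower_incl_T i v : (i < n)%N ->
  tower_incl (towerT z l n t i v) = towerT z l n.+1 t' i (tower_incl v).
Proof.
move=> iN; apply: (towerM_ext (g := tower_incl \o towerT z l n t i)
  (h := towerT z l n.+1 t' i \o tower_incl)) => j y jn /=.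
have iN1 := ltnW iN; have iN2 := leqW iN.
rewrite tower_incl_blk //; case: (ltngtP j i) => [ji|ij|->].
- case: i iN iN1 iN2 ji => // i iN iN1 iN2 ji; have iN3 := leqW iN1.
  by rewrite !T_lt // tower_incl_blk // tt.
- move: ij; rewrite leq_eqVlt => /orP[/eqP <-|ij]; first by rewrite !T_S // tower_incl_blk.
  by rewrite !T_gt ?(leqW jn) // tower_incl_blk // tt // (leq_trans ij).
- by rewrite !T_eq // linearD linearZZ !tower_incl_blk.
Qed.
End TowerInclusion.

Section Coordinates.
Variables (k : comPzRingType) (z : k) (l : nat) (f : 'I_l.+1 -> k) (f_inv : k).
Hypotheses (f0 : f ord0 = 1) (f_invK : f ord_max * f_inv = 1).

Local Notation A := (cyc_hecke z f).
Local Notation iota n := (H_incl z f n).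
Local Notation gx := (gx z f).
Local Notation gtau := (gtau z f).
Local Notation X_ := (X_ z f).
Local Notation T_ := (T_ z f).

Lemma datum_map n (B C : pzalg k) (phi : {rmorphism B -> C}) (x : B) (T : nat -> B) :
  (forall a, phi (scal B a) = scal C a) ->
  hecke_datum z f n x T -> hecke_datum z f n (phi x) (fun i => phi (T i)).
Proof.
move=> ps D; split.
- by move=> i iN; rewrite -rmorphM (hd_quad D) // rmorphD rmorphM ps rmorph1.
- by move=> i j ij jn; rewrite -!rmorphM (hd_comm D).
- by move=> i iN; rewrite -!rmorphM (hd_braid D).
- by move=> i i0 iN; rewrite -!rmorphM (hd_xT D).
- by move=> n1; rewrite -!rmorphM (hd_xTxT D).
- move=> n0; rewrite -(rmorph0 phi) -(hd_f D n0) /poly_eval rmorph_sum.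
  by apply: eq_bigr => i _; rewrite rmorphM rmorphXn ps.
Qed.

Lemma kend_scale1 (V : lmodType k) (B : pzalg k) (phi : {rmorphism B -> kend_alg V}) :
  (forall a, phi (scal B a) = scal (kend_alg V) a) ->
  forall a v, (phi (scal B a) : kend V) v = a *: v.
Proof. by move=> ps a v; rewrite ps. Qed.

Section Rho.
Variables (n : nat) (N : lmodType k) (phi : {rmorphism A n -> kend_alg N}).
Hypothesis phi_scal : forall a, phi (scal (A n) a) = scal (kend_alg N) a.

Local Notation act u m := ((phi u : kend N) m).
Local Notation c := (mon l N 0).

(** The action of A_{n+1} on the tower of N, from an action phi of A_n on N. *)
Definition rho : {rmorphism A n.+1 -> kend_alg (towerM l N n)} :=
  datum_hom f_invK (tower_datum f0 (datum_map phi_scal (hecke_datum_self z f n))).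

Lemma rho_scal a : rho (scal (A n.+1) a) = scal (kend_alg _) a.
Proof. exact: datum_hom_scal. Qed.

Lemma rho_x : rho (gx n.+1 0) = towerX z f n (phi (gx n 0)) (fun i => phi (gtau n i)) :> kend _.
Proof. by rewrite (gx_ord _ _ (ltn0Sn n)) /rho datum_homE. Qed.

Lemma rho_tau j : (j < n)%N ->
  rho (gtau n.+1 j) = towerT z l n (fun i => phi (gtau n i)) j :> kend _.
Proof. by move=> jn; rewrite (gtau_ord _ _ (jn : (j < n.+1.-1)%N)) /rho datum_homE. Qed.

Lemma rho_mul u v w : (rho (u * v) : kend _) w = (rho u : kend _) ((rho v : kend _) w).
Proof. by rewrite rmorphM. Qed.
Lemma rho_add u v w : (rho (u + v) : kend _) w = (rho u : kend _) w + (rho v : kend _) w.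
Proof. by rewrite rmorphD. Qed.

Lemma phi_mul u v w : act (u * v) w = act u (act v w).
Proof. by rewrite rmorphM. Qed.
Lemma phi_add u v w : act (u + v) w = act u w + act v w.
Proof. by rewrite rmorphD. Qed.

(** The correction terms of [Xblk] vanish on constants, so the constants of the last
   block behave like the elements 1 (x) m of an induced module. *)
Lemma rho_top a m : (rho (iota n a) : kend _) (blk l N n n (c m)) = blk l N n n (c (act a m)).
Proof.
move: m; pattern a; move: a; apply: (hecke_ind f_invK).
- move=> a m; rewrite H_incl_scal (kend_scale1 rho_scal) (kend_scale1 phi_scal).
  by rewrite (linearZZ c) (linearZZ (blk l N n n)).
- by move=> u v hu hv m; rewrite rmorphD rho_add hu hv phi_add (linearD c) linearD.
- by move=> u v hu hv m; rewrite rmorphM rho_mul hv hu phi_mul.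
- move=> n0 m; rewrite H_incl_x // rho_x.
  have D := datum_map phi_scal (hecke_datum_self z f n).
  case: (n) n0 phi D => // p _ phi' D.
  rewrite X_S // evdiffE (evalM_mon0 f0 (hd_f D _)) // subrr.
  by rewrite !linear0 addr0 cw_c.
- move=> j jn m; rewrite H_incl_tau // rho_tau ?(ltnW jn) // T_gt //.
  by rewrite cw_c.
Qed.
End Rho.

Section Inclusion.
Variables (n : nat) (N : lmodType k) (phi : {rmorphism A n.+1 -> kend_alg N}).
Hypothesis phi_scal : forall a, phi (scal (A n.+1) a) = scal (kend_alg N) a.

Definition phi_res : {rmorphism A n -> kend_alg N} := phi \o iota n.
Lemma phi_resE u : phi_res u = phi (iota n u).
Proof. by []. Qed.
Lemma phi_res_scal a : phi_res (scal (A n) a) = scal (kend_alg N) a.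
Proof. by rewrite phi_resE (@H_incl_scal k z l f). Qed.

Local Notation R1 := (rho phi_res_scal).
Local Notation R2 := (rho phi_scal).

(** On generators this is [tower_incl_X] and [tower_incl_T]: the first n + 1 blocks of
   the tower over A_{n+2} are the tower over A_{n+1} of the restriction of phi. *)
Lemma tower_incl_act u v :
  tower_incl l N n ((R1 u : kend _) v) = (R2 (iota n.+1 u) : kend _) (tower_incl l N n v).
Proof.
move: v; pattern u; move: u; apply: (hecke_ind f_invK).
- move=> a v; rewrite (@H_incl_scal k z l f).
  by rewrite (kend_scale1 (rho_scal _)) (kend_scale1 (rho_scal _)) linearZZ.
- by move=> u w hu hw v; rewrite (rmorphD (iota n.+1)) !rho_add linearD hu hw.
- by move=> u w hu hw v; rewrite (rmorphM (iota n.+1)) !rho_mul hu hw.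
- move=> n0 v; rewrite (@H_incl_x k z l f) // !rho_x; apply: tower_incl_X => [n1|j jn].
    by rewrite phi_resE (@H_incl_x k z l f).
  by rewrite phi_resE (@H_incl_tau k z l f).
- move=> j jn v; rewrite (@H_incl_tau k z l f) // !rho_tau ?(ltnW jn) //.
  apply: tower_incl_T => // i iN.
  by rewrite phi_resE (@H_incl_tau k z l f).
Qed.

End Inclusion.

Section Triangular.
Variable N : lmodType k.

Definition last_blk_fun n (v : towerM l N n) : polyM l N := v ord_max.
Lemma last_blk_linear n : linear (@last_blk_fun n).
Proof. by move=> a u v; rewrite /last_blk_fun !ffunE. Qed.
HB.instance Definition _ n := GRing.isLinear.Build k (towerM l N n) (polyM l N) *:%R
  (@last_blk_fun n) (@last_blk_linear n).
Definition last_blk n : {linear towerM l N n -> polyM l N} := @last_blk_fun n.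

Lemma last_blk_blk n j y : (j <= n)%N ->
  last_blk n (blk l N n j y) = if j == n then y else 0.
Proof. by move=> jn; rewrite /last_blk /= /last_blk_fun ffunE eq_sym. Qed.

Lemma last_blk_incl n v : last_blk n.+1 (tower_incl l N n v) = 0.
Proof.
apply: (towerM_ext (g := last_blk n.+1 \o tower_incl l N n) (h := \0)) => j y jn.
by rewrite /= tower_incl_blk // last_blk_blk ?leqW // ltn_eqF.
Qed.

Lemma last_blk_T_incl n t v :
  last_blk n.+1 (towerT z l n.+1 t n (tower_incl l N n v)) = last_blk n v.
Proof.
apply: (towerM_ext (g := last_blk n.+1 \o (towerT z l n.+1 t n \o tower_incl l N n))
  (h := last_blk n)) => j y jn /=.
rewrite [tower_incl _ _ _ _]tower_incl_blk // [RHS]last_blk_blk //.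
move: jn; rewrite leq_eqVlt => /orP[/eqP ->|jn].
  rewrite T_eq // linearD linearZZ [X in X + _]last_blk_blk // eqxx.
  by rewrite [last_blk _ _]last_blk_blk // ltn_eqF // scaler0 addr0 eqxx.
case: n jn v => // n jn v; rewrite T_lt ?(leqW (ltnSn n)) // [LHS]last_blk_blk; last by lia.
by rewrite !ltn_eqF //; lia.
Qed.

(** Polynomials in w of degree less than a. *)
Definition lower (a : nat) (y : polyM l N) : Prop := forall b : 'I_l, (a <= b)%N -> y b = 0.

Lemma lower0 a : lower a 0.
Proof. by move=> b _; rewrite ffunE. Qed.
Lemma lowerD a y y' : lower a y -> lower a y' -> lower a (y + y').
Proof. by move=> h h' b ab; rewrite ffunE h // h' // addr0. Qed.
Lemma lowerS a b y : lower a y -> (a <= b)%N -> lower b y.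
Proof. by move=> h ab d bd; apply: h; apply: leq_trans bd. Qed.
Lemma lower_mon a b m : (a < b)%N -> lower b (mon l N a m).
Proof.
by move=> ab d bd; rewrite ffunE ifF //; apply/negbTE; rewrite neq_ltn (leq_trans ab bd) orbT.
Qed.
End Triangular.

(** Induction on n and on a.  By [mspan_TxT], X^a is tau x^a tau up to elements of
   A_{n+1} tau A_{n+1}, which contribute nothing to the last block, and up to
   A_{n+1} X^i with i < a.  In tau x^a tau the right factor tau moves the constants of
   the last block one block down, where x^a acts as in the smaller tower, and the left
   factor tau moves the result back ([last_blk_T_incl]). *)
Lemma rho_X_top n : forall (N : lmodType k) (phi : {rmorphism A n -> kend_alg N})
    (phi_scal : forall a, phi (scal (A n) a) = scal (kend_alg N) a) a m,
  (a < l)%N ->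
  lower a (last_blk N n ((rho phi_scal (X_ n ^+ a) : kend _) (blk l N n n (mon l N 0 m)))
           - mon l N a m).
Proof.
elim: n => [|n IHn] N phi phi_scal.
  move=> a m al.
  have -> : (rho phi_scal (X_ 0 ^+ a) : kend _) (blk l N 0 0 (mon l N 0 m)) = blk l N 0 0 (mon l N a m).
    have E : rho phi_scal (X_ 0) = _ :> kend _ := rho_x phi_scal.
    rewrite rmorphXn kend_expE E -(iter_wmul f m al).
    by elim: a {al} => [//|a IH]; rewrite !iterS IH X_0.
  by rewrite last_blk_blk // subrr; apply: lower0.
elim/ltn_ind=> a IHa m al.
have HT := cyc_tower z f0 f_invK.
have step u : mspan (H_incl z f) X_ T_ 1 a u ->
    lower a (last_blk N n.+1 ((rho phi_scal u : kend _) (blk l N n.+1 n.+1 (mon l N 0 m)))).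
  elim=> [|v w _ hv _ hw|p h|h i /andP[_ ia]].
  - by rewrite rmorph0 linear0; apply: lower0.
  - by rewrite rho_add linearD; apply: lowerD.
  - rewrite !rho_mul rho_top (rho_tau _ (ltnSn n)) T_S //.
    rewrite -(tower_incl_blk _ (leqnn n)) -tower_incl_act last_blk_incl.
    exact: lower0.
  - rewrite -(Xn_comm HT) rho_mul rho_top.
    have il := ltn_trans ia al; have := IHa i ia (((phi h : kend N) m)) il.
    move=> /lowerS /(_ (ltnW ia)) hl.
    by have := lowerD hl (lower_mon (phi h m : N) ia); rewrite subrK.
have := step _ (mspan_TxT HT n a).
rewrite rmorphB; move: (rho phi_scal (X_ n.+1 ^+ a)) => XX.
rewrite -[(_ - _ : kend _) _]/((XX : kend _) _ - (rho phi_scal _ : kend _) _) linearB.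
rewrite !rho_mul (rho_tau _ (ltnSn n)) T_S // -(tower_incl_blk _ (leqnn n)) -rmorphXn -tower_incl_act.
rewrite last_blk_T_incl => h1.
have h2 := IHn N _ (phi_res_scal phi_scal) a m al.
by have := lowerD h1 h2; rewrite addrA subrK.
Qed.

End Coordinates.

(** * The Mackey decomposition *)

Section MackeyModules.
Variables (k : comPzRingType) (z : k) (l : nat) (f : 'I_l.+1 -> k) (f_inv : k).
Hypotheses (f0 : f ord0 = 1) (f_invK : f ord_max * f_inv = 1).

Local Notation A := (cyc_hecke z f).
Local Notation iota n := (H_incl z f n).
Local Notation X_ := (X_ z f).
Local Notation T_ := (T_ z f).
Local Notation rho := (rho f0 f_invK).
Local Notation HT := (cyc_tower z f0 f_invK).

Section Coord.
Variables (n : nat) (N : lmodType k) (phi : {rmorphism A n -> kend_alg N}).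
Hypothesis phi_scal : forall a, phi (scal (A n) a) = scal (kend_alg N) a.
Variables (M : lmodType (A n)) (theta : M -> N).
Hypothesis thetaD : {morph theta : u v / u + v}.
Hypothesis thetaZ : forall a m, theta (a *: m) = (phi a : kend N) (theta m).
Local Notation c := (mon l N 0).

(** The k-module N is kept apart from M in order that the induction on n can replace M
   by its restriction without changing N. *)
Definition coord_unit_fun (m : M) : res_mod (iota n) (twist (rho phi_scal)) :=
  blk l N n n (c (theta m)).
Lemma coord_unit_linear : linear coord_unit_fun.
Proof.
move=> a u v; rewrite /coord_unit_fun thetaD thetaZ (linearD c) (linearD (blk l N n n)).
by rewrite -(rho_top f0 f_invK phi_scal).
Qed.
HB.instance Definition _ := GRing.isLinear.Build (A n) M
  (res_mod (iota n) (twist (rho phi_scal))) *:%R coord_unit_fun coord_unit_linear.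
Definition coord_unit : {linear M -> res_mod (iota n) (twist (rho phi_scal))} := coord_unit_fun.
Definition coord : {linear ind_mod (iota n) M -> twist (rho phi_scal)} := ind_lift coord_unit.

Lemma coord_pure u m :
  coord (tpure (iota n) u m) = (rho phi_scal u : kend _) (blk l N n n (c (theta m))).
Proof. exact: ind_lift_pure. Qed.
End Coord.

(** ind o res, which vanishes on modules over A_0. *)
Definition indres n : lmodType (A n) -> lmodType (A n) :=
  match n with
  | 0 => fun _ => 'rV[A 0]_0
  | m.+1 => fun M => ind_mod (iota m) (res_mod (iota m) M)
  end.

Section Sigma.
Variables (n : nat) (M : lmodType (A n.+1)).
Definition sigma_unit_fun (m : res_mod (iota n) M) :
    res_mod (iota n) (res_mod (iota n.+1) (ind_mod (iota n.+1) M)) :=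
  tpure (iota n.+1) (T_ n.+1) m.
Lemma sigma_unit_linear : linear sigma_unit_fun.
Proof.
move=> a u v; rewrite [LHS]tpureDr; congr (_ + _).
transitivity (tpure (iota n.+1) (T_ n.+1 * iota n.+1 (iota n a)) (u : M)).
  by rewrite tpure_bal.
by rewrite (tw_T HT) [RHS]tpureZ.
Qed.
HB.instance Definition _ := GRing.isLinear.Build (A n) (res_mod (iota n) M)
  (res_mod (iota n) (res_mod (iota n.+1) (ind_mod (iota n.+1) M))) *:%R
  sigma_unit_fun sigma_unit_linear.
Definition sigma_unit : {linear res_mod (iota n) M ->
  res_mod (iota n) (res_mod (iota n.+1) (ind_mod (iota n.+1) M))} := sigma_unit_fun.
Definition sigma_succ :
    {linear ind_mod (iota n) (res_mod (iota n) M) ->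
       res_mod (iota n.+1) (ind_mod (iota n.+1) M)} := ind_lift sigma_unit.
Lemma sigma_succ_pure u m :
  sigma_succ (tpure (iota n) u m) = tpure (iota n.+1) (iota n.+1 u * T_ n.+1) (m : M).
Proof. by rewrite [LHS]ind_lift_pure [LHS]tpureZ. Qed.
End Sigma.

Definition sigma n : forall M : lmodType (A n),
    {linear indres M -> res_mod (iota n) (ind_mod (iota n) M)} :=
  match n with
  | 0 => fun M => \0
  | m.+1 => fun M => sigma_succ M
  end.

Definition mackey n (M : lmodType (A n)) (w : indres M) (m : 'I_l -> M) :
    ind_mod (iota n) M :=
  (sigma M w : ind_mod (iota n) M) + \sum_(a < l) tpure (iota n) (X_ n ^+ a) (m a).

Lemma mackeyE n (M : lmodType (A n)) (w : indres M) (m : 'I_l -> M) :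
  mackey w m
  = (sigma M w : ind_mod (iota n) M) + \sum_(a < l) tpure (iota n) (X_ n ^+ a) (m a).
Proof. by []. Qed.

Lemma mackey_add n (M : lmodType (A n)) (w w' : indres M) (m m' : 'I_l -> M) :
  mackey w m + mackey w' m' = mackey (w + w') (fun a => m a + m' a).
Proof.
rewrite /mackey addrACA (linearD (sigma M)) -big_split; congr (_ + _).
by apply: eq_bigr => a _; rewrite tpureDr.
Qed.

Lemma mackey_0 n (M : lmodType (A n)) : mackey (0 : indres M) (fun=> 0) = 0.
Proof.
rewrite /mackey (linear0 (sigma M)) add0r big1 // => a _.
by apply: (addIr (tpure (iota n) (X_ n ^+ a) 0)); rewrite -tpureDr !add0r.
Qed.

Lemma tpure0r n (M : lmodType (A n)) u : tpure (iota n) u (0 : M) = 0.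
Proof. by apply: (addIr (tpure (iota n) u 0)); rewrite -tpureDr !add0r. Qed.
Lemma tpureNr n (M : lmodType (A n)) u (m : M) :
  tpure (iota n) u (- m) = - tpure (iota n) u m.
Proof. by apply: (addIr (tpure (iota n) u m)); rewrite -tpureDr !addNr tpure0r. Qed.
Lemma tpure0l n (M : lmodType (A n)) (m : M) : tpure (iota n) 0 m = 0.
Proof. by apply: (addIr (tpure (iota n) 0 m)); rewrite -tpureDl !add0r. Qed.

Lemma mackey_opp n (M : lmodType (A n)) (w : indres M) (m : 'I_l -> M) :
  - mackey w m = mackey (- w) (fun a => - m a).
Proof.
rewrite /mackey opprD (linearN (sigma M)) -sumrN; congr (_ + _).
by apply: eq_bigr => a _; rewrite tpureNr.
Qed.

(** The summand A_n tau A_n contributes to ind res M and A_n X^i to the copy of M with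
   index i. *)
Lemma mackey_mspan n (M : lmodType (A n)) lo (u : A n.+1) (m : M) :
  mspan (H_incl z f) X_ T_ lo l u ->
  exists w m', tpure (iota n) u m = mackey w m' /\ forall a : 'I_l, (a < lo)%N -> m' a = 0.
Proof.
move=> hu; elim: hu m => [|v w _ hv _ hw|g h|h i /andP[ilo il]] m.
- by exists 0, (fun=> 0); rewrite tpure0l mackey_0.
- have [w1 [m1 [E1 z1]]] := hv m; have [w2 [m2 [E2 z2]]] := hw m.
  exists (w1 + w2), (fun a => m1 a + m2 a); rewrite tpureDl E1 E2 mackey_add.
  by split=> // a alo; rewrite z1 // z2 // addr0.
- case: n M g h m {u} => [|n] M g h m.
    by exists 0, (fun=> 0); rewrite mackey_0 (tw_T0 HT) mulr0 mul0r tpure0l.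
  exists (tpure (iota n) g (h *: m : res_mod (iota n) M)), (fun=> 0).
  rewrite tpure_bal /mackey [sigma _ _]sigma_succ_pure big1 ?addr0 // => a _.
  exact: tpure0r.
- exists 0, (fun a : 'I_l => if a == i :> nat then h *: m else 0); split.
    rewrite -(Xn_comm HT) tpure_bal /mackey (linear0 (sigma M)) add0r.
    rewrite (bigD1 (Ordinal il)) //= eqxx big1 ?addr0 // => a ai.
    by rewrite ifF ?tpure0r //; apply/negbTE.
  by move=> a alo; rewrite ifF // ltn_eqF // (leq_trans alo).
Qed.

Lemma mackey_surj n (M : lmodType (A n)) (v : ind_mod (iota n) M) :
  exists w m, v = mackey w m.
Proof.
elim/tensor_ind: v => [u m||v v' [w [m ->]] [w' [m' ->]]|u [w [m ->]]].
- by have [w [m' [-> _]]] := mackey_mspan m (mspan_full HT u); exists w, m'.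
- by exists 0, (fun=> 0); rewrite mackey_0.
- by exists (w + w'), (fun a => m a + m' a); rewrite mackey_add.
- by exists (- w), (fun a => - m a); rewrite mackey_opp.
Qed.

(** By [mspan_top] the element X^l + f_l has no component of index 0. *)
Lemma mackey_top n (M : lmodType (A n)) (m : M) : (0 < l)%N ->
  exists w m', tpure (iota n) (X_ n ^+ l) m = mackey w m' /\
    forall a : 'I_l, a = 0%N :> nat -> m' a = - (scal (A n) (f ord_max) *: m).
Proof.
move=> l0; have [w [m' [E z0]]] := mackey_mspan m (mspan_top HT n l0).
have c0 := coef_const f.
pose m0 (a : 'I_l) : M := if a == 0%N :> nat then scal (A n) (f ord_max) *: m else 0.
exists w, (fun a => m' a - m0 a); split; last first.
  by move=> a a0; rewrite z0 ?a0 // /m0 a0 add0r.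
rewrite -[w]subr0 -mackey_add -mackey_opp -E c0 tpureDl.
have -> : mackey (0 : indres M) m0 = tpure (iota n) (scal (A n.+1) (f ord_max)) m.
  rewrite /mackey (linear0 (sigma M)) add0r (bigD1 (Ordinal l0)) //= big1 ?addr0.
    by rewrite /m0 /= expr0 -tpure_bal mul1r (tw_scal HT).
  by move=> a a0; rewrite /m0 ifF ?tpure0r //; apply/negbTE.
by rewrite addrK.
Qed.

Definition coord_injective n : Prop :=
  forall (N : lmodType k) (phi : {rmorphism A n -> kend_alg N})
    (phi_scal : forall a, phi (scal (A n) a) = scal (kend_alg N) a)
    (M : lmodType (A n)) (theta : M -> N)
    (thetaD : {morph theta : u v / u + v})
    (thetaZ : forall a m, theta (a *: m) = (phi a : kend N) (theta m)),
  (forall m, theta m = 0 -> m = 0) ->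
  forall v, coord phi_scal thetaD thetaZ v = 0 -> v = 0.

(** It suffices to see that tau carries the constants of block n + 1 to those of
   block n. *)
Lemma coord_sigma n (N : lmodType k) (phi : {rmorphism A n.+1 -> kend_alg N})
    (phi_scal : forall a, phi (scal (A n.+1) a) = scal (kend_alg N) a)
    (M : lmodType (A n.+1)) (theta : M -> N)
    (thetaD : {morph theta : u v / u + v})
    (thetaZ : forall a m, theta (a *: m) = (phi a : kend N) (theta m))
    (thetaD' : {morph (theta : res_mod (iota n) M -> N) : u v / u + v})
    (thetaZ' : forall a (m : res_mod (iota n) M),
       theta (a *: m) = (phi_res phi a : kend N) (theta m))
    (w : ind_mod (iota n) (res_mod (iota n) M)) :
  coord phi_scal thetaD thetaZ (sigma_succ M w : ind_mod (iota n.+1) M)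
  = tower_incl l N n (coord (phi_res_scal phi_scal) thetaD' thetaZ' w).
Proof.
elim/tensor_ind: w => [u m||u v hu hv|u hu].
- rewrite sigma_succ_pure coord_pure (rho_mul f0 f_invK).
  rewrite (rho_tau f0 f_invK _ (ltnSn n)) T_S // -(tower_incl_blk _ (leqnn n)).
  by rewrite -(tower_incl_act f0 f_invK) -coord_pure.
- by rewrite !linear0.
- by rewrite (linearD (sigma_succ M)) linearD hu hv (linearD (coord _ _ _)) linearD.
- by rewrite (linearN (sigma_succ M)) linearN hu (linearN (coord _ _ _)) linearN.
Qed.

Section Injectivity.
Variables (N : lmodType k).

Lemma last_blk_coord_sigma n (phi : {rmorphism A n -> kend_alg N})
    (phi_scal : forall a, phi (scal (A n) a) = scal (kend_alg N) a)
    (M : lmodType (A n)) (theta : M -> N)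
    (thetaD : {morph theta : u v / u + v})
    (thetaZ : forall a m, theta (a *: m) = (phi a : kend N) (theta m)) w :
  last_blk l N n (coord phi_scal thetaD thetaZ (sigma M w : ind_mod (iota n) M)) = 0.
Proof.
case: n phi phi_scal M theta thetaD thetaZ w => [|n] phi phi_scal M theta thetaD thetaZ w.
  by rewrite linear0 [LHS](linear0 (last_blk l N 0)).
have thetaZ' a (m : res_mod (iota n) M) :
    theta (a *: m) = (phi_res phi a : kend N) (theta m) by apply: thetaZ.
have thetaD' : {morph (theta : res_mod (iota n) M -> N) : u v / u + v} by exact: thetaD.
by rewrite (coord_sigma _ _ _ thetaD' thetaZ') last_blk_incl.
Qed.

Variables (n : nat) (phi : {rmorphism A n -> kend_alg N}).
Hypothesis phi_scal : forall a, phi (scal (A n) a) = scal (kend_alg N) a.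
Variables (M : lmodType (A n)) (theta : M -> N).
Hypothesis thetaD : {morph theta : u v / u + v}.
Hypothesis thetaZ : forall a m, theta (a *: m) = (phi a : kend N) (theta m).
Hypothesis theta_inj : forall m, theta m = 0 -> m = 0.
Local Notation crd := (coord phi_scal thetaD thetaZ).

(** The last block of [coord] kills sigma w and is unitriangular in m. *)
Lemma mackey_coord_ker w m : crd (mackey w m) = 0 -> forall a, m a = 0.
Proof.
rewrite /mackey linearD linear_sum => /(congr1 (last_blk l N n)).
rewrite [LHS](linearD (last_blk l N n)) last_blk_coord_sigma add0r.
rewrite [RHS](linear0 (last_blk l N n)) [LHS](linear_sum (last_blk l N n)) => E.
pose L (b : 'I_l) := last_blk l N n (crd (tpure (iota n) (X_ n ^+ b) (m b))).
have Llow (b : 'I_l) : lower b (L b - mon l N b (theta (m b))).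
  by rewrite /L coord_pure; apply: rho_X_top.
have Lval (b a : 'I_l) : (b <= a)%N -> L b a = mon l N b (theta (m b)) a.
  by move=> ba; have := Llow b a ba; rewrite !ffunE => /eqP; rewrite subr_eq0 => /eqP.
(* descending induction on a, the highest power of w being determined first *)
suff H d : forall a : 'I_l, (l - a <= d)%N -> m a = 0 by move=> a; apply: (H l); apply: leq_subr.
elim: d => [|d IH] a ad.
  by have := ltn_ord a; rewrite -subn_gt0 lt0n; move: ad; rewrite leqn0 => ->.
have := congr1 (fun y : polyM l N => y a) E; rewrite sum_ffunE ffunE (bigD1 a) //=.
rewrite -/(L a) Lval // ffunE eqxx big1 ?addr0; first exact: theta_inj.
move=> b ba; rewrite -/(L b); case: (ltngtP b a) => [lt|gt|/val_inj E']; last by rewrite E' eqxx in ba.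
  by rewrite Lval ?(ltnW lt) // ffunE ifF // gtn_eqF.
have mb : m b = 0 by apply: IH; have := ltn_ord b; lia.
have t0 : theta 0 = 0 by apply: (addIr (theta 0)); rewrite -thetaD !add0r.
by rewrite /L coord_pure mb t0 !linear0 ffunE.
Qed.
End Injectivity.

Lemma sigma_succ_inj n (N : lmodType k) (phi : {rmorphism A n.+1 -> kend_alg N})
    (phi_scal : forall a, phi (scal (A n.+1) a) = scal (kend_alg N) a)
    (M : lmodType (A n.+1)) (theta : M -> N)
    (thetaD : {morph theta : u v / u + v})
    (thetaZ : forall a m, theta (a *: m) = (phi a : kend N) (theta m)) w :
  coord_injective n -> (forall m, theta m = 0 -> m = 0) ->
  coord phi_scal thetaD thetaZ (sigma_succ M w : ind_mod (iota n.+1) M) = 0 -> w = 0.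
Proof.
have thetaZ' a (u : res_mod (iota n) M) :
    theta (a *: u) = (phi_res phi a : kend N) (theta u) by apply: thetaZ.
have thetaD' : {morph (theta : res_mod (iota n) M -> N) : u v / u + v} by exact: thetaD.
move=> IH theta_inj; rewrite (coord_sigma _ _ _ thetaD' thetaZ') => cw.
apply: (IH N _ (phi_res_scal phi_scal) (res_mod (iota n) M) theta thetaD' thetaZ') => //.
exact: tower_incl_inj cw.
Qed.

(** Every element is of the form [mackey w m].  If it is killed by [coord], then m = 0
   by [mackey_coord_ker], and w = 0 by the induction hypothesis for the restriction
   of M. *)
Lemma coord_inj n : coord_injective n.
Proof.
elim: n => [|n IH] N phi phi_scal M theta thetaD thetaZ theta_inj v;
  have [w [m ->]] := mackey_surj v => cv; have m0 := mackey_coord_ker theta_inj cv.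
  by rewrite /mackey add0r big1 // => a _; rewrite m0; exact: tpure0r.
have mE : mackey w m = sigma_succ M w :> ind_mod (iota n.+1) M.
  by rewrite /mackey big1 ?addr0 // => a _; rewrite m0; apply: tpure0r.
rewrite mE in cv *; rewrite (sigma_succ_inj IH theta_inj cv).
exact: linear0.
Qed.

(** The k-module underlying a module over A_n, and the action of A_n on it. *)
Section Underlying.
Variables (n : nat) (M : lmodType (A n)).
Definition base_mod : lmodType k := res_mod (scal (A n)) M.
Definition act_fun (u : A n) (m : base_mod) : base_mod := u *: (m : M).
Lemma act_linear u : linear (act_fun u).
Proof.
move=> a v w; rewrite /act_fun scalerDr; congr (_ + _).
by rewrite [LHS]scalerA -scal_central -scalerA.
Qed.
HB.instance Definition _ u :=
  GRing.isLinear.Build k base_mod base_mod *:%R (act_fun u) (act_linear u).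
Definition act_end (u : A n) : kend_alg base_mod := (act_fun u : kend base_mod).
Lemma act_nmod : nmod_morphism act_end.
Proof.
split=> [|u v]; apply: linear_ext => m; first exact: (scale0r (m : M)).
exact: (scalerDl (m : M) u v).
Qed.
Lemma act_monoid : monoid_morphism act_end.
Proof.
split=> [|u v]; apply: linear_ext => m; first exact: (scale1r (m : M)).
exact: (esym (scalerA u v (m : M))).
Qed.
HB.instance Definition _ :=
  GRing.isNmodMorphism.Build (A n) (kend_alg base_mod) act_end act_nmod.
HB.instance Definition _ :=
  GRing.isMonoidMorphism.Build (A n) (kend_alg base_mod) act_end act_monoid.
Lemma act_scal a : act_end (scal (A n) a) = scal (kend_alg base_mod) a.
Proof. exact: linear_ext. Qed.
End Underlying.

Lemma mackey_inj n (M : lmodType (A n)) (w w' : indres M) (m m' : 'I_l -> M) :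
  mackey w m = mackey w' m' -> w = w' /\ m =1 m'.
Proof.
move=> E.
have E0 : mackey (w - w') (fun a => m a - m' a) = 0.
  by rewrite -mackey_add -mackey_opp E subrr.
pose theta (u : M) : base_mod M := u.
have tD : {morph theta : u v / u + v} by [].
have tZ a u : theta (a *: u) = (act_end M a : kend (base_mod M)) (theta u) by [].
have m0 : forall a, m a - m' a = 0.
  apply: (@mackey_coord_ker (base_mod M) n _ (@act_scal n M) M theta tD tZ _
    (w - w') (fun a => m a - m' a)) => //.
  by rewrite E0 linear0.
split; last by move=> a; apply/eqP; rewrite -subr_eq0 m0.
apply/eqP; rewrite -subr_eq0; apply/eqP.
move: E0; rewrite /mackey big1 ?addr0 => [E0|a _]; last by rewrite m0 tpure0r.
case: n M w w' m m' {E m0 theta tD tZ} E0 => [|n] M w w' m m' E0.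
  exact: thinmx0.
apply: (sigma_succ_inj (phi_scal := @act_scal n.+1 M) (theta := fun u : M => u : base_mod M)
  (w := w - w') (@coord_inj n)) => //.
by move=> tD; rewrite [sigma_succ _ _]E0; apply: (linear0 (coord _ _ _)).
Qed.

End MackeyModules.

(** * Functors from presented categories *)

Section KModuleCancel.
Variables (k : comPzRingType) (D : lincat k) (a b : obj D).
Local Notation K := (hom_kmodule D a b).

Lemma hadd0 (g : hom D a b) : hadd D g (hzero D a b) = g.
Proof. by rewrite (kmod_addC K) (kmod_add0 K). Qed.

Lemma hadd_cancel (g u v : hom D a b) : hadd D u g = hadd D v g -> u = v.
Proof.
move=> E; have N w : hadd D (hadd D w g) (hopp D g) = w.
  by rewrite -(kmod_addA K) [hadd D g _](kmod_addC K) (kmod_addN K) hadd0.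
by rewrite -[u]N E N.
Qed.
End KModuleCancel.

Lemma big_empty_ord (T : Type) (op : T -> T -> T) (idx : T) m (F : 'I_m -> T) :
  m = 0%N -> \big[op/idx]_(i < m) F i = idx.
Proof. by move=> m0; apply: big_pred0 => i; have := ltn_ord i; rewrite {2}m0. Qed.

Section Arrows.
Variables (k : comPzRingType) (C : lincat k).

Definition cast_hom (a a' b b' : obj C) (ea : a = a') (eb : b = b') (f : hom C a b) :
    hom C a' b' :=
  match ea in _ = x, eb in _ = y return hom C x y with erefl, erefl => f end.

Lemma arr_eq_cast a a' b b' (ea : a = a') (eb : b = b') (f : hom C a b) :
  arr_eq (cast_hom ea eb f) f.
Proof. by case: _ / ea; case: _ / eb. Qed.

Lemma arr_eq_sym a b c d (f : hom C a b) (g : hom C c d) : arr_eq f g -> arr_eq g f.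
Proof. exact: esym. Qed.

Lemma arr_eq_trans a b c d a' b' (f : hom C a b) (g : hom C c d) (h : hom C a' b') :
  arr_eq f g -> arr_eq g h -> arr_eq f h.
Proof. exact: etrans. Qed.

Lemma arr_eq_inv a b c d (f : hom C a b) (g : hom C c d) :
  arr_eq f g -> exists (ea : a = c) (eb : b = d), g = cast_hom ea eb f.
Proof.
move=> fg; pose T := {p : obj C * obj C & hom C p.1 p.2}.
pose P (q : T) := exists (ea : a = (projT1 q).1) (eb : b = (projT1 q).2),
  projT2 q = cast_hom ea eb f.
have : P (existT _ (c, d) g) by rewrite -[existT _ _ _]fg; exists erefl, erefl.
by [].
Qed.

Lemma arr_eq_eq a b (f g : hom C a b) : arr_eq f g -> f = g.
Proof.
case/arr_eq_inv=> ea [eb ->].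
by rewrite (Prop_irrelevance ea erefl) (Prop_irrelevance eb erefl).
Qed.

Lemma arr_eq_id a b : a = b -> arr_eq (idm C a) (idm C b).
Proof. by move=> ->. Qed.
Lemma arr_eq_zero a b c d : a = c -> b = d -> arr_eq (hzero C a b) (hzero C c d).
Proof. by move=> -> ->. Qed.

Lemma arr_eq_comp a b c a' b' c' (f : hom C b c) (g : hom C a b) (f' : hom C b' c')
    (g' : hom C a' b') :
  arr_eq f f' -> arr_eq g g' -> arr_eq (hcomp C f g) (hcomp C f' g').
Proof.
case/arr_eq_inv=> eb [ec ->] /arr_eq_inv[ea [eb' ->]]; case: _ / ec; case: _ / ea.
by case: _ / eb eb' => eb'; rewrite (Prop_irrelevance eb' erefl).
Qed.

Lemma arr_eq_add a b a' b' (f g : hom C a b) (f' g' : hom C a' b') :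
  arr_eq f f' -> arr_eq g g' -> arr_eq (hadd C f g) (hadd C f' g').
Proof.
case/arr_eq_inv=> ea [eb ->] /arr_eq_inv[ea' [eb' ->]].
case: _ / ea ea' => ea'; case: _ / eb eb' => eb'.
by rewrite (Prop_irrelevance eb' erefl) (Prop_irrelevance ea' erefl).
Qed.
Lemma arr_eq_opp a b a' b' (f : hom C a b) (f' : hom C a' b') :
  arr_eq f f' -> arr_eq (hopp C f) (hopp C f').
Proof. by case/arr_eq_inv=> ea [eb ->]; case: _ / ea; case: _ / eb. Qed.
Lemma arr_eq_scale a b a' b' x (f : hom C a b) (f' : hom C a' b') :
  arr_eq f f' -> arr_eq (hscale C x f) (hscale C x f').
Proof. by case/arr_eq_inv=> ea [eb ->]; case: _ / ea; case: _ / eb. Qed.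
End Arrows.

Lemma arr_eq_ten (k : comPzRingType) (C : strict_moncat k) (a b c d a' b' c' d' : obj C)
    (f : hom C a b) (g : hom C c d) (f' : hom C a' b') (g' : hom C c' d') :
  arr_eq f f' -> arr_eq g g' -> arr_eq (hten C f g) (hten C f' g').
Proof.
case/arr_eq_inv=> ea [eb ->] /arr_eq_inv[ec [ed ->]].
by case: _ / ea; case: _ / eb; case: _ / ec; case: _ / ed.
Qed.

(** The universal property of a monoidal category given by generators and
   relations.  Tensor products of words have to be transported along the equality
   between the image of a concatenation and the tensor product of the images. *)
Section PresentedFunctor.
Variables (k : comPzRingType) (O : Type) (Gen : seq O -> seq O -> Type).
Variable Rel : forall a b, tm k Gen a b -> tm k Gen a b -> Prop.
Variables (D : strict_moncat k) (F0 : O -> obj D).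

Definition word_obj (w : seq O) : obj D := foldr (fun o => mten D (F0 o)) (munit D) w.

Lemma word_obj_cat a b : word_obj (a ++ b) = mten D (word_obj a) (word_obj b).
Proof. by elim: a => [|o a IH] /=; rewrite ?mten1x // IH mtenA. Qed.

Variable G : forall a b, Gen a b -> hom D (word_obj a) (word_obj b).

Fixpoint interp a b (f : tm k Gen a b) : hom D (word_obj a) (word_obj b) :=
  match f with
  | TmGen _ _ g => G g
  | TmId a => idm D (word_obj a)
  | TmComp _ _ _ f g => hcomp D (interp f) (interp g)
  | TmTen _ _ _ _ f g =>
      cast_hom (esym (word_obj_cat _ _)) (esym (word_obj_cat _ _))
        (hten D (interp f) (interp g))
  | TmZero a b => hzero D (word_obj a) (word_obj b)
  | TmAdd _ _ f g => hadd D (interp f) (interp g)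
  | TmOpp _ _ f => hopp D (interp f)
  | TmScale _ _ x f => hscale D x (interp f)
  end.

Lemma interp_ten a b c d (f : tm k Gen a b) (g : tm k Gen c d) :
  arr_eq (interp (TmTen f g)) (hten D (interp f) (interp g)).
Proof. exact: arr_eq_cast. Qed.

Hypothesis G_rel : forall a b (f g : tm k Gen a b), Rel f g -> interp f = interp g.

Lemma interp_eq a b c d (f : tm k Gen a b) (g : tm k Gen c d) :
  tm_eq Rel f g -> arr_eq (interp f) (interp g).
Proof.
have K x y := hom_kmodule D x y.
have sten a1 b1 c1 d1 (f1 : tm k Gen a1 b1) (g1 : tm k Gen c1 d1) :=
  arr_eq_sym (interp_ten f1 g1).
elim=> {a b c d f g}.
- by move=> a b f g /G_rel ->.
- by [].
- by move=> a b c d f g _; apply: arr_eq_sym.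
- by move=> a b c d a' b' f g h _ h1 _; apply: arr_eq_trans h1.
- by move=> a b c a' b' c' f g f' g' _ h1 _ h2; apply: arr_eq_comp.
- move=> a b c d a' b' c' d' f g f' g' _ h1 _ h2.
  apply: arr_eq_trans (interp_ten _ _) _; apply: arr_eq_trans (sten _ _ _ _ _ _).
  exact: arr_eq_ten.
- by move=> a b a' b' f g f' g' _ h1 _ h2; apply: arr_eq_add.
- by move=> a b a' b' f f' _; apply: arr_eq_opp.
- by move=> a b a' b' x f f' _; apply: arr_eq_scale.
- by move=> a b f g h /=; rewrite (kmod_addA (K _ _)).
- by move=> a b f g /=; rewrite (kmod_addC (K _ _)).
- by move=> a b f /=; rewrite (kmod_add0 (K _ _)).
- by move=> a b f /=; rewrite (kmod_addN (K _ _)).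
- by move=> a b x y f /=; rewrite (kmod_scaleA (K _ _)).
- by move=> a b f /=; rewrite (kmod_scale1 (K _ _)).
- by move=> a b x f g /=; rewrite (kmod_scaleDr (K _ _)).
- by move=> a b x y f /=; rewrite (kmod_scaleDl (K _ _)).
- by move=> a b c d f g h /=; rewrite Defs.compA.
- by move=> a b f /=; rewrite compIm.
- by move=> a b f /=; rewrite compmI.
- by move=> a b c f f' g /=; rewrite compDl.
- by move=> a b c f g g' /=; rewrite compDr.
- by move=> a b c x f g /=; rewrite compZl.
- by move=> a b c x f g /=; rewrite compZr.
- move=> a b; apply: arr_eq_trans (interp_ten _ _) _.
  by rewrite /= hten_id; apply: arr_eq_id; rewrite word_obj_cat.
- move=> a b c a' b' c' f g f' g'; apply: arr_eq_trans (interp_ten _ _) _.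
  by rewrite /= hten_comp; apply: arr_eq_comp; apply: sten.
- move=> a b c d f f' g; apply: arr_eq_trans (interp_ten _ _) _.
  by rewrite /= htenDl; apply: arr_eq_add; apply: sten.
- move=> a b c d f g g'; apply: arr_eq_trans (interp_ten _ _) _.
  by rewrite /= htenDr; apply: arr_eq_add; apply: sten.
- move=> a b c d x f g; apply: arr_eq_trans (interp_ten _ _) _.
  by rewrite /= htenZl; apply: arr_eq_scale; apply: sten.
- move=> a b c d x f g; apply: arr_eq_trans (interp_ten _ _) _.
  by rewrite /= htenZr; apply: arr_eq_scale; apply: sten.
- move=> a b c a' b' c' f g h; apply: arr_eq_trans (interp_ten _ _) _.
  apply: arr_eq_trans (sten _ _ _ _ _ _).
  apply: arr_eq_trans (arr_eq_ten (erefl _) (interp_ten _ _)) _.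
  apply: arr_eq_trans (htenA _ _ _) _.
  exact: arr_eq_ten.
- move=> a b f; apply: arr_eq_trans (interp_ten _ _) _; exact: hten1x.
- move=> a b f; apply: arr_eq_trans (interp_ten _ _) _; exact: htenx1.
Qed.

Definition pres_hom (a b : seq O) (f : hom (pres_cat Rel) a b) :
    hom D (word_obj a) (word_obj b) := interp (tm_rep f).

Lemma pres_homE a b (f : tm k Gen a b) : pres_hom (tm_cls Rel f) = interp f.
Proof. by apply/arr_eq_eq/interp_eq/tm_rep_eq. Qed.

Lemma pres_hom_linfunctor : @is_linfunctor k (pres_cat Rel) D word_obj pres_hom.
Proof.
split=> [a|a b c f g|a b f g|a b x f].
- exact: pres_homE.
- by rewrite [LHS]pres_homE.
- by rewrite [LHS]pres_homE.
- by rewrite [LHS]pres_homE.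
Qed.

Definition pres_linfunctor : linfunctor (pres_cat Rel) D := LinFunctor pres_hom_linfunctor.

Lemma pres_functor_hten a b c d (f : hom (pres_cat Rel) a b) (g : hom (pres_cat Rel) c d) :
  arr_eq (fhom pres_linfunctor (hten (pres_cat Rel) f g))
         (hten D (fhom pres_linfunctor f) (fhom pres_linfunctor g)).
Proof. by rewrite [fhom _ _]pres_homE; apply: interp_ten. Qed.

Definition pres_functor : strict_monfunctor (pres_cat Rel) D :=
  @StrictMonFunctor k (pres_cat Rel) D pres_linfunctor erefl word_obj_cat pres_functor_hten.

End PresentedFunctor.

(** * The inverse of the Mackey map *)

Definition mk_linear (R : pzRingType) (U V : lmodType R) (g : U -> V) (gP : linear g) :
  {linear U -> V} := HB.pack g (GRing.isLinear.Build R U V *:%R g gP).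

Lemma ind_lin_ext (R S : pzRingType) (phi : {rmorphism R -> S}) (M : lmodType R)
    (V : lmodType S) (g h : {linear ind_mod phi M -> V}) :
  (forall s m, g (tpure phi s m) = h (tpure phi s m)) -> forall v, g v = h v.
Proof. by move=> /ind_map_ext ->. Qed.

Section MackeyInverse.
Variables (k : comPzRingType) (z : k) (l : nat) (f : 'I_l.+1 -> k) (f_inv : k).
Hypotheses (f0 : f ord0 = 1) (f_invK : f ord_max * f_inv = 1).

Local Notation A := (cyc_hecke z f).
Local Notation iota n := (H_incl z f n).
Local Notation HT := (cyc_tower z f0 f_invK).
Local Notation mackey := (mackey f0 f_invK).

Lemma mackey_scale n (M : lmodType (A n)) (w : indres M) (m : 'I_l -> M) a :
  iota n a *: mackey w m = mackey (a *: w) (fun i => a *: m i).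
Proof.
rewrite !mackeyE scalerDr (linearZZ (sigma f0 f_invK M)); congr (_ + _).
rewrite scaler_sumr; apply: eq_bigr => i _.
by rewrite tpureZ -(Xn_comm HT) tpure_bal.
Qed.

Definition indres_map n : forall M N : lmodType (A n), {linear M -> N} ->
    {linear indres M -> indres N} :=
  match n return forall M N : lmodType (A n), {linear M -> N} ->
    {linear indres M -> indres N} with
  | 0 => fun _ _ _ => idfun
  | m.+1 => fun M N g => ind_map (iota m) (res_map (iota m) g)
  end.

Lemma mackey_natural n (M N : lmodType (A n)) (g : {linear M -> N}) (w : indres M)
    (m : 'I_l -> M) :
  ind_map (iota n) g (mackey w m) = mackey (indres_map g w) (g \o m).
Proof.
rewrite !mackeyE linearD linear_sum; congr (_ + _); last first.
  by apply: eq_bigr => i _; rewrite ind_map_pure.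
case: n M N g w m => [|n] M N g w m; first exact: linear0.
elim/tensor_ind: w => [u v||u v hu hv|u hu].
- rewrite [sigma _ _ _ _]sigma_succ_pure ind_map_pure [indres_map _ _]ind_map_pure.
  by rewrite [RHS]sigma_succ_pure.
- by rewrite !linear0.
- by rewrite (linearD (sigma f0 f_invK M)) linearD hu hv (linearD (indres_map g)) linearD.
- by rewrite (linearN (sigma f0 f_invK M)) linearN hu (linearN (indres_map g)) linearN.
Qed.

Section Inverse.
Variables (n : nat) (M : lmodType (A n)).

Definition mackey_w_fun (v : res_mod (iota n) (ind_mod (iota n) M)) : indres M :=
  sval (cid (mackey_surj f0 f_invK v)).
Definition mackey_m_fun (a : 'I_l) (v : res_mod (iota n) (ind_mod (iota n) M)) : M :=
  sval (cid (svalP (cid (mackey_surj f0 f_invK v)))) a.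

Lemma mackey_invK v : mackey (mackey_w_fun v) (fun a => mackey_m_fun a v) = v.
Proof. exact: esym (svalP (cid (svalP (cid (mackey_surj f0 f_invK v))))). Qed.

Lemma mackey_wK w m : mackey_w_fun (mackey w m) = w.
Proof. by have [] := mackey_inj (mackey_invK (mackey w m)). Qed.
Lemma mackey_mK w m a : mackey_m_fun a (mackey w m) = m a.
Proof. by have [_ ->] := mackey_inj (mackey_invK (mackey w m)). Qed.

Lemma mackey_w_linear : linear mackey_w_fun.
Proof.
move=> a u v; have : (a *: u + v : res_mod _ _) =
    mackey (a *: mackey_w_fun u + mackey_w_fun v)
      (fun i => a *: mackey_m_fun i u + mackey_m_fun i v).
  by rewrite -mackey_add -mackey_scale !mackey_invK.
by move=> ->; rewrite mackey_wK.
Qed.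
Lemma mackey_m_linear i : linear (mackey_m_fun i).
Proof.
move=> a u v; have : (a *: u + v : res_mod _ _) =
    mackey (a *: mackey_w_fun u + mackey_w_fun v)
      (fun i => a *: mackey_m_fun i u + mackey_m_fun i v).
  by rewrite -mackey_add -mackey_scale !mackey_invK.
by move=> ->; rewrite mackey_mK.
Qed.

(** The index is not bounded by l in its type, as the generators eps_a are indexed by a
   set whose size is only propositionally equal to l. *)
Definition mackey_w : {linear res_mod (iota n) (ind_mod (iota n) M) -> indres M} :=
  mk_linear mackey_w_linear.
Definition mackey_m (a : nat) : {linear res_mod (iota n) (ind_mod (iota n) M) -> M} :=
  if insub a is Some i then mk_linear (mackey_m_linear i) else \0.
End Inverse.

Lemma mackey_wE n (M : lmodType (A n)) w m : mackey_w M (mackey w m) = w.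
Proof. exact: mackey_wK. Qed.
Lemma mackey_mE n (M : lmodType (A n)) (a : 'I_l) w m : mackey_m M a (mackey w m) = m a.
Proof. by rewrite /mackey_m valK; apply: mackey_mK. Qed.

Lemma mackey_w_natural n (M N : lmodType (A n)) (g : {linear M -> N})
    (v : ind_mod (iota n) M) :
  mackey_w N (ind_map (iota n) g v) = indres_map g (mackey_w M v).
Proof.
by have [w [m ->]] := mackey_surj f0 f_invK v; rewrite mackey_natural !mackey_wE.
Qed.
Lemma mackey_m_natural n (M N : lmodType (A n)) (g : {linear M -> N}) a
    (v : ind_mod (iota n) M) :
  mackey_m N a (ind_map (iota n) g v) = g (mackey_m M a v).
Proof.
have [w [m ->]] := mackey_surj f0 f_invK v; rewrite mackey_natural.
rewrite /mackey_m; case: insub => [i|]; last by rewrite linear0.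
by rewrite [LHS]mackey_mK [X in g X]mackey_mK.
Qed.

End MackeyInverse.

(** * The natural transformations attached to the generators *)

Section Generators.
Variables (k : comPzRingType) (z : k) (l : nat) (f : 'I_l.+1 -> k) (f_inv : k).
Hypotheses (f0 : f ord0 = 1) (f_invK : f ord_max * f_inv = 1).

Local Notation A := (cyc_hecke z f).
Local Notation iota n := (H_incl z f n).
Local Notation T_ := (T_ z f).
Local Notation HT := (cyc_tower z f0 f_invK).
Local Notation C := (Hmod z f).
Local Notation gmodule := (graded_mod A).
Local Notation Ind := (HInd z f).
Local Notation Res := (HRes z f).

(** In degree 0 the source vanishes. *)
Lemma gr_ind_ext (M N : gmodule) (g h : hom C (Ind M) N) :
  (forall n s m, g n.+1 (tpure (iota n) s m) = h n.+1 (tpure (iota n) s m)) -> g = h.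
Proof.
move=> gh; apply: functional_extensionality_dep => -[|n].
  by apply: linear_ext => v; rewrite [v]thinmx0 !linear0.
exact: ind_map_ext.
Qed.

Lemma tpure_unit n (M : lmodType (A n)) u (m : M) :
  tpure (iota n) u m = u *: (tpure (iota n) 1 m : ind_mod (iota n) M).
Proof. by rewrite tpureZ mulr1. Qed.

(** In degree 1 too the source vanishes, as ind_0^1 is applied to 0.  In higher degrees
   the left tensor factor absorbs the right one. *)
Lemma gr_indind_ext (M N : gmodule) (g h : hom C (Ind (Ind M)) N) :
  (forall n s m, g n.+2 (tpure (iota n.+1) s (tpure (iota n) 1 m : Ind M n.+1))
               = h n.+2 (tpure (iota n.+1) s (tpure (iota n) 1 m : Ind M n.+1))) -> g = h.
Proof.
move=> gh; apply: gr_ind_ext => -[|n] s v.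
  by rewrite [v]thinmx0 tpure0r !linear0.
elim/tensor_ind: v => [u m||u v hu hv|u hu].
- have E : tpure (iota n) u m = u *: (tpure (iota n) 1 m : ind_mod _ _).
    by rewrite tpureZ mulr1.
  by rewrite E -tpure_bal gh.
- by rewrite tpure0r !linear0.
- by rewrite tpureDr !linearD hu hv.
- by rewrite tpureNr !linearN hu.
Qed.

Lemma gr_ind3_ext (M N : gmodule) (g h : hom C (Ind (Ind (Ind M))) N) :
  (forall n s m,
     g n.+3 (tpure (iota n.+2) s (tpure (iota n.+1) 1 (tpure (iota n) 1 m : Ind M n.+1) : Ind (Ind M) n.+2))
   = h n.+3 (tpure (iota n.+2) s (tpure (iota n.+1) 1 (tpure (iota n) 1 m : Ind M n.+1) : Ind (Ind M) n.+2))) ->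
  g = h.
Proof.
move=> gh; apply: (gr_indind_ext (M := Ind M)) => -[|n] s v.
  by rewrite [v]thinmx0 tpure0r tpure0r !linear0.
elim/tensor_ind: v => [u m||u v hu hv|u hu].
- rewrite (tpure_unit u m) -tpure_bal mul1r (tpure_unit (iota n.+1 u)) -tpure_bal.
  exact: gh.
- by rewrite tpure0r tpure0r !linear0.
- by rewrite !tpureDr !linearD hu hv.
- by rewrite !tpureNr !linearN hu.
Qed.

Section RightMul.
Variables (n : nat) (y : A n.+1).
Hypothesis yc : forall u, GRing.comm y (iota n u).
Variable M : lmodType (A n).

Lemma rmul_unit_linear :
  linear (fun m : M => tpure (iota n) y m : res_mod (iota n) (ind_mod (iota n) M)).
Proof.
by move=> a u v; rewrite tpureDr -tpure_bal yc -tpureZ.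
Qed.
Definition rmul : {linear ind_mod (iota n) M -> ind_mod (iota n) M} :=
  ind_lift (mk_linear rmul_unit_linear).
Lemma rmul_pure u m : rmul (tpure (iota n) u m) = tpure (iota n) (u * y) m.
Proof. by rewrite [LHS]ind_lift_pure [LHS]tpureZ. Qed.
End RightMul.

Section NatRightMul.
Variable y : forall n, A n.+1.
Hypothesis yc : forall n u, GRing.comm (y n) (iota n u).

Definition rmul_gr (M : gmodule) : hom C (Ind M) (Ind M) :=
  fun n => match n return {linear Ind M n -> Ind M n} with
  | 0 => idfun
  | m.+1 => rmul (@yc m) (M m)
  end.
Lemma rmul_natural : @is_natural k C C Ind Ind rmul_gr.
Proof.
move=> M N g; apply: gr_ind_ext => n s m.
by rewrite /= ind_map_pure !rmul_pure ind_map_pure.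
Qed.
Definition nat_rmul : nattrans Ind Ind := NatTrans rmul_natural.
End NatRightMul.

Definition XV_ n : A n.+1 := gxV z f n.+1 n.

Lemma XV_comm n u : GRing.comm (XV_ n) (iota n u).
Proof.
have [h1 h2] := @gxVK k z l f n.+1 n (ltnSn n).
have E (B : pzRingType) (x x' y : B) : x * x' = 1 -> x' * x = 1 -> x * y = y * x ->
    GRing.comm x' y.
  move=> e1 e2 xy; rewrite /GRing.comm -[x' * y]mulr1 -e1 mulrA -(mulrA x' y x) -xy.
  by rewrite mulrA e2 mul1r.
exact: E h1 h2 (tw_X HT u).
Qed.

Definition nat_x : nattrans Ind Ind := nat_rmul (tw_X HT).
Definition nat_xinv : nattrans Ind Ind := nat_rmul XV_comm.

Section Tau.
Variables (n : nat) (M : lmodType (A n)).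
Local Notation II := (ind_mod (iota n.+1) (ind_mod (iota n) M)).

Lemma tau_unit_linear : linear (fun m : M =>
  tpure (iota n.+1) (T_ n.+1) (tpure (iota n) 1 m)
    : res_mod (iota n) (res_mod (iota n.+1) II)).
Proof.
move=> a u v; rewrite !tpureDr -[tpure _ 1 (a *: u)]tpure_bal mul1r; congr (_ + _).
have -> : tpure (iota n) (iota n a) u = iota n a *: (tpure (iota n) 1 u : ind_mod _ _).
  by rewrite tpureZ mulr1.
by rewrite -tpure_bal (tw_T HT) -tpureZ.
Qed.
Definition tau_map : {linear II -> II} :=
  ind_lift (ind_lift (V := res_mod (iota n.+1) II) (mk_linear tau_unit_linear)).
Lemma tau_map_pure u w m :
  tau_map (tpure (iota n.+1) u (tpure (iota n) w m))
  = tpure (iota n.+1) (u * iota n.+1 w * T_ n.+1) (tpure (iota n) 1 m).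
Proof.
by rewrite [LHS]ind_lift_pure [X in _ *: X]ind_lift_pure [X in _ *: X]tpureZ [LHS]tpureZ mulrA.
Qed.
End Tau.

Definition tau_gr (M : gmodule) : hom C (Ind (Ind M)) (Ind (Ind M)) :=
  fun n => match n return {linear Ind (Ind M) n -> Ind (Ind M) n} with
  | m.+2 => tau_map (M m)
  | _ => idfun
  end.
Lemma tau_natural : @is_natural k C C (comp_functor Ind Ind) (comp_functor Ind Ind) tau_gr.
Proof.
move=> M N g; apply: gr_indind_ext => n s m.
rewrite /= ind_map_pure [ind_map _ _ (tpure _ 1 _)]ind_map_pure.
by rewrite !tau_map_pure ind_map_pure ind_map_pure.
Qed.
Definition nat_tau : nattrans (comp_functor Ind Ind) (comp_functor Ind Ind) :=
  NatTrans tau_natural.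

Definition c_gr (M : gmodule) : hom C M (Res (Ind M)) := fun n => ind_unit (iota n) (M n).
Lemma c_natural : @is_natural k C C (id_functor C) (comp_functor Res Ind) c_gr.
Proof. by move=> M N g; apply: gr_ext => n v; rewrite [RHS]ind_map_pure. Qed.
Definition nat_c : nattrans (id_functor C) (comp_functor Res Ind) := NatTrans c_natural.

Definition d_gr (M : gmodule) : hom C (Ind (Res M)) M :=
  fun n => match n return {linear Ind (Res M) n -> M n} with
  | 0 => \0
  | m.+1 => ind_lift (idfun : {linear res_mod (iota m) (M m.+1) -> res_mod (iota m) (M m.+1)})
  end.
Lemma d_gr_pure (M : gmodule) n u (v : M n.+1) :
  d_gr M n.+1 (tpure (iota n) u (v : res_mod (iota n) (M n.+1))) = u *: v.
Proof. exact: ind_lift_pure. Qed.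
Lemma d_natural : @is_natural k C C (comp_functor Ind Res) (id_functor C) d_gr.
Proof.
move=> M N g; apply: gr_ind_ext => n s m.
by rewrite /= ind_map_pure [LHS]d_gr_pure [ind_lift _ _]d_gr_pure linearZZ.
Qed.
Definition nat_d : nattrans (comp_functor Ind Res) (id_functor C) := NatTrans d_natural.

Definition L_gr (M : gmodule) : hom C (Res (Ind M)) (Ind (Res M)) :=
  (* Ind (Res M) n is convertible to [indres] only when n is a constructor. *)
  fun n => match n return {linear Res (Ind M) n -> Ind (Res M) n} with
  | 0 => mackey_w f0 f_invK (M 0)
  | m.+1 => mackey_w f0 f_invK (M m.+1)
  end.
Lemma L_natural : @is_natural k C C (comp_functor Res Ind) (comp_functor Ind Res) L_gr.
Proof.
by move=> M N g; apply: gr_ext => -[|n] v; apply: mackey_w_natural.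
Qed.
Definition nat_L : nattrans (comp_functor Res Ind) (comp_functor Ind Res) := NatTrans L_natural.

Definition eps_gr (a : nat) (M : gmodule) : hom C (Res (Ind M)) M :=
  fun n => mackey_m f0 f_invK (M n) a.
Lemma eps_natural a : @is_natural k C C (comp_functor Res Ind) (id_functor C) (eps_gr a).
Proof. by move=> M N g; apply: gr_ext => n v; apply: mackey_m_natural. Qed.
Definition nat_eps a : nattrans (comp_functor Res Ind) (id_functor C) := NatTrans (eps_natural a).

End Generators.

(** * The defining relations of the Heisenberg category *)

Section Relations.
Variables (k : comPzRingType) (z t : ring_unit k) (l : nat) (f : 'I_l.+1 -> k).
Hypotheses (f0 : f ord0 = 1) (fl : f ord_max = uval t ^+ 2).
Variable c : int.
Hypotheses (cpos : pos_part c = 0%N) (cneg : neg_part c = l).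

Lemma f_last_unit : f ord_max * uinv t ^+ 2 = 1.
Proof. by rewrite fl -exprMn uvalK expr1n. Qed.
Local Notation fK := f_last_unit.

Local Notation A := (cyc_hecke z f).
Local Notation iota n := (H_incl z f n).
Local Notation X_ := (X_ z f).
Local Notation T_ := (T_ z f).
Local Notation HT := (cyc_tower z f0 fK).
Local Notation C := (Hmod z f).
Local Notation D := (End_cat C).
Local Notation gmodule := (graded_mod A).
Local Notation Ind := (HInd z f).
Local Notation Res := (HRes z f).
Local Notation mackey := (mackey f0 fK).

Definition dir_obj (d : dir) : obj D := if d is Up then Ind else Res.
Local Notation W := (word_obj (D := D) dir_obj).

(** The transformations have to be retyped, because the functor attached to a word
   of length one is only propositionally equal to Ind or Res.  There are no
   generators eta_a for c <= 0. *)
Definition gen_nat a b (g : heis_gen c a b) : hom D (W a) (W b) :=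
  match g in heis_gen _ a b return hom D (W a) (W b) with
  | Gx => @NatTrans k C C (W [:: Up]) (W [:: Up]) (nat_x z f0 fK) (nattransP (nat_x z f0 fK))
  | Gxinv => @NatTrans k C C (W [:: Up]) (W [:: Up])
      (nat_xinv z f0 fK) (nattransP (nat_xinv z f0 fK))
  | Gtau => @NatTrans k C C (W [:: Up; Up]) (W [:: Up; Up])
      (nat_tau z f0 fK) (nattransP (nat_tau z f0 fK))
  | Gc => @NatTrans k C C (W [::]) (W [:: Down; Up]) (nat_c z f) (nattransP (nat_c z f))
  | Gd => @NatTrans k C C (W [:: Up; Down]) (W [::]) (nat_d z f) (nattransP (nat_d z f))
  | GL => @NatTrans k C C (W [:: Down; Up]) (W [:: Up; Down])
      (nat_L z f0 fK) (nattransP (nat_L z f0 fK))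
  | Geta _ => hzero D (W [::]) (W [:: Up; Down])
  | Geps a => @NatTrans k C C (W [:: Down; Up]) (W [::])
      (nat_eps z f0 fK a) (nattransP (nat_eps z f0 fK a))
  end.

Local Notation I := (interp gen_nat).
Local Notation term := (tm k (heis_gen c)).

Lemma arr_eq_app (F G F' G' : linfunctor C C) (n : nattrans F G) (m : nattrans F' G') :
  arr_eq (C := D) n m -> forall M, arr_eq (C := C) (n M) (m M).
Proof.
by case/arr_eq_inv=> eF [eG ->] M; case: _ / eF; case: _ / eG.
Qed.

Lemma interp_ten_app a b a' b' (g : term a b) (h : term a' b') M :
  arr_eq (C := C) ((I (TmTen g h) : nattrans _ _) M)
    (hcomp C ((I g : nattrans _ _) ((W b' : linfunctor _ _) M))
             (fhom (W a : linfunctor _ _) ((I h : nattrans _ _) M))).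
Proof. exact: (arr_eq_app (interp_ten gen_nat g h)). Qed.

Lemma interp_whisker_l a a' b' (h : term a' b') M :
  arr_eq (C := C) ((I (TmTen (TmId k (heis_gen c) a) h) : nattrans _ _) M)
    (fhom (W a : linfunctor _ _) ((I h : nattrans _ _) M)).
Proof.
apply: arr_eq_trans (interp_ten_app _ _ _) _.
by apply: (f_equal (fun x => existT _ (_, _) x)); apply: Defs.compIm.
Qed.

Lemma interp_whisker_r a b a' (g : term a b) M :
  arr_eq (C := C) ((I (TmTen g (TmId k (heis_gen c) a')) : nattrans _ _) M)
    ((I g : nattrans _ _) ((W a' : linfunctor _ _) M)).
Proof.
apply: arr_eq_trans (interp_ten_app _ _ _) _.
apply: (f_equal (fun x => existT _ (_, _) x)).
by rewrite -[RHS](Defs.compmI); congr (hcomp C _ _); apply: (fun_id (linfunctorP (W a : linfunctor _ _))).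
Qed.

Lemma interp_id a b M :
  arr_eq (C := C) ((I (TmTen (TmId k (heis_gen c) a) (TmId k (heis_gen c) b)) : nattrans _ _) M)
    (idm C ((W (a ++ b) : linfunctor _ _) M)).
Proof.
apply: arr_eq_trans (interp_whisker_r _ _ _) _.
by rewrite /= word_obj_cat.
Qed.

Local Notation hx := (TmGen k (Gx c)).
Local Notation htau := (TmGen k (Gtau c)).
Local Notation hc := (TmGen k (Gc c)).
Local Notation hd := (TmGen k (Gd c)).
Local Notation up := (TmId k (heis_gen c) [:: Up]).
Local Notation down := (TmId k (heis_gen c) [:: Down]).
Local Notation app g M := ((I g : nattrans _ _) M).

Variable M : gmodule.

Lemma interp_up_x : app (TmTen up hx) M = fhom Ind (nat_x z f0 fK M) :> hom C (Ind (Ind M)) (Ind (Ind M)).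
Proof. exact: (arr_eq_eq (interp_whisker_l [:: Up] hx M)). Qed.
Lemma interp_x_up : app (TmTen hx up) M = nat_x z f0 fK (Ind M) :> hom C (Ind (Ind M)) (Ind (Ind M)).
Proof. exact: (arr_eq_eq (interp_whisker_r [:: Up] hx M)). Qed.
Lemma interp_up_tau : app (TmTen up htau) M = fhom Ind (nat_tau z f0 fK M)
  :> hom C (Ind (Ind (Ind M))) (Ind (Ind (Ind M))).
Proof. exact: (arr_eq_eq (interp_whisker_l [:: Up] htau M)). Qed.
Lemma interp_tau_up : app (TmTen htau up) M = nat_tau z f0 fK (Ind M)
  :> hom C (Ind (Ind (Ind M))) (Ind (Ind (Ind M))).
Proof. exact: (arr_eq_eq (interp_whisker_r [:: Up] htau M)). Qed.
Lemma interp_up_c : app (TmTen up hc) M = fhom Ind (nat_c z f M)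
  :> hom C (Ind M) (Ind (Res (Ind M))).
Proof. exact: (arr_eq_eq (interp_whisker_l [:: Up] hc M)). Qed.
Lemma interp_d_up : app (TmTen hd up) M = nat_d z f (Ind M)
  :> hom C (Ind (Res (Ind M))) (Ind M).
Proof. exact: (arr_eq_eq (interp_whisker_r [:: Up] hd M)). Qed.
Lemma interp_c_down : app (TmTen hc down) M = nat_c z f (Res M)
  :> hom C (Res M) (Res (Ind (Res M))).
Proof. exact: (arr_eq_eq (interp_whisker_r [:: Down] hc M)). Qed.
Lemma interp_down_d : app (TmTen down hd) M = fhom Res (nat_d z f M)
  :> hom C (Res (Ind (Res M))) (Res M).
Proof. exact: (arr_eq_eq (interp_whisker_l [:: Down] hd M)). Qed.

Lemma interp_sigma : app (sigma_plus k c) M =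
  hcomp C (fhom Res (fhom Ind (nat_d z f M)))
    (hcomp C (fhom Res (nat_tau z f0 fK (Res M))) (nat_c z f (Ind (Res M))))
  :> hom C (Ind (Res M)) (Res (Ind M)).
Proof.
have E1 : app (TmTen (TmTen down up) hd) M = fhom Res (fhom Ind (nat_d z f M))
    :> hom C (Res (Ind (Ind (Res M)))) (Res (Ind M)).
  apply: arr_eq_eq; apply: arr_eq_trans (interp_ten_app (TmTen down up) hd M) _.
  have E := arr_eq_eq (interp_id [:: Down] [:: Up] M).
  apply: (f_equal (fun x => existT _ (_, _) x)).
  exact: (etrans (f_equal (fun y => hcomp C y _) E) (Defs.compIm _)).
have E2 : app (TmTen (TmTen down htau) down) M = fhom Res (nat_tau z f0 fK (Res M))
    :> hom C (Res (Ind (Ind (Res M)))) (Res (Ind (Ind (Res M)))).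
  apply: arr_eq_eq; apply: arr_eq_trans (interp_whisker_r [:: Down] (TmTen down htau) M) _.
  exact: (interp_whisker_l [:: Down] htau (Res M)).
have E3 : app (TmTen (TmTen hc up) down) M = nat_c z f (Ind (Res M))
    :> hom C (Ind (Res M)) (Res (Ind (Ind (Res M)))).
  apply: arr_eq_eq; apply: arr_eq_trans (interp_whisker_r [:: Down] (TmTen hc up) M) _.
  exact: (interp_whisker_r [:: Up] hc (Res M)).
exact: (f_equal2 (fun a b => hcomp C a b) E1 (f_equal2 (fun a b => hcomp C a b) E2 E3)).
Qed.

Lemma sigma_val n w : (app (sigma_plus k c) M : hom C (Ind (Res M)) (Res (Ind M))) n.+1 w
  = sigma_succ f0 fK (M n.+1) w.
Proof.
rewrite interp_sigma; set g : hom C (Ind (Res M)) (Res (Ind M)) := hcomp C _ _.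
move: w; apply: (ind_lin_ext (g := g n.+1) (h := sigma_succ f0 fK (M n.+1))) => u v.
rewrite sigma_succ_pure -[LHS]/(ind_map _ (d_gr (f := f) M n.+1)
  (tau_map f0 fK _ (tpure _ 1 (tpure _ u v)))).
by rewrite tau_map_pure ind_map_pure d_gr_pure mul1r scale1r.
Qed.

Lemma xpow_val a n (u : A n.+1) (m : M n) :
  (app (xpow k c a) M : hom C (Ind M) (Ind M)) n.+1 (tpure (iota n) u m)
  = tpure (iota n) (u * X_ n ^+ a) m.
Proof.
elim: a u => [|a IH] u /=; first by rewrite expr0 mulr1.
by rewrite [X in rmul _ _ X]IH rmul_pure -mulrA -exprSr.
Qed.

Lemma interp_cup a : app (dot_cup k c a) M =
   hcomp C (fhom Res (app (xpow k c a) M : hom C (Ind M) (Ind M))) (nat_c z f M)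
   :> hom C M (Res (Ind M)).
Proof.
exact: (f_equal (fun y => hcomp C y _)
  (arr_eq_eq (interp_whisker_l [:: Down] (xpow k c a) M))).
Qed.

Lemma cup_val a n (m : M n) :
  (app (dot_cup k c a) M : hom C M (Res (Ind M))) n m = tpure (iota n) (X_ n ^+ a) m.
Proof. by rewrite interp_cup [LHS]xpow_val mul1r. Qed.

Notation val g N P := ((I g : nattrans _ _) M : hom C N P).

Lemma rel_xxinv : app (TmComp hx (TmGen k (Gxinv c))) M = app up M.
Proof.
apply: (gr_ind_ext (M := M) (N := Ind M)) => n s m.
have [_ h] := @gxVK k z l f n.+1 n (ltnSn n).
suff E : rmul (fun u => tw_X HT u) _ (rmul (fun u => XV_comm f0 fK u) _
    (tpure (iota n) s m)) = tpure (iota n) s m.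
  exact: E.
by rewrite !rmul_pure -mulrA [XV_ _ _ _ * _]h mulr1.
Qed.

Lemma rel_xinvx : app (TmComp (TmGen k (Gxinv c)) hx) M = app up M.
Proof.
apply: (gr_ind_ext (M := M) (N := Ind M)) => n s m.
have [h _] := @gxVK k z l f n.+1 n (ltnSn n).
suff E : rmul (fun u => XV_comm f0 fK u) _ (rmul (fun u => tw_X HT u) _
    (tpure (iota n) s m)) = tpure (iota n) s m.
  exact: E.
by rewrite !rmul_pure -mulrA [_ * XV_ _ _ _]h mulr1.
Qed.

Lemma rel_slide :
  app (TmComp htau (TmComp (TmTen up hx) htau)) M = app (TmTen hx up) M.
Proof.
rewrite [RHS]interp_x_up.
apply: (gr_indind_ext (M := M) (N := Ind (Ind M))) => n s m.
rewrite -[LHS]/(tau_map f0 fK _ (val (TmTen up hx) (Ind (Ind M)) (Ind (Ind M)) n.+2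
  (tau_map f0 fK _ (tpure (iota n.+1) s (tpure (iota n) 1 m))))).
rewrite interp_up_x tau_map_pure rmorph1 mulr1.
rewrite [X in tau_map _ _ _ X]ind_map_pure [X in tpure _ _ X]rmul_pure tau_map_pure mul1r.
by rewrite [RHS]rmul_pure (tw_XE HT) !mulrA.
Qed.

Lemma rel_quad : app (TmComp htau htau) M =
  app (TmAdd (TmScale (uval z) htau) (TmId k (heis_gen c) [:: Up; Up])) M.
Proof.
apply: (gr_indind_ext (M := M) (N := Ind (Ind M))) => n s m.
rewrite -[LHS]/(tau_map f0 fK _ (tau_map f0 fK _ (tpure (iota n.+1) s (tpure (iota n) 1 m)))).
rewrite -[RHS]/(scal (A n.+2) (uval z) *: (tau_map f0 fK _ (tpure (iota n.+1) s (tpure (iota n) 1 m))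
  : ind_mod _ _) + tpure (iota n.+1) s (tpure (iota n) 1 m)).
rewrite !tau_map_pure !rmorph1 !mulr1 -mulrA (tw_quad HT) mulrDr mulr1 tpureDl.
by rewrite tpureZ !mulrA scal_central.
Qed.

Lemma rel_braid :
  app (TmComp (TmTen htau up) (TmComp (TmTen up htau) (TmTen htau up))) M
  = app (TmComp (TmTen up htau) (TmComp (TmTen htau up) (TmTen up htau))) M.
Proof.
pose a : hom C (Ind (Ind (Ind M))) (Ind (Ind (Ind M))) := nat_tau z f0 fK (Ind M).
pose b : hom C (Ind (Ind (Ind M))) (Ind (Ind (Ind M))) := fhom Ind (nat_tau z f0 fK M).
have E : hcomp C a (hcomp C b a) = hcomp C b (hcomp C a b).
  apply: (gr_ind3_ext (M := M) (N := Ind (Ind (Ind M)))) => n s m.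
  pose e s := tpure (iota n.+2) s (tpure (iota n.+1) 1 (tpure (iota n) 1 m)).
  have aE u : a n.+3 (e u) = e (u * T_ n.+2).
    by rewrite [LHS]tau_map_pure rmorph1 mulr1.
  have bE u : b n.+3 (e u) = e (u * iota n.+2 (T_ n.+1)).
    rewrite [LHS]ind_map_pure [X in tpure _ _ X]tau_map_pure.
    by rewrite rmorph1 !mul1r (tpure_unit (T_ n.+1)) -tpure_bal.
  have aba : a n.+3 (b n.+3 (a n.+3 (e s))) = e (s * T_ n.+2 * iota n.+2 (T_ n.+1) * T_ n.+2).
    exact: (etrans (f_equal (fun v => a n.+3 (b n.+3 v)) (aE _))
      (etrans (f_equal (fun v => a n.+3 v) (bE _)) (aE _))).
  have bab : b n.+3 (a n.+3 (b n.+3 (e s))) =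
      e (s * iota n.+2 (T_ n.+1) * T_ n.+2 * iota n.+2 (T_ n.+1)).
    exact: (etrans (f_equal (fun v => b n.+3 (a n.+3 v)) (bE _))
      (etrans (f_equal (fun v => b n.+3 v) (aE _)) (bE _))).
  have br : s * T_ n.+2 * iota n.+2 (T_ n.+1) * T_ n.+2
      = s * iota n.+2 (T_ n.+1) * T_ n.+2 * iota n.+2 (T_ n.+1).
    have gen (B : pzRingType) (u x y : B) : x * y * x = y * x * y -> u * x * y * x = u * y * x * y.
      by move=> E; rewrite -!mulrA (mulrA x) E !mulrA.
    exact: gen (tw_braid HT n).
  exact: (etrans aba (etrans (f_equal e br) (esym bab))).
have Ea := interp_tau_up; have Eb := interp_up_tau.
pose h (x y : hom C (Ind (Ind (Ind M))) (Ind (Ind (Ind M)))) := hcomp C x y.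
exact: (etrans (f_equal2 h Ea (f_equal2 h Eb Ea))
  (etrans E (esym (f_equal2 h Eb (f_equal2 h Ea Eb))))).
Qed.

Lemma rel_zigzag_up : app (TmComp (TmTen hd up) (TmTen up hc)) M = app up M.
Proof.
pose d : hom C (Ind (Res (Ind M))) (Ind M) := nat_d z f (Ind M).
pose u : hom C (Ind M) (Ind (Res (Ind M))) := fhom Ind (nat_c z f M).
have E : hcomp C d u = idm C (Ind M).
  apply: (gr_ind_ext (M := M) (N := Ind M)) => n s m.
  have uE : u n.+1 (tpure (iota n) s m) = tpure (iota n) s _ := ind_map_pure _ _ _ _.
  have dE := d_gr_pure (M := Ind M) s (tpure (iota n) 1 m : Ind M n.+1).
  exact: (etrans (f_equal (d n.+1) uE) (etrans dE (esym (tpure_unit _ _)))).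
pose h (x : hom C (Ind (Res (Ind M))) (Ind M)) (y : hom C (Ind M) (Ind (Res (Ind M)))) :=
  hcomp C x y.
exact: (etrans (f_equal2 h interp_d_up interp_up_c) E).
Qed.

Lemma rel_zigzag_down : app (TmComp (TmTen down hd) (TmTen hc down)) M = app down M.
Proof.
pose d : hom C (Res (Ind (Res M))) (Res M) := fhom Res (nat_d z f M).
pose u : hom C (Res M) (Res (Ind (Res M))) := nat_c z f (Res M).
have E : hcomp C d u = idm C (Res M).
  apply: (gr_ext (M := Res M) (N := Res M)) => n v.
  exact: (etrans (d_gr_pure (1 : A n.+1) (v : M n.+1)) (scale1r (v : M n.+1))).
pose h (x : hom C (Res (Ind (Res M))) (Res M)) (y : hom C (Res M) (Res (Ind (Res M)))) :=
  hcomp C x y.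
exact: (etrans (f_equal2 h interp_down_d interp_c_down) E).
Qed.

Local Notation S := (val (sigma_plus k c) (Ind (Res M)) (Res (Ind M))).
Local Notation L := (val (TmGen k (GL c)) (Res (Ind M)) (Ind (Res M))).
Local Notation cup a := (val (dot_cup k c a) M (Res (Ind M))).
Local Notation eps a := (val (TmGen k (@Geps c a)) (Res (Ind M)) M).

(** In degree 0 both sigma and the first component of [mackey] live on zero objects,
   which is why the two cases are separate. *)
Lemma row_mackey_succ n w (m : 'I_l -> M n.+1) :
  (S n.+1 w : ind_mod (iota n.+1) (M n.+1)) + \sum_(a < l) (cup a n.+1 (m a) : ind_mod _ _)
  = mackey (w : indres (M n.+1)) m.
Proof.
rewrite sigma_val; congr (_ + _); apply: eq_bigr => a _; exact: cup_val.
Qed.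
Lemma row_mackey0 w (m : 'I_l -> M 0%N) :
  (S 0%N w : ind_mod (iota 0) (M 0)) + \sum_(a < l) (cup a 0%N (m a) : ind_mod _ _)
  = mackey (w : indres (M 0%N)) m.
Proof.
rewrite [w]thinmx0 (linear0 (S 0%N)); congr (_ + _); apply: eq_bigr => a _; exact: cup_val.
Qed.

Lemma L_row n (w : Ind (Res M) n) (m : 'I_l -> M n) :
  L n (S n w + \sum_(a < l) cup a n (m a)) = w.
Proof.
case: n w m => [|n] w m.
  by rewrite [w]thinmx0; apply: thinmx0.
exact: (etrans (f_equal (L n.+1) (row_mackey_succ w m)) (mackey_wE _ _ _ _)).
Qed.

Lemma eps_row (a : 'I_(neg_part c)) (b : 'I_l) n (w : Ind (Res M) n) (m : 'I_l -> M n) :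
  a = b :> nat -> eps a n (S n w + \sum_(a < l) cup a n (m a)) = m b.
Proof.
have eE n' v : eps a n' v = mackey_m f0 fK (M n') a v by [].
move=> ab; rewrite eE ab; case: n w m => [|n] w m.
  exact: (etrans (f_equal (mackey_m f0 fK (M 0%N) b) (row_mackey0 w m)) (mackey_mE _ _ _ _ _)).
exact: (etrans (f_equal (mackey_m f0 fK (M n.+1) b) (row_mackey_succ w m)) (mackey_mE _ _ _ _ _)).
Qed.

Lemma row_surj n (v : Res (Ind M) n) :
  exists w (m : 'I_l -> M n), v = S n w + \sum_(a < l) cup a n (m a).
Proof.
have [w [m ->]] := mackey_surj f0 fK v.
case: n v w m => [|n] v w m; exists w, m; symmetry; first exact: row_mackey0.
exact: row_mackey_succ.
Qed.

Lemma S_row n (w : Ind (Res M) n) : S n w = S n w + \sum_(a < l) cup a n 0.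
Proof. by rewrite big1 ?addr0 // => a _; apply: linear0. Qed.

Lemma cup_row (b : 'I_l) n (m : M n) :
  cup b n m = S n 0 + \sum_(a < l) cup a n (if a == b then m else 0).
Proof.
rewrite linear0 add0r (bigD1 b isT) eqxx big1 => [|a /negbTE ->].
  exact: (esym (addr0 _)).
exact: (linear0 (cup a n)).
Qed.

Lemma rel_L_sigma (F : 'I_(pos_part c) -> term [:: Up; Down] [:: Up; Down]) :
  app (TmAdd (TmComp (TmGen k (GL c)) (sigma_plus k c))
     (\big[@TmAdd _ _ _ _ _/TmZero k (heis_gen c) _ _]_(a < pos_part c) F a)) M
  = app (TmId k (heis_gen c) [:: Up; Down]) M.
Proof.
have E : hcomp C L S = idm C (Ind (Res M)).
  apply: gr_ext => n v; exact: (etrans (f_equal (L n) (S_row v)) (L_row _ _)).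
rewrite (big_empty_ord _ _ _ cpos); exact: (etrans (hadd0 _) E).
Qed.

Lemma interp_sum_val a b m (F : 'I_m -> term a b) n v :
  app (\big[@TmAdd _ _ _ _ _/TmZero k (heis_gen c) a b]_(i < m) F i) M n v
  = \sum_(i < m) app (F i) M n v.
Proof. exact: (big_morph (fun g => app g M n v)). Qed.

Lemma rel_sigma_L :
  app (TmAdd (TmComp (sigma_plus k c) (TmGen k (GL c)))
     (\big[@TmAdd _ _ _ _ _/TmZero k (heis_gen c) _ _]_(a < neg_part c)
        TmComp (dot_cup k c a) (TmGen k (@Geps c a)))) M
  = app (TmId k (heis_gen c) [:: Down; Up]) M.
Proof.
have sum_eq (V : nmodType) m (e : m = l) (F : 'I_m -> V) (G : 'I_l -> V) :
    (forall (a : 'I_m) (b : 'I_l), a = b :> nat -> F a = G b) -> \sum_(a < m) F a = \sum_(b < l) G b.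
  by move=> FG; subst m; apply: eq_bigr => a _; apply: FG.
apply: (gr_ext (M := Res (Ind M)) (N := Res (Ind M))) => n v.
have [w [m vE]] := row_surj v.
have E1 : S n (L n v) = S n w by rewrite vE L_row.
have E2 : \sum_(a < neg_part c) cup a n (eps a n v) = \sum_(a < l) cup a n (m a).
  apply: (sum_eq _ _ cneg) => a b ab; rewrite vE (eps_row _ _ ab).
  by rewrite ab.
have E := interp_sum_val (fun a : 'I_(neg_part c) =>
  TmComp (dot_cup k c a) (TmGen k (@Geps c a))) v.
exact: (etrans (f_equal2 (fun a b : Res (Ind M) n => a + b) E1 (etrans E E2)) (esym vE)).
Qed.

Lemma rel_L_cup (a : 'I_(neg_part c)) :
  app (TmComp (TmGen k (GL c)) (dot_cup k c a)) M
  = app (TmZero k (heis_gen c) [::] [:: Up; Down]) M.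
Proof.
apply: (gr_ext (M := M) (N := Ind (Res M))) => n v.
exact: (etrans (f_equal (L n) (cup_row (cast_ord cneg a) v)) (L_row _ _)).
Qed.

Lemma rel_eps_sigma (a : 'I_(neg_part c)) :
  app (TmComp (TmGen k (@Geps c a)) (sigma_plus k c)) M
  = app (TmZero k (heis_gen c) [:: Up; Down] [::]) M.
Proof.
apply: (gr_ext (M := Ind (Res M)) (N := M)) => n v.
exact: (etrans (f_equal (eps a n) (S_row v)) (eps_row (b := cast_ord cneg a) _ _ erefl)).
Qed.

Lemma rel_eps_cup (a b : 'I_(neg_part c)) :
  app (TmComp (TmGen k (@Geps c a)) (dot_cup k c b)) M
  = app (if a == b then TmId k (heis_gen c) [::] else TmZero k (heis_gen c) [::] [::]) M.
Proof.
apply: (gr_ext (M := M) (N := M)) => n v.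
have E := etrans (f_equal (eps a n) (cup_row (cast_ord cneg b) v))
  (eps_row (b := cast_ord cneg a) _ _ erefl).
apply: (etrans E); rewrite (inj_eq (@cast_ord_inj _ _ _)).
by case: (a == b).
Qed.

Lemma scaleNscale (B : pzalg k) (V : lmodType B) (x y : k) (v : V) :
  scal B x *: - (scal B y *: v) = scal B (- (x * y)) *: v.
Proof. by rewrite scalerN scalerA -rmorphM rmorphN scaleNr. Qed.

(** The value is - t^-1 z^-1 times the component of index 0 of X^l (x) v, which is
   - t^2 v by [mackey_top]. *)
Lemma rel_bubble_neg (a : 'I_(neg_part c)) : a = 0%N :> nat ->
  app (TmComp (TmScale (- (uinv t * uinv z)) (TmGen k (@Geps c a)))
    (dot_cup k c (neg_part c))) M
  = app (TmScale (uval t * uinv z) (TmId k (heis_gen c) [::])) M.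
Proof.
move=> a0; apply: (gr_ext (M := M) (N := M)) => n v.
have l0 : (0 < l)%N by rewrite -cneg; apply: leq_ltn_trans (ltn_ord a).
pose b : 'I_l := cast_ord cneg a.
have [w [m' [E z0]]] := mackey_top f0 fK v l0.
have Ecup : cup (neg_part c) n v = mackey w m'.
  exact: (etrans (cup_val _ _) (etrans (f_equal (fun q => tpure (iota n) (X_ n ^+ q) v) cneg) E)).
have Eeps : eps a n (mackey w m') = - (scal (A n) (f ord_max) *: v).
  exact: (etrans (mackey_mE f0 fK b w m') (z0 b a0)).
have E1 := f_equal (fun u : M n => scal (A n) (- (uinv t * uinv z)) *: u)
  (etrans (f_equal (eps a n) Ecup) Eeps).
have tz : - (- (uinv t * uinv z) * f ord_max) = uval t * uinv z.
  rewrite fl mulNr opprK expr2 mulrACA (mulrC (uinv t)) uvalK mul1r.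
  by rewrite mulrC.
exact: (etrans E1 (etrans (scaleNscale _ _ v) (f_equal (fun q => scal (A n) q *: v) tz))).
Qed.

(** For l = 0 the polynomial f is 1. *)
Lemma hecke_unit_trivial n : l = 0%N -> (1 : A n.+1) = 0.
Proof.
move=> l0; have E (B : pzalg k) (y : B) : poly_eval f y = 1.
  rewrite (poly_eval_coef f0) big1 => [|i _]; last by have := ltn_ord i; rewrite {2}l0.
  by rewrite addr0 l0 expr0.
exact: (etrans (esym (E (A n.+1) _)) (gx_f z f (ltn0Sn n))).
Qed.

(** In positive degrees all modules are zero.  In degree 0 the left side factors through
   ind res, which is zero there, and the scalar on the right vanishes because t^2 is
   both the first and the last coefficient of f. *)
Lemma rel_bubble0 : l = 0%N ->
  app (TmComp hd (TmScale (uval t) (TmComp (TmGen k (GL c)) hc))) M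
  = app (TmScale (uval t * uinv z - uinv t * uinv z) (TmId k (heis_gen c) [::])) M.
Proof.
move=> l0; apply: (gr_ext (M := M) (N := M)) => -[|n] v; last first.
  have triv (B : pzRingType) (V : lmodType B) (u u' : V) : (1 : B) = 0 -> u = u'.
    by move=> E; rewrite -[u]scale1r -[u']scale1r E !scale0r.
  exact: triv (hecke_unit_trivial n l0).
have tt : uval t * uinv z - uinv t * uinv z = 0.
  have t2 : uval t ^+ 2 = 1.
    by rewrite -fl -f0; congr (f _); apply/val_inj; rewrite /= l0.
  have -> : uinv t = uval t.
    by rewrite -[uinv t]mul1r -t2 expr2 -mulrA uvalK mulr1.
  exact: subrr.
have E : scal (A 0%N) (uval t * uinv z - uinv t * uinv z) *: v = 0.
  by rewrite tt rmorph0 scale0r.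
exact: esym E.
Qed.

End Relations.

Lemma gen_nat_rel (k : comPzRingType) (z t : ring_unit k) (l : nat) (f : 'I_l.+1 -> k)
    (f0 : f ord0 = 1) (fl : f ord_max = uval t ^+ 2) (c : int)
    (cpos : pos_part c = 0%N) (cneg : neg_part c = l) a b (g h : tm k (heis_gen c) a b) :
  heis_rel z t g h ->
  interp (@gen_nat k z t l f f0 fl c) g = interp (@gen_nat k z t l f f0 fl c) h.
Proof.
have pos0 (i : 'I_(pos_part c)) : False by have := ltn_ord i; rewrite {2}cpos.
case=> [|||||||||i|i|i j|i|i|i j|c0|c0|c0]; apply: nattrans_ext => M; try by case: (pos0 i).
- exact: rel_xxinv.
- exact: rel_xinvx.
- exact: rel_slide.
- exact: rel_quad.
- exact: rel_braid.
- exact: rel_zigzag_up.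
- exact: rel_zigzag_down.
- exact: rel_L_sigma cpos _ _.
- exact: rel_sigma_L cneg _.
- exact: rel_L_cup cneg _ _.
- exact: rel_eps_sigma cneg _ _.
- exact: rel_eps_cup cneg _ _ _.
- exfalso.
  by clear -cpos c0; case: c cpos c0 => [[|p]|q].
- subst c; exact: rel_bubble0.
- case: c cneg cpos c0 {pos0 g h} => [p|q] // cneg cpos _.
  exact: (rel_bubble_neg f0 fl cneg M (a := ord0)).
Qed.

(** * Uniqueness *)

Section LinFunctorTerms.
Variables (k : comPzRingType) (O : Type) (Gen : seq O -> seq O -> Type).
Variable Rel : forall a b, tm k Gen a b -> tm k Gen a b -> Prop.
Variables (D : strict_moncat k) (P : strict_monfunctor (pres_cat Rel) D).

Definition on_term a b (g : tm k Gen a b) : hom D (P a) (P b) := fhom P (tm_cls Rel g).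

Lemma on_id a : on_term (TmId k Gen a) = idm D (P a).
Proof. exact: (fun_id (linfunctorP P) a). Qed.
Lemma on_comp a b c (g : tm k Gen b c) (h : tm k Gen a b) :
  on_term (TmComp g h) = hcomp D (on_term g) (on_term h).
Proof.
by rewrite /on_term -pcompE; apply: (fun_comp (linfunctorP P)).
Qed.
Lemma on_add a b (g h : tm k Gen a b) :
  on_term (TmAdd g h) = hadd D (on_term g) (on_term h).
Proof. by rewrite /on_term -paddE; apply: (fun_add (linfunctorP P)). Qed.
Lemma on_scale a b x (g : tm k Gen a b) : on_term (TmScale x g) = hscale D x (on_term g).
Proof. by rewrite /on_term -pscaleE; apply: (fun_scale (linfunctorP P)). Qed.
Lemma on_ten a b c d (g : tm k Gen a b) (h : tm k Gen c d) :
  arr_eq (on_term (TmTen g h)) (hten D (on_term g) (on_term h)).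
Proof. by rewrite /on_term -ptenE; apply: (monfun_hten P). Qed.
Lemma on_rel a b (g h : tm k Gen a b) : Rel g h -> on_term g = on_term h.
Proof. by move=> gh; rewrite /on_term (tm_clsP (tm_eq_rel gh)). Qed.
Lemma on_zero a b : on_term (TmZero k Gen a b) = hzero D (P a) (P b).
Proof.
apply: (hadd_cancel (g := on_term (TmZero k Gen a b))).
rewrite -on_add (kmod_add0 (hom_kmodule D _ _)) /on_term.
by rewrite (tm_clsP (tm_eq_add0 Rel _)).
Qed.
Lemma on_opp a b (g : tm k Gen a b) : on_term (TmOpp g) = hopp D (on_term g).
Proof.
apply: (hadd_cancel (g := on_term g)).
rewrite -on_add (kmod_addN (hom_kmodule D _ _)) -on_zero /on_term.
by rewrite (tm_clsP (tm_eq_addN Rel _)).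
Qed.
Lemma on_sum a b m (F : 'I_m -> tm k Gen a b) :
  on_term (\big[@TmAdd _ _ _ _ _/TmZero k Gen a b]_(i < m) F i)
  = \big[hadd D/hzero D (P a) (P b)]_(i < m) on_term (F i).
Proof. exact: (big_morph _ (@on_add a b) (on_zero a b)). Qed.
End LinFunctorTerms.

Section Agreement.
Variables (k : comPzRingType) (O : Type) (Gen : seq O -> seq O -> Type).
Variable Rel : forall a b, tm k Gen a b -> tm k Gen a b -> Prop.
Variables (D : strict_moncat k) (P Q : strict_monfunctor (pres_cat Rel) D).
Hypothesis PQ_obj : forall o, P [:: o] = Q [:: o].

Definition agree a b (g : tm k Gen a b) := arr_eq (on_term P g) (on_term Q g).

Lemma words_agree w : P w = Q w.
Proof.
elim: w => [|o w IH]; first by rewrite (monfun_unit P) (monfun_unit Q).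
by rewrite [LHS](monfun_ten P [:: o] w) PQ_obj IH -(monfun_ten Q).
Qed.

Lemma agree_id a : agree (TmId k Gen a).
Proof. by rewrite /agree !on_id; apply/arr_eq_id/words_agree. Qed.
Lemma agree_comp a b c (g : tm k Gen b c) (h : tm k Gen a b) :
  agree g -> agree h -> agree (TmComp g h).
Proof. by rewrite /agree !on_comp; apply: arr_eq_comp. Qed.
Lemma agree_ten a b c d (g : tm k Gen a b) (h : tm k Gen c d) :
  agree g -> agree h -> agree (TmTen g h).
Proof.
move=> gE hE; apply: arr_eq_trans (on_ten _ _ _) _.
by apply: arr_eq_trans (arr_eq_ten gE hE) _; apply/arr_eq_sym/on_ten.
Qed.

(** Agreement passes from the generators to all formal expressions, and every morphism
   is the class of one. *)
Lemma monfunctor_eq : (forall a b (g : Gen a b), agree (TmGen k g)) -> P = Q.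
Proof.
move=> PQ_gen; have PQ a b (g : tm k Gen a b) : agree g.
  elim: g => {a b} [a b g|a|a b c g Hg h Hh|a b c d g Hg h Hh|a b|a b g Hg h Hh|a b g Hg|a b x g Hg].
  - exact: PQ_gen.
  - exact: agree_id.
  - exact: agree_comp.
  - exact: agree_ten.
  - by rewrite /agree !on_zero; apply: arr_eq_zero; apply: words_agree.
  - by rewrite /agree !on_add; apply: arr_eq_add.
  - by rewrite /agree !on_opp; apply: arr_eq_opp.
  - by rewrite /agree !on_scale; apply: arr_eq_scale.
have := words_agree; move: PQ; clear PQ_obj PQ_gen; rewrite /agree /on_term.
case: P Q => [[F h Fh] uP tP ht] [[F' h' Fh'] uQ tQ ht'] /= PQ FF'.
have EF : F = F' by apply: funext.
subst F'; have Eh : h = h'.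
  apply: functional_extensionality_dep => a; apply: functional_extensionality_dep => b.
  by apply: functional_extensionality_dep; elim/phom_ind => g; apply: arr_eq_eq.
subst h'; rewrite (Prop_irrelevance Fh' Fh) in uQ tQ ht' *.
by congr StrictMonFunctor; apply: Prop_irrelevance.
Qed.

End Agreement.

(** For c <= 0 the generators x^-1, L and eps_a are determined by x, tau, c, d,
   being entries of inverses of matrices in these. *)
Section HeisenbergAgreement.
Variables (k : comPzRingType) (z t : ring_unit k) (c : int).
Hypothesis cpos : pos_part c = 0%N.
Variables (D : strict_moncat k) (P Q : strict_monfunctor (Heis z t c) D).
Hypothesis PQ_obj : forall o, P [:: o] = Q [:: o].

Local Notation term := (tm k (heis_gen c)).
Local Notation onP g := (@on_term k dir (heis_gen c) (@heis_rel k z t c) D P _ _ g).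
Local Notation onQ g := (@on_term k dir (heis_gen c) (@heis_rel k z t c) D Q _ _ g).
Local Notation agree g := (@agree k dir (heis_gen c) (@heis_rel k z t c) D P Q _ _ g).

(** The objects P a and Q a are equal but not convertible; composing values of Q with
   values of P requires a transport. *)
Definition transport a b (g : term a b) : hom D (P a) (P b) :=
  cast_hom (esym (words_agree PQ_obj a)) (esym (words_agree PQ_obj b)) (onQ g).

Lemma transport_eq a b (g : term a b) : arr_eq (transport g) (onQ g).
Proof. exact: arr_eq_cast. Qed.

Lemma agreeP a b (g : term a b) : agree g <-> onP g = transport g.
Proof.
split=> [E|E]; first by apply: arr_eq_eq; apply: arr_eq_trans E (arr_eq_sym (transport_eq g)).
exact: (eq_ind_r (fun h => arr_eq h (onQ g)) (transport_eq g) E).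
Qed.

Lemma transport_comp a b d (g : term b d) (h : term a b) :
  transport (TmComp g h) = hcomp D (transport g) (transport h).
Proof.
apply: arr_eq_eq; apply: arr_eq_trans (transport_eq _) _; rewrite on_comp.
by apply: arr_eq_comp; apply/arr_eq_sym/transport_eq.
Qed.
Lemma transport_zero a b : transport (TmZero k _ a b) = hzero D (P a) (P b).
Proof.
apply: arr_eq_eq; apply: arr_eq_trans (transport_eq _) _; rewrite on_zero.
by apply: arr_eq_zero; apply/esym/words_agree.
Qed.
Lemma transport_id a : transport (TmId k _ a) = idm D (P a).
Proof.
apply: arr_eq_eq; apply: arr_eq_trans (transport_eq _) _; rewrite on_id.
by apply: arr_eq_id; apply/esym/words_agree.
Qed.
Lemma transport_rel a b (g h : term a b) : heis_rel z t g h -> transport g = transport h.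
Proof. by move=> gh; rewrite /transport (on_rel Q gh). Qed.

Hypotheses (PQ_x : agree (TmGen k (Gx c))) (PQ_tau : agree (TmGen k (Gtau c)))
  (PQ_c : agree (TmGen k (Gc c))) (PQ_d : agree (TmGen k (Gd c))).

Lemma agree_sigma : agree (sigma_plus k c).
Proof.
have up := agree_id PQ_obj [:: Up]; have down := agree_id PQ_obj [:: Down].
exact: (agree_comp (agree_ten (agree_ten down up) PQ_d)
  (agree_comp (agree_ten (agree_ten down PQ_tau) down)
    (agree_ten (agree_ten PQ_c up) down))).
Qed.

Lemma agree_cup a : agree (dot_cup k c a).
Proof.
have agree_xpow : agree (xpow k c a).
  by elim: a => [|a IH]; [apply: agree_id | apply: agree_comp].
exact: (agree_comp (agree_ten (agree_id PQ_obj [:: Down]) agree_xpow) PQ_c).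
Qed.

Lemma agree_xinv : agree (TmGen k (Gxinv c)).
Proof.
apply/agreeP; have xE := (agreeP _).1 PQ_x.
rewrite -[RHS](Defs.compIm) -on_id -(on_rel P (Heis_xinvx z t c)) on_comp xE.
by rewrite -Defs.compA -transport_comp (transport_rel (Heis_xxinv z t c)) transport_id Defs.compmI.
Qed.

(** By the relation on sigma_+ L, the row (sigma_+, cups) is a split epimorphism. *)
Lemma row_epi Y (u v : hom D (P [:: Down; Up]) Y) :
  hcomp D u (onP (sigma_plus k c)) = hcomp D v (onP (sigma_plus k c)) ->
  (forall a : 'I_(neg_part c),
     hcomp D u (onP (dot_cup k c a)) = hcomp D v (onP (dot_cup k c a))) -> u = v.
Proof.
move=> us ua; rewrite -[u]Defs.compmI -[v]Defs.compmI -on_id -(on_rel P (Heis_sigma_L z t c)).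
rewrite on_add on_comp on_sum !Defs.compDr !Defs.compA us; congr (hadd D _ _).
have comp_sum w (F : 'I_(neg_part c) -> hom D (P [:: Down; Up]) (P [:: Down; Up])) :
    hcomp D w (\big[hadd D/hzero D _ _]_(i < neg_part c) F i)
    = \big[hadd D/hzero D _ Y]_(i < neg_part c) hcomp D w (F i).
  by apply: big_morph => [g h|]; [apply: Defs.compDr | apply: hcomp0r].
by rewrite !comp_sum; apply: eq_bigr => a _; rewrite on_comp !Defs.compA ua.
Qed.

Lemma agree_L : agree (TmGen k (GL c)).
Proof.
apply/agreeP; have sE := (agreeP _).1 agree_sigma.
have R := Heis_L_sigma z t c; rewrite (big_empty_ord _ _ _ cpos) in R.
apply: row_epi => [|a].
  rewrite -on_comp sE -transport_comp; apply: (hadd_cancel (g := hzero D _ _)).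
  have := on_rel P R; rewrite on_add on_zero on_id => ->; rewrite hadd0.
  have := on_rel Q R; rewrite on_add on_zero on_id hadd0 => E.
  by rewrite -transport_id /transport E on_id.
have aE := (agreeP _).1 (agree_cup a).
rewrite -on_comp aE -transport_comp (on_rel P (Heis_L_cup z t a)).
by rewrite (transport_rel (Heis_L_cup z t a)) on_zero transport_zero.
Qed.

Lemma agree_eps a : agree (TmGen k (Geps a)).
Proof.
apply/agreeP; have sE := (agreeP _).1 agree_sigma.
apply: row_epi => [|b].
  rewrite -on_comp sE -transport_comp (on_rel P (Heis_eps_sigma z t a)).
  by rewrite (transport_rel (Heis_eps_sigma z t a)) on_zero transport_zero.
have bE := (agreeP _).1 (agree_cup b).
rewrite -on_comp bE -transport_comp (on_rel P (Heis_eps_cup z t a b)).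
rewrite (transport_rel (Heis_eps_cup z t a b)).
by case: (a == b); rewrite ?on_zero ?transport_zero ?on_id ?transport_id.
Qed.

Lemma heis_functor_eq : P = Q.
Proof.
apply: (monfunctor_eq PQ_obj) => a b [||||||i|i] //.
- exact: agree_xinv.
- exact: agree_L.
- by have := ltn_ord i; rewrite {2}cpos.
- exact: agree_eps.
Qed.

End HeisenbergAgreement.

(** * Existence and uniqueness of the action *)

Section Action.
Variables (k : comPzRingType) (z t : ring_unit k) (l : nat) (f : 'I_l.+1 -> k).
Hypotheses (f0 : f ord0 = 1) (fl : f ord_max = uval t ^+ 2).
Variable c : int.

Local Notation A := (cyc_hecke z f).
Local Notation C := (Hmod z f).
Local Notation D := (End_cat C).
Local Notation Ind := (HInd z f).
Local Notation Res := (HRes z f).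
Local Notation fK := (f_last_unit fl).

Definition categorical_action (Psi : strict_monfunctor (Heis z t c) D) : Prop :=
  [/\ Psi [:: Up] = Ind, Psi [:: Down] = Res &
  [/\ exists X : nattrans Ind Ind,
        arr_eq (C := D) (fhom Psi (Heis_of z t (Gx c))) X /\
        forall (M : graded_mod A) (n : nat) (u : A n.+1) (v : M n),
          X M n.+1 (u \ot v) = (u * x_last z f n) \ot v,
      exists T : nattrans (comp_functor Ind Ind) (comp_functor Ind Ind),
        arr_eq (C := D) (fhom Psi (Heis_of z t (Gtau c))) T /\
        forall (M : graded_mod A) (n : nat) (u : A n.+2) (v : M n),
          T M n.+2 (u \ot (1 \ot v)) = (u * tau_last z f n) \ot (1 \ot v),
      exists C' : nattrans (id_functor C) (comp_functor Res Ind),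
        arr_eq (C := D) (fhom Psi (Heis_of z t (Gc c))) C' /\
        forall (M : graded_mod A) (n : nat) (v : M n), C' M n v = 1 \ot v
    & exists D' : nattrans (comp_functor Ind Res) (id_functor C),
        arr_eq (C := D) (fhom Psi (Heis_of z t (Gd c))) D' /\
        forall (M : graded_mod A) (n : nat) (u : A n.+1) (v : M n.+1),
          D' M n.+1 (u \ot (v : res_mod (H_incl z f n) (M n.+1))) = u *: v]].

Lemma categorical_action_unique (P Q : strict_monfunctor (Heis z t c) D) :
  pos_part c = 0%N -> categorical_action P -> categorical_action Q -> P = Q.
Proof.
move=> cpos [Pu Pd [[X [PX XE]] [T [PT TE]] [U [PU UE]] [V [PV VE]]]].
move=> [Qu Qd [[X' [QX XE']] [T' [QT TE']] [U' [QU UE']] [V' [QV VE']]]].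
have tr a b (g : heis_gen c a b) (F G : linfunctor C C) (n m : nattrans F G) :
    n = m -> arr_eq (C := D) (fhom P (Heis_of z t g)) n ->
    arr_eq (C := D) (fhom Q (Heis_of z t g)) m ->
    arr_eq (C := D) (fhom P (Heis_of z t g)) (fhom Q (Heis_of z t g)).
  by move=> -> h1 h2; apply: arr_eq_trans h1 (arr_eq_sym h2).
apply: (heis_functor_eq cpos).
- by case; rewrite ?Pu ?Qu ?Pd ?Qd.
- apply: tr PX QX; apply: nattrans_ext => M.
  apply: (gr_ind_ext (M := M) (N := Ind M)) => n u v.
  exact: (etrans (XE M n u v) (esym (XE' M n u v))).
- apply: tr PT QT; apply: nattrans_ext => M.
  apply: (gr_indind_ext (M := M) (N := Ind (Ind M))) => n u v.
  exact: (etrans (TE M n u v) (esym (TE' M n u v))).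
- apply: tr PU QU; apply: nattrans_ext => M.
  apply: (gr_ext (M := M) (N := Res (Ind M))) => n v.
  exact: (etrans (UE M n v) (esym (UE' M n v))).
- apply: tr PV QV; apply: nattrans_ext => M.
  apply: (gr_ind_ext (M := Res M) (N := M)) => n u v.
  exact: (etrans (VE M n u v) (esym (VE' M n u v))).
Qed.

Lemma categorical_action_exists :
  pos_part c = 0%N -> neg_part c = l -> exists Psi, categorical_action Psi.
Proof.
move=> cpos cneg.
have rel := @gen_nat_rel k z t l f f0 fl c cpos cneg.
pose Psi : strict_monfunctor (Heis z t c) D := pres_functor rel.
have onG a b (g : heis_gen c a b) :
    fhom Psi (Heis_of z t g) = gen_nat z f0 fl g := pres_homE rel (TmGen k g).
exists Psi; split; [exact: comp_functorx1|exact: comp_functorx1|split].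
- exists (nat_x z f0 fK); split; first by rewrite onG; apply: nattrans_arr_eq.
  move=> M n u v; exact: (etrans (rmul_pure _ _ _)
    (f_equal (fun y => tpure (H_incl z f n) (u * y) v) (esym (gx_last z f n)))).
- exists (nat_tau z f0 fK); split; first by rewrite onG; apply: nattrans_arr_eq.
  move=> M n u v; rewrite [LHS]tau_map_pure rmorph1 mulr1.
  exact: (f_equal (fun y => tpure (H_incl z f n.+1) (u * y) (tpure (H_incl z f n) 1 v))
    (esym (gtau_last z f n))).
- exists (nat_c z f); split; first by rewrite onG; apply: nattrans_arr_eq.
  by [].
- exists (nat_d z f); split; first by rewrite onG; apply: nattrans_arr_eq.
  move=> M n u v; exact: d_gr_pure.
Qed.

End Action.
Theorem theorem6p2 (k : comPzRingType) (z t : ring_unit k)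
    (l : nat) (f : 'I_l.+1 -> k)
    (f_first : f ord0 = 1) (f_last : f ord_max = uval t ^+ 2) :
  exists! Psi : strict_monfunctor (Heis z t (- l%:Z)) (End_cat (Hmod z f)),
    [/\ Psi [:: Up] = HInd z f,
        Psi [:: Down] = HRes z f &
    [/\ (* x *)
        exists X : nattrans (HInd z f) (HInd z f),
          arr_eq (C := End_cat (Hmod z f)) (fhom Psi (Heis_of z t (Gx _))) X /\
          forall (M : graded_mod (cyc_hecke z f)) (n : nat)
                 (u : cyc_hecke z f n.+1) (v : M n),
            X M n.+1 (u \ot v) = (u * x_last z f n) \ot v,
        (* tau *)
        exists T : nattrans (comp_functor (HInd z f) (HInd z f))
                            (comp_functor (HInd z f) (HInd z f)),
          arr_eq (C := End_cat (Hmod z f)) (fhom Psi (Heis_of z t (Gtau _))) T /\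
          forall (M : graded_mod (cyc_hecke z f)) (n : nat)
                 (u : cyc_hecke z f n.+2) (v : M n),
            T M n.+2 (u \ot (1 \ot v)) = (u * tau_last z f n) \ot (1 \ot v),
        (* c *)
        exists C : nattrans (id_functor (Hmod z f))
                            (comp_functor (HRes z f) (HInd z f)),
          arr_eq (C := End_cat (Hmod z f)) (fhom Psi (Heis_of z t (Gc _))) C /\
          forall (M : graded_mod (cyc_hecke z f)) (n : nat) (v : M n),
            C M n v = 1 \ot v
        & (* d *)
        exists D : nattrans (comp_functor (HInd z f) (HRes z f))
                            (id_functor (Hmod z f)),
          arr_eq (C := End_cat (Hmod z f)) (fhom Psi (Heis_of z t (Gd _))) D /\
          forall (M : graded_mod (cyc_hecke z f)) (n : nat)
                 (u : cyc_hecke z f n.+1) (v : M n.+1),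
            D M n.+1 (u \ot (v : res_mod (H_incl z f n) (M n.+1))) = u *: v]].

Proof.
have [cpos cneg] : pos_part (- l%:Z) = 0%N /\ neg_part (- l%:Z) = l by case: (l).
have [Psi PsiP] := categorical_action_exists z f_first f_last cpos cneg.
exists Psi; split=> [|Psi' Psi'P]; first exact: PsiP.
exact: categorical_action_unique cpos PsiP Psi'P.
Qed.
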